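(* Let $F\subset \mathbb{R}^2$ be a shaved indecomposable set. Then the topological closure $\bar{F}$ of $F$ satisfies $$\|\chi_{F}-\chi_{\bar{F}}\|_{BV(\mathbb{R}^2)}=0 .$$ Consequently, for every indecomposable set $F\subset\mathbb{R}^2$ there is a closed set $\mathbb{F}\subset\mathbb{R}^2$ with $\|\chi_{F}-\chi_{\mathbb{F}}\|_{BV(\mathbb{R}^2)}=0$.
   Context: $\chi_A$ denotes the characteristic function of $A$, $|A|$ denotes Lebesgue measure, and $B_r(x)$ is the ball of radius $r$ centred at $x$. The norm is $\|u\|_{BV(\mathbb{R}^2)}=\|u\|_{L^1(\mathbb{R}^2)}+|Du|(\mathbb{R}^2)$. A measurable set $E\subset\mathbb{R}^n$ is of finite perimeter if $\mathrm{Per}(E):=\sup\{\int_E \mathrm{div}\,\phi : \phi\in [C^1_c(\mathbb{R}^n)]^n,\ \|\phi\|_\infty\le 1\}<\infty$. A set $E$ of finite perimeter is indecomposable if whenever $E=A\cup B$ with $A,B$ disjoint and $\mathrm{Per}(E)=\mathrm{Per}(A)+\mathrm{Per}(B)$, then $|A|=0$ or $|B|=0$. For a set $E$ let $\mathrm{Neg}(E):=\{x\in E: |B_r(x)\cap E|=0 \text{ for some } r>0\}$; a set $F$ is shaved if $\mathrm{Neg}(F)=\emptyset$. *)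

(* Defs.v *)
From HB Require Import structures.
From mathcomp Require Import all_boot all_order all_algebra.
From mathcomp Require Import all_classical all_reals all_analysis.

Set Implicit Arguments.
Unset Strict Implicit.
Unset Printing Implicit Defensive.

Import Order.TTheory GRing.Theory Num.Theory.
Import numFieldNormedType.Exports.

Local Open Scope classical_set_scope.
Local Open Scope ring_scope.
Local Open Scope ereal_scope.

(* The plane is [R * R] for [R : realType], with its product topology. *)

Section planar_bv.
Variable R : realType.
Implicit Types (E F : set (R * R)) (phi : R * R -> R * R) (u : R * R -> R).

(* [lebesgue_measure] lives on the Borel sets, so the product measure only
   measures Borel sets of the plane; its completion (by Caratheodory extension)
   is the measure on all Lebesgue measurable sets. *)
Definition borel_measure2 :
    {measure set (measurableTypeR R * measurableTypeR R) -> \bar R} :=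
  lebesgue_measure \x lebesgue_measure.

Definition lebesgue_measure2 :=
  @completed_measure_extension _ _ _ borel_measure2.

HB.instance Definition _ := Measure.on lebesgue_measure2.

Definition lebesgue_measurable2 E :=
  ((borel_measure2)^*)%mu.-cara.-measurable E.

(* The library's norm and [ball] on [R * R] are those of the sup norm. *)
Definition enorm (x : R * R) : R := Num.sqrt (x.1 ^+ 2 + x.2 ^+ 2)%R.

Definition eball (x : R * R) (r : R) : set (R * R) :=
  [set y | (enorm (y - x) < r)%R].

Definition continuously_differentiable phi :=
  (forall x, differentiable phi x) /\ (forall v, continuous ('D_v phi)).

Definition compactly_supported phi := compact (closure [set x | phi x != 0%R]).

Definition test_field phi :=
  [/\ continuously_differentiable phi, compactly_supported phi &
      forall x, (enorm (phi x) <= 1)%R].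

Definition div phi (x : R * R) : R :=
  ('D_(1, 0) (fun y => (phi y).1) x + 'D_(0, 1) (fun y => (phi y).2) x)%R.

Definition Per E : \bar R :=
  ereal_sup [set \int[lebesgue_measure2]_(x in E) (div phi x)%:E
            | phi in test_field].

Definition finite_perimeter E := lebesgue_measurable2 E /\ Per E < +oo.

(* [A] and [B] range over measurable sets, those for which [Per] is meant. *)
Definition indecomposable E :=
  finite_perimeter E /\
  forall A B, lebesgue_measurable2 A -> lebesgue_measurable2 B ->
    E = A `|` B -> A `&` B = set0 -> Per E = Per A + Per B ->
    lebesgue_measure2 A = 0 \/ lebesgue_measure2 B = 0.

Definition Neg E : set (R * R) :=
  [set x | E x /\
    exists r : R, (0 < r)%R /\
      lebesgue_measure2 (eball x r `&` E) = 0].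

Definition shaved F := Neg F = set0.

(* [|Du|(R^2)], in its variational form. *)
Definition total_variation2 u : \bar R :=
  ereal_sup [set \int[lebesgue_measure2]_x (u x * div phi x)%:E
            | phi in test_field].

Definition BV_norm u : \bar R :=
  \int[lebesgue_measure2]_x `|(u x)%:E| + total_variation2 u.

End planar_bv.

(* Main.v *)
(* Let F be indecomposable and let G be its essential support, a closed set that
   is the closure of F when F is shaved; F \ G is null by Lindeloef. Suppose
   that G \ F has positive measure. A fine grid of mesh l then contains at least
   c / l^2 squares Q in which F has very small density although the centre of Q
   meets G. Cutting F along a rectangle inside Q that F does not charge would
   decompose F, so F meets almost every line of one of the four strips along the
   sides of Q. As F has small density, these lines cross the reduced boundary,
   which yields a test field supported in Q with integral over F at least c l.
   Adding up over the squares gives Per F >= c / l, absurd as l -> 0. *)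
Require Import Defs.
From HB Require Import structures.
From mathcomp Require Import all_boot all_order all_algebra.
From mathcomp Require Import all_classical all_reals all_analysis.
From mathcomp Require Import measurable_realfun.
From mathcomp Require Import ring lra.
Import numFieldNormedType.Exports.

Set Implicit Arguments.
Unset Strict Implicit.
Unset Printing Implicit Defensive.

Import Order.TTheory GRing.Theory Num.Theory.

Local Open Scope classical_set_scope.
Local Open Scope ring_scope.

(** * Continuously differentiable functions *)

Section C1.
Variable R : realType.

(** The reduced boundary stays heuristic: perimeter enters only as a supremum over test fields, and
    its lower bounds come from explicit fields. In a strip these are fields [(0, - g)]. Their
    divergence contains no derivative in the first variable, so cutoffs in that variable may be
    arbitrarily steep; this permits a separate choice of profile on each vertical line. A good line
    gains 1/8, and finitely many profiles serve half of the lines of a strip of width l/4, which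
    gives l/64. A mass of at most l^2/512 and the smoothing error cost l/256 each, and l/128
    remains. With m the area of G \ F in a large box, at least m / (2 l^2) squares force Per F >= m
    / (256 l). Cutting also follows the definition of [Per]: gluing two fields by a cutoff of slope
    O(1/e) costs the mass of the set in the frame divided by e. A Lebesgue point where the slice
    mass vanishes makes this cost o(1), so the perimeter splits exactly. F is only Lebesgue
    measurable, while Fubini and Lebesgue density are applied to Borel sets; a Borel set E
    containing F, with null difference, replaces F in the integrals. *)

Definition C1 (V W : normedModType R) (f : V -> W) :=
  (forall x, differentiable f x) /\ (forall v, continuous ('D_v f)).

Lemma C1_continuous (V W : normedModType R) (f : V -> W) : C1 f -> continuous f.
Proof. by move=> [df _] x; exact: differentiable_continuous. Qed.

Lemma C1_cst (V W : normedModType R) (a : W) : C1 (fun _ : V => a).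
Proof.
split=> [x|v x]; first exact: differentiable_cst.
rewrite (_ : 'D_v _ = cst 0); first exact: cst_continuous.
by apply/funext => y; rewrite derive_cst.
Qed.

Lemma C1D (V W : normedModType R) (f g : V -> W) :
  C1 f -> C1 g -> C1 (fun x => f x + g x).
Proof.
move=> [df cf] [dg cg]; split=> [x|v x]; first exact: differentiableD.
rewrite (_ : 'D_v _ = fun y => 'D_v f y + 'D_v g y); last first.
  by apply/funext => y; rewrite deriveD//; exact: diff_derivable.
by apply: cvgD; [exact: cf|exact: cg].
Qed.

Lemma C1N (V W : normedModType R) (f : V -> W) : C1 f -> C1 (fun x => - f x).
Proof.
move=> [df cf]; split=> [x|v x]; first exact: differentiableN.
rewrite (_ : 'D_v _ = fun y => - 'D_v f y); last first.
  by apply/funext => y; rewrite deriveN//; exact: diff_derivable.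
by apply: cvgN; exact: cf.
Qed.

Lemma C1B (V W : normedModType R) (f g : V -> W) :
  C1 f -> C1 g -> C1 (fun x => f x - g x).
Proof. by move=> f1 g1; apply: C1D => //; exact: C1N. Qed.

Lemma C1M (V : normedModType R) (f g : V -> R) :
  C1 f -> C1 g -> C1 (fun x => f x * g x).
Proof.
move=> f1 g1; have cf' := C1_continuous f1; have cg' := C1_continuous g1.
move: f1 g1 => [df cf] [dg cg]; split=> [x|v x]; first exact: differentiableM.
rewrite (_ : 'D_v _ = fun y => f y * 'D_v g y + g y * 'D_v f y); last first.
  by apply/funext => y; rewrite deriveM//; exact: diff_derivable.
apply: cvgD.
  by apply: cvgM; [exact: cf'|exact: cg].
by apply: cvgM; [exact: cg'|exact: cf].
Qed.

Lemma C1_pair (V : normedModType R) (f g : V -> R) :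
  C1 f -> C1 g -> C1 (fun x => (f x, g x)).
Proof.
move=> [df cf] [dg cg]; split=> [x|v x]; first exact: differentiable_pair.
rewrite (_ : 'D_v _ = fun y => ('D_v f y, 'D_v g y)); last first.
  apply/funext => y; rewrite deriveE; last exact: differentiable_pair.
  by rewrite diff_pair//= -!deriveE.
exact: (cvg_pair (cf v x) (cg v x)).
Qed.

Lemma C1_linear (V W : normedModType R) (f : {linear V -> W}) :
  continuous f -> C1 f.
Proof.
move=> cf; split=> [x|v x]; first exact: linear_differentiable.
rewrite (_ : 'D_v _ = cst (f v)); first exact: cst_continuous.
apply/funext => y; rewrite deriveE; last exact: linear_differentiable.
by rewrite diff_lin.
Qed.

Lemma derive_linear (V W : normedModType R) (f : {linear V -> W}) v x :
  continuous f -> 'D_v f x = f v.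
Proof.
move=> cf; rewrite deriveE; last exact: linear_differentiable.
by rewrite diff_lin.
Qed.

Lemma derive_comp_linear (U V W : normedModType R) (f : V -> W)
    (l : {linear U -> V}) v x : continuous l -> differentiable f (l x) ->
  'D_v (fun y => f (l y)) x = 'D_(l v) f (l x).
Proof.
move=> cl df.
have dl : differentiable l x by exact: linear_differentiable.
rewrite (_ : (fun y => f (l y)) = f \o l)//.
rewrite deriveE; last exact: differentiable_comp.
by rewrite diff_comp//= diff_lin// -deriveE.
Qed.

Lemma C1_comp_linear (U V W : normedModType R) (f : V -> W)
    (l : {linear U -> V}) : continuous l -> C1 f -> C1 (fun x => f (l x)).
Proof.
move=> cl [df cf]; split=> [x|v x].
  by apply: differentiable_comp; [exact: linear_differentiable|exact: df].
rewrite (_ : 'D_v _ = fun y => 'D_(l v) f (l y)); last first.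
  by apply/funext => y; rewrite derive_comp_linear.
exact: (continuous_comp (cl x) (cf (l v) (l x))).
Qed.

Lemma derive_linear_comp (U V W : normedModType R) (f : U -> V)
    (l : {linear V -> W}) v x : continuous l -> differentiable f x ->
  'D_v (fun y => l (f y)) x = l ('D_v f x).
Proof.
move=> cl df.
have dl : differentiable l (f x) by exact: linear_differentiable.
rewrite (_ : (fun y => l (f y)) = l \o f)//.
rewrite deriveE; last exact: differentiable_comp.
by rewrite diff_comp//= diff_lin// -deriveE.
Qed.

Lemma C1_linear_comp (U V W : normedModType R) (f : U -> V)
    (l : {linear V -> W}) : continuous l -> C1 f -> C1 (fun x => l (f x)).
Proof.
move=> cl [df cf]; split=> [x|v x].
  by apply: differentiable_comp; [exact: df|exact: linear_differentiable].
rewrite (_ : 'D_v _ = fun y => l ('D_v f y)); last first.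
  by apply/funext => y; rewrite derive_linear_comp.
exact: (continuous_comp (cf v x) (cl ('D_v f x))).
Qed.

Lemma derive_comp1 (V : normedModType R) (g : V -> R) (f f' : R -> R) v x :
  (forall t : R, is_derive t (1 : R) f (f' t)) -> differentiable g x ->
  'D_v (fun y => f (g y)) x = f' (g x) * 'D_v g x.
Proof.
move=> ff' dg.
have df t : differentiable f t by apply/derivable1_diffP; have [] := ff' t.
rewrite (_ : (fun y => f (g y)) = f \o g)//.
rewrite deriveE; last exact: differentiable_comp.
rewrite diff_comp//= diff1E// derive1E derive_val.
by rewrite -deriveE// [LHS]mulrC.
Qed.

Lemma C1_comp1 (V : normedModType R) (g : V -> R) (f f' : R -> R) :
  (forall t : R, is_derive t (1 : R) f (f' t)) -> continuous f' -> C1 g ->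
  C1 (fun x => f (g x)).
Proof.
move=> ff' cf' g1; have cg' := C1_continuous g1.
have df t : differentiable f t by apply/derivable1_diffP; have [] := ff' t.
move: g1 => [dg cg].
split=> [x|v x]; first by apply: differentiable_comp; [exact: dg|exact: df].
rewrite (_ : 'D_v _ = fun y => f' (g y) * 'D_v g y); last first.
  by apply/funext => y; rewrite (derive_comp1 _ ff').
apply: cvgM; last exact: cg.
exact: (continuous_comp (cg' x) (cf' (g x))).
Qed.

End C1.

(** * A C^1 step function with explicit derivative *)

Section smooth_step.
Variable R : realType.
Implicit Types t : R.

(** Squaring removes the corner of [Num.max 0 t]. A combination of three translates has a compactly
    supported tent as derivative. *)
Definition sqpos t : R := (Num.max 0 t) ^+ 2.

Lemma is_derive_sqpos t : is_derive t (1 : R) sqpos (2 * Num.max 0 t).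
Proof.
suff H : h^-1 *: (sqpos (h *: 1 + t) - sqpos t) @[h --> 0^'] --> 2 * Num.max 0 t.
  split; first by apply: cvgP; exact: H.
  by rewrite /derive; exact/cvg_lim.
apply/cvgrPdist_le => e e0.
near=> h.
have h0 : h != 0 by near: h; exact: nbhs_dnbhs_neq.
have he : `|h| <= e.
  near: h; apply: dnbhs0_le => //.
apply: le_trans he.
(* Multiplied by |h|, the claim says that h * 2 max(0, t) differs from the increment of [sqpos] by
   at most h^2; this is polynomial in each of the four sign cases of t and h + t. *)
rewrite -(@ler_pM2l _ `|h|) ?normr_gt0// -normrM mulrBr.
rewrite [X in `|_ - X|](_ : _ = sqpos (h + t) - sqpos t); last first.
  by rewrite /GRing.scale/= mulr1 mulrA mulfV// mul1r.
rewrite -expr2 real_normK ?num_real// /sqpos ler_norml.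
have [t0|t0] := leP 0 t; have [ht0|ht0] := leP 0 (h + t); apply/andP; split; nra.
Unshelve. all: by end_near. Qed.

(* The primitive of a tent function of mass 1 on [0, 1], hence a C^1 step. *)
Definition sstep t : R := 2 * (sqpos t - 2 * sqpos (t - 2^-1) + sqpos (t - 1)).

Definition dsstep t : R :=
  4 * (Num.max 0 t - 2 * Num.max 0 (t - 2^-1) + Num.max 0 (t - 1)).

Lemma sstep_le0 t : t <= 0 -> sstep t = 0.
Proof.
move=> t0; rewrite /sstep /sqpos !(max_idPl _)//; first by ring.
all: lra.
Qed.

Lemma sstep_ge1 t : 1 <= t -> sstep t = 1.
Proof.
move=> t0; rewrite /sstep /sqpos !(max_idPr _)//; first by field.
all: lra.
Qed.

Lemma sstep_itv t : 0 <= sstep t <= 1.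
Proof.
have [t0|t0] := leP t 0; first by rewrite sstep_le0// lexx ler01.
have [t1|t1] := leP 1 t; first by rewrite sstep_ge1// lexx ler01.
rewrite /sstep /sqpos (max_idPr (ltW t0)) (max_idPl (_ : t - 1 <= 0)); last lra.
have [t2|t2] := leP 0 (t - 2^-1); apply/andP; split; nra.
Qed.


Lemma dsstep_itv t : 0 <= dsstep t <= 2.
Proof.
rewrite /dsstep; have [t0|t0] := leP 0 t; have [t1|t1] := leP 0 (t - 1);
  have [t2|t2] := leP 0 (t - 2^-1); apply/andP; split; lra.
Qed.

Lemma dsstep_ge0 t : 0 <= dsstep t. Proof. by have /andP[] := dsstep_itv t. Qed.
Lemma dsstep_le2 t : dsstep t <= 2. Proof. by have /andP[] := dsstep_itv t. Qed.

Lemma dsstep_out t : t <= 0 \/ 1 <= t -> dsstep t = 0.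
Proof.
rewrite /dsstep => t01; have [t0|t0] := leP 0 t; have [t1|t1] := leP 0 (t - 1);
  have [t2|t2] := leP 0 (t - 2^-1); lra.
Qed.

(** The tent has height 2, so it stays above 1 on the middle half of [0, 1]. For this reason
    [dense_subinterval] asks for density on the middle half of an interval. *)
Lemma dsstep_mid t : 4^-1 <= t <= 3 / 4 -> 1 <= dsstep t.
Proof.
move=> /andP[a b]; rewrite /dsstep.
rewrite (max_idPr (_ : 0 <= t)); last lra.
rewrite (max_idPl (_ : t - 1 <= 0)); last lra.
have [t2|t2] := leP 0 (t - 2^-1); lra.
Qed.

Lemma is_derive_sstep t : is_derive t (1 : R) sstep (dsstep t).
Proof.
have sh (a : R) : is_derive t (1 : R) (fun x => sqpos (x - a)) (2 * Num.max 0 (t - a)).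
  have h1 : is_derive t (1 : R) (fun x : R => x - a) 1.
    by apply: is_derive_eq; rewrite subr0.
  have := @is_derive1_comp _ sqpos (fun x : R => x - a) t _ _ (is_derive_sqpos (t - a)) h1.
  by rewrite mulr1.
rewrite (_ : sstep = fun x => 2 *: (sqpos x - 2 *: sqpos (x - 2^-1) + sqpos (x - 1)))//.
have h0 := is_derive_sqpos t.
have h1 := sh 2^-1; have h2 := sh 1.
apply: is_derive_eq.
rewrite /dsstep /GRing.scale/=; ring.
Qed.

Lemma dsstep_continuous : continuous dsstep.
Proof.
have cm (a : R) : continuous (fun t : R => Num.max 0 (t - a)).
  move=> x; apply: (@continuous_max _ _ (fun _ => 0) (fun t : R => t - a)).
    exact: cst_continuous.
  by apply: cvgB; [exact: cvg_id|exact: cvg_cst].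
move=> x; apply: cvgM; first exact: cvg_cst.
apply: cvgD; last exact: cm.
apply: cvgB.
  by have := cm 0; under eq_fun do rewrite subr0; exact.
by apply: cvgM; [exact: cvg_cst|exact: cm].
Qed.

End smooth_step.

(** * Lebesgue measure and integration in the plane *)

Section plane_measure.
Variable R : realType.
Notation mu1 := (@lebesgue_measure R).
Notation mu2 := (borel_measure2 R).
Notation mub := (@lebesgue_measure2 R).
Implicit Types (A E F : set (R * R)).

(** The sigma-algebra of the plane is the product one, generated by rectangles; an open set belongs
    to it as the union of the countably many rational boxes that it contains. *)
Lemma open_measurable2 A : open A -> measurable A.
Proof.
move=> oA.
pose r (x : rat) : R := ratr x.
pose box (i : rat * rat * rat * rat) : set (R * R) :=
  `]r i.1.1.1, r i.1.1.2[ `*` `]r i.1.2, r i.2[.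
have mbox i : measurable (box i) by exact: measurableX.
rewrite (_ : A = \bigcup_(i in [set i | box i `<=` A]) box i).
  rewrite bigcup_mkcond.
  apply: countable_bigcupT_measurable; first exact: countableP.
  by move=> i; case: ifP => // _; exact: measurable0.
apply/seteqP; split => [[x y] Axy|z [i /= iA iz]]; last exact: iA.
have [e /= e0 eA] : nbhs_ball (x, y) A by rewrite nbhs_ballE; exact: open_nbhs_nbhs.
have [a] := @rat_in_itvoo R (x - e) x ltac:(lra); rewrite in_itv/= => /andP[a1 a2].
have [b] := @rat_in_itvoo R x (x + e) ltac:(lra); rewrite in_itv/= => /andP[b1 b2].
have [c] := @rat_in_itvoo R (y - e) y ltac:(lra); rewrite in_itv/= => /andP[c1 c2].
have [d] := @rat_in_itvoo R y (y + e) ltac:(lra); rewrite in_itv/= => /andP[d1 d2].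
exists (a, b, c, d); last first.
  by split => /=; rewrite in_itv/=; apply/andP; split.
move=> [u v] [/=]; rewrite !in_itv/= => /andP[u1 u2] /andP[v1 v2].
apply: eA; split; rewrite /ball/= ltr_distlC /r in u1 u2 v1 v2 *.
  by apply/andP; split; lra.
by apply/andP; split; lra.
Qed.

Lemma closed_measurable2 A : closed A -> measurable A.
Proof. by move=> /closed_openC/open_measurable2/measurableC; rewrite setCK. Qed.

Lemma continuous_measurable_fun2 (f : R * R -> R) :
  continuous f -> measurable_fun setT f.
Proof.
move=> cf mT; apply: (measurability _ (RGenOpens.measurableE R)) => //.
move=> _ [_ [a [b ->] <-]]; rewrite setTI; apply: open_measurable2.
by move/continuousP : cf; apply; exact: interval_open.
Qed.

Lemma lebesgue_measurable2_borel A : measurable A -> lebesgue_measurable2 A.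
Proof. move=> mA; rewrite /lebesgue_measurable2.
exact (@caratheodory_measurable_mu_ext _ R (measurableTypeR R * measurableTypeR R)%type
  (borel_measure2 R) A mA).
Qed.

Lemma lebesgue_measure2_borel A : measurable A -> mub A = mu2 A.
Proof.
move=> mA.
by rewrite /lebesgue_measure2/= /completed_measure_extension measurable_mu_extE.
Qed.

(** The outer measure is an infimum over countable Borel covers. Intersecting covers of excess at
    most 1/(n+1) attains it. *)
Lemma borel_hull_finite A : (mub A < +oo)%E ->
  exists E, [/\ measurable E, A `<=` E & mub E = mub A].
Proof.
move=> Afin.
have fA : mub A \is a fin_num by rewrite ge0_fin_numE// outer_measure_ge0.
have H (n : nat) : exists E, [/\ measurable E, A `<=` E & (mub E <= mub A + (n.+1%:R^-1)%:E)%E].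
  have n0 : (0 < n.+1%:R^-1 :> R) by rewrite invr_gt0.
  move: (fA) => /lb_ereal_inf_adherent => /(_ _ n0)[_/= [B [mB AB] <-] Blt].
  exists (\bigcup_k B k); split => //; first exact: bigcupT_measurable.
  apply: le_trans (ltW Blt).
  apply: le_trans; first exact: (outer_measure_sigma_subadditive (mu2^*)%mu).
  apply: lee_nneseries => k *; first exact: mu_ext_ge0.
  by have /eqP := measurable_mu_extE mu2 (mB k); rewrite eq_le => /andP[].
have [B HB] := choice H.
exists (\bigcap_n B n); split.
- by apply: bigcapT_measurable => n; have [] := HB n.
- by move=> x Ax n _; have [_ + _] := HB n; apply.
- apply/eqP; rewrite eq_le; apply/andP; split; last first.
    by apply: (le_outer_measure (mu2^*)%mu) => x Ax n _; have [_ + _] := HB n; apply.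
  apply/lee_addgt0Pr => _/posnumP[e]; near \oo => n.
  have [_ _ h] := HB n.
  apply: (@le_trans _ _ (mub (B n))).
    by apply: (le_outer_measure (mu2^*)%mu); exact: bigcap_inf.
  apply: (le_trans h); rewrite leeD2l// lee_fin ltW//.
  by near: n; apply: near_infty_natSinv_lt.
Unshelve. all: by end_near. Qed.

Definition sqr_box (M : R) : set (R * R) := `[- M, M] `*` `[- M, M].

Lemma measurable_sqr_box M : measurable (sqr_box M).
Proof. exact: measurableX. Qed.

Lemma sqr_boxP M x : sqr_box M x <-> (`|x.1| <= M /\ `|x.2| <= M).
Proof. by rewrite /sqr_box/= !in_itv/= !ler_norml; split => -[]. Qed.

Lemma sqr_box_fin M : (mu2 (sqr_box M) < +oo)%E.
Proof.
rewrite [ltLHS]product_measure1E//= !lebesgue_measure_itv/=.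
by case: ifP => _; rewrite -?EFinB -?EFinM ?mule0 ?ltry.
Qed.

Lemma sqr_box_ge_norm x : exists n : nat, forall m, (n <= m)%N -> sqr_box m%:R x.
Proof.
exists (Num.truncn (Num.max `|x.1| `|x.2|)).+1 => m nm.
have h : Num.max `|x.1| `|x.2| <= m%:R.
  apply: le_trans (ltW (truncnS_gt _)) _; by rewrite ler_nat.
by apply/sqr_boxP; split; apply: le_trans h; rewrite le_max lexx ?orbT.
Qed.

(** Equality of measures turns into a null difference only when the measures are finite, hence the
    truncation to boxes; the null differences are then collected by subadditivity. The result lets
    integrals over F be computed over a Borel set, in the product measure. *)
Lemma lebesgue_measurable2_hull F : lebesgue_measurable2 F ->
  exists E, [/\ measurable E, F `<=` E & mub (E `\` F) = 0%E].
Proof.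
move=> mF.
have mFn (n : nat) : lebesgue_measurable2 (F `&` sqr_box n%:R).
  apply: measurableI => //; apply: lebesgue_measurable2_borel; exact: measurable_sqr_box.
have fin (n : nat) : (mub (F `&` sqr_box n%:R) < +oo)%E.
  apply: le_lt_trans (sqr_box_fin n%:R).
  rewrite -lebesgue_measure2_borel; last exact: measurable_sqr_box.
  by apply: (le_outer_measure (mu2^*)%mu); exact: subIsetr.
have [E HE] := choice (fun n => borel_hull_finite (fin n)).
exists (\bigcup_n E n); split.
- by apply: bigcupT_measurable => n; have [] := HE n.
- move=> x Fx; have [n nx] := sqr_box_ge_norm x.
  exists n => //; have [_ + _] := HE n; apply; split => //; exact: nx.
- apply/eqP; rewrite eq_le outer_measure_ge0 andbT.
  apply: (@le_trans _ _ (mub (\bigcup_n (E n `\` (F `&` sqr_box n%:R))))).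
    apply: (le_outer_measure (mu2^*)%mu) => x [[n _ Enx] nFx].
    by exists n => //; split => // -[].
  apply: (le_trans (outer_measure_sigma_subadditive (mu2^*)%mu _)).
  rewrite eseries0// => n _ _.
  have [mEn sE eqE] := HE n.
  change (mub (E n `\` (F `&` sqr_box n%:R)) = 0%E).
  rewrite measureD//=; [|exact: lebesgue_measurable2_borel|exact: mFn|by rewrite eqE; exact: fin].
  rewrite setIidr// eqE subee// ge0_fin_numE//; exact: outer_measure_ge0.
Qed.

End plane_measure.

Section plane_integral.
Variable R : realType.
Notation mu1 := (@lebesgue_measure R).
Notation mu2 := (borel_measure2 R).
Notation mub := (@lebesgue_measure2 R).
Implicit Types (A E F : set (R * R)).

Let cT := caratheodory_type ((mu2)^*)%mu.
(** The identity, read as a measurable map from the Caratheodory sigma-algebra to the product one.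
    The pushforward of [mub] along it agrees with [mu2] on Borel sets, so integrals are compared by
    change of variables. *)
Let to_borel : cT -> measurableTypeR R * measurableTypeR R := id.

Let measurable_to_borel : measurable_fun setT to_borel.
Proof. by move=> _ A mA; rewrite setTI; exact: lebesgue_measurable2_borel. Qed.

Lemma measurable_fun_lebesgue2 A (f : R * R -> \bar R) : measurable A ->
  measurable_fun A f -> measurable_fun (A : set cT) f.
Proof.
by move=> mA mf _ B mB; apply: lebesgue_measurable2_borel; exact: mf.
Qed.

Lemma integrable_lebesgue2 A (f : R * R -> \bar R) : measurable A ->
  mu2.-integrable A f -> mub.-integrable A f.
Proof.
move=> mA /integrableP[mf intf]; apply/integrableP; split.
  exact: measurable_fun_lebesgue2.
have := @ge0_integral_pushforward _ _ _ _ _ to_borel measurable_to_borel mub A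
  (fun x => `|f x|%E) mA.
move=> /(_ _ _)/= <-//; last exact: measurableT_comp.
rewrite (eq_measure_integral mu2)//= => B mB _.
exact: lebesgue_measure2_borel.
Qed.

Lemma integral_lebesgue2_borel A (f : R * R -> \bar R) : measurable A ->
  measurable_fun setT f -> mu2.-integrable A f ->
  (\int[mub]_(x in A) f x = \int[mu2]_(x in A) f x)%E.
Proof.
move=> mA mf intf.
have := @integral_pushforward _ _ _ _ _ to_borel measurable_to_borel mub A f mf
  (integrable_lebesgue2 mA intf) mA.
move=> /= <-.
apply: eq_measure_integral => B mB _.
exact: lebesgue_measure2_borel.
Qed.

Lemma integral_lebesgue2_hull F E (f : R * R -> \bar R) :
  lebesgue_measurable2 F -> measurable E -> F `<=` E -> mub (E `\` F) = 0%E ->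
  measurable_fun setT f -> mu2.-integrable E f ->
  (\int[mub]_(x in F) f x = \int[mu2]_(x in E) f x)%E.
Proof.
move=> mF mE FE EF0 mf intf.
rewrite -integral_lebesgue2_borel//.
have mE' := lebesgue_measurable2_borel mE.
rewrite [RHS](@negligible_integral _ _ _ mub E (E `\` F)) ?setDD ?(setIidr FE)//.
- exact: measurableD.
- exact: integrable_lebesgue2.
Qed.

Definition swap2 (x : R * R) : R * R := (x.2, x.1).

Let plane := (measurableTypeR R * measurableTypeR R)%type.

Let mswap : measurable_fun setT (swap2 : plane -> plane).
Proof. exact: measurable_swap. Qed.

Lemma measurable_swap2 A : measurable A -> measurable (swap2 @^-1` A).
Proof. by move=> mA; rewrite -[X in measurable X]setTI; exact: mswap. Qed.

Lemma borel_measure2_swap A : measurable A -> mu2 (swap2 @^-1` A) = mu2 A.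
Proof.
move=> mA; apply/esym.
pose m' : {measure set plane -> \bar R} :=
  measure_function_pushforward__canonical__measure_function_Measure mu2 mswap.
apply: (@product_measure_unique _ _ _ _ _ mu1 mu1 m') => // B C mB mC.
rewrite /m' /= /pushforward.
rewrite (_ : _ @^-1` _ = C `*` B); last by apply/seteqP; split => x /= [].
by rewrite [LHS]product_measure1E// muleC.
Qed.

(** A class large enough for all divergences and indicators of bounded Borel sets, and small enough
    that its members are integrable over every Borel set, even one of infinite measure. *)
Definition tame (f : R * R -> R) := measurable_fun setT f /\
  exists M C, forall x, `|f x| <= C /\ (~ sqr_box M x -> f x = 0).

Lemma tame_measurable f : tame f -> measurable_fun setT f. Proof. by case. Qed.

Lemma tame_integrable A f : measurable A -> tame f ->
  mu2.-integrable A (EFin \o f).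
Proof.
move=> mA [mf [M [C fMC]]].
apply: (@integrableS _ _ _ _ setT) => //.
rewrite (_ : EFin \o f = (EFin \o f) \_ (sqr_box M)); last first.
  apply/funext => x; rewrite patchE; case: ifPn => // /negP; rewrite inE => /((fMC x).2) /= ->//.
apply/(integrable_mkcond _ _).1; first exact: measurable_sqr_box.
apply: measurable_bounded_integrable.
- exact: measurable_sqr_box.
- exact: sqr_box_fin.
- exact: measurable_funTS.
- by exists C; split; [exact: num_real|move=> D /= CD x _; apply: le_trans (fMC x).1 (ltW CD)].
Qed.

Lemma sqr_boxS (M M' : R) : M <= M' -> sqr_box M `<=` sqr_box M'.
Proof. by move=> MM x /sqr_boxP[a b]; apply/sqr_boxP; split; exact: le_trans MM. Qed.

Lemma tameD f g : tame f -> tame g -> tame (fun x => f x + g x).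
Proof.
move=> [mf [M [C fMC]]] [mg [N [D gND]]]; split; first exact: measurable_funD.
exists (Num.max M N), (C + D) => x; split.
  by apply: le_trans (ler_normD _ _) _; apply: lerD; [exact: (fMC x).1|exact: (gND x).1].
move=> nx; rewrite (fMC x).2 ?(gND x).2 ?addr0// => h; apply: nx; apply: sqr_boxS h.
  by rewrite le_max lexx orbT.
by rewrite le_max lexx.
Qed.

Lemma tameMl (f g : R * R -> R) : tame f -> measurable_fun setT g ->
  (exists D, forall x, `|g x| <= D) -> tame (fun x => g x * f x).
Proof.
move=> [mf [M [C fMC]]] mg [D gD]; split; first exact: measurable_funM.
exists M, (D * C) => x; split.
  rewrite normrM; apply: ler_pM => //; exact: (fMC x).1.
by move=> nx; rewrite (fMC x).2 ?mulr0.
Qed.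

Lemma tameN f : tame f -> tame (fun x => - f x).
Proof.
move=> [mf [M [C fMC]]]; split.
  by apply: measurableT_comp.
exists M, C => x; split; first by rewrite normrN; exact: (fMC x).1.
by move=> nx; rewrite (fMC x).2 ?oppr0.
Qed.

Lemma tameZ (k : R) f : tame f -> tame (fun x => k * f x).
Proof.
move=> tf; apply: (@tameMl _ (fun _ => k)) => //.
by exists `|k|.
Qed.

Lemma tame_indic A M : measurable A -> A `<=` sqr_box M -> tame (\1_A : R * R -> R).
Proof.
move=> mA AM; split; first exact: measurable_indic.
exists M, 1 => x; rewrite indicE; split.
  by case: (x \in A); rewrite ?normr1// normr0.
by move=> nx; rewrite memNset// => /AM.
Qed.

Lemma tame_continuous f M : continuous f -> (forall x, ~ sqr_box M x -> f x = 0) ->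
  tame f.
Proof.
move=> cf f0; split; first exact: continuous_measurable_fun2.
have cpt : compact (sqr_box M) by apply: compact_setX; exact: segment_compact.
have : compact (f @` sqr_box M).
  apply: continuous_compact => //; exact: continuous_subspaceT.
move=> /compact_bounded [C [_ HC]].
exists M, (`|C| + 1) => x; split; last exact: f0.
have [Mx|Mx] := pselect (sqr_box M x).
  apply: HC; last by exists x.
  by rewrite (le_lt_trans (ler_norm _))// ltrDl.
by rewrite f0// normr0 addr_ge0.
Qed.

End plane_integral.

(** * Test fields and perimeter *)

Section test_fields.
Variable R : realType.
Notation mu1 := (@lebesgue_measure R).
Notation mu2 := (borel_measure2 R).
Notation mub := (@lebesgue_measure2 R).
Implicit Types (A E F : set (R * R)) (phi psi : R * R -> R * R).

Lemma continuous_fst : continuous (fst : R * R -> R).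
Proof. by move=> x; exact: cvg_fst. Qed.

Lemma continuous_snd : continuous (snd : R * R -> R).
Proof. by move=> x; exact: cvg_snd. Qed.

Lemma C1_fst : C1 (fst : R * R -> R).
Proof. by apply: C1_linear; exact: continuous_fst. Qed.

Lemma C1_snd : C1 (snd : R * R -> R).
Proof. by apply: C1_linear; exact: continuous_snd. Qed.

Lemma derive_fst (v x : R * R) : 'D_v fst x = v.1.
Proof. by rewrite derive_linear//; exact: continuous_fst. Qed.

Lemma derive_snd (v x : R * R) : 'D_v snd x = v.2.
Proof. by rewrite derive_linear//; exact: continuous_snd. Qed.

Lemma C1_comp_fst (f : R * R -> R * R) : C1 f -> C1 (fun x => (f x).1).
Proof. by move=> f1; apply: C1_linear_comp => //; exact: continuous_fst. Qed.

Lemma C1_comp_snd (f : R * R -> R * R) : C1 f -> C1 (fun x => (f x).2).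
Proof. by move=> f1; apply: C1_linear_comp => //; exact: continuous_snd. Qed.

Lemma compact_sqr_box (M : R) : compact (sqr_box M).
Proof. by apply: compact_setX; exact: segment_compact. Qed.

Lemma closed_sqr_box (M : R) : closed (sqr_box M).
Proof. by apply: compact_closed (@compact_sqr_box M); exact: norm_hausdorff. Qed.

Lemma derive_eq0_out (f : R * R -> R) A v x : closed A ->
  (forall y, ~ A y -> f y = 0) -> ~ A x -> 'D_v f x = 0.
Proof.
move=> cA f0 Ax.
rewrite (@near_eq_derive _ _ _ f (fun=> 0) x v) ?derive_cst//.
have : \forall y \near x, (~` A) y.
  by apply: open_nbhs_nbhs; split => //; exact: closed_openC.
by apply: filterS => y /f0.
Qed.

Lemma enorm_le1 (x : R * R) : (enorm x <= 1) = (x.1 ^+ 2 + x.2 ^+ 2 <= 1).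
Proof.
rewrite /enorm -{1}(@sqrtr1 R) ler_psqrt//.
  by rewrite nnegrE addr_ge0 ?sqr_ge0.
by rewrite nnegrE.
Qed.

Lemma test_field_pair (f g : R * R -> R) M : C1 f -> C1 g ->
  (forall x, ~ sqr_box M x -> f x = 0 /\ g x = 0) ->
  (forall x, f x ^+ 2 + g x ^+ 2 <= 1) -> test_field (fun x => (f x, g x)).
Proof.
move=> f1 g1 fg0 fg1; split; last by move=> x; rewrite enorm_le1; exact: fg1.
  exact: C1_pair.
apply: (subclosed_compact _ (@compact_sqr_box M)).
  exact: closed_closure.
rewrite [X in _ `<=` X](iffLR (closure_id _) (@closed_sqr_box M)).
apply: closureS => x /= fgx; apply: contrapT => /fg0[fx gx].
by move: fgx; rewrite fx gx eqxx.
Qed.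

Lemma test_field_support phi : test_field phi ->
  exists M, 0 <= M /\ forall x, ~ sqr_box M x -> phi x = 0.
Proof.
move=> [_ /compact_bounded[C [_ HC]] _].
exists (`|C| + 1); split; first by rewrite addr_ge0.
move=> x nx; apply: contrapT => /eqP phix; apply: nx.
have : `|x| <= `|C| + 1.
  apply: HC; first by rewrite (le_lt_trans (ler_norm _))// ltrDl.
  exact: subset_closure.
by rewrite prod_normE/= ge_max => /andP[x1 x2]; apply/sqr_boxP.
Qed.

Lemma div_C1_tame (f g : R * R -> R) M : C1 f -> C1 g ->
  (forall x, ~ sqr_box M x -> f x = 0 /\ g x = 0) ->
  tame (fun x => 'D_(1, 0) f x + 'D_(0, 1) g x).
Proof.
move=> f1 g1 fg0; apply: (@tame_continuous _ _ M).
  by move=> x; apply: cvgD; [exact: f1.2|exact: g1.2].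
move=> x nx.
rewrite (derive_eq0_out _ (@closed_sqr_box M) _ nx); last by move=> y /fg0[].
rewrite (derive_eq0_out _ (@closed_sqr_box M) _ nx) ?addr0//.
by move=> y /fg0[].
Qed.

Lemma test_field_tame phi : test_field phi -> tame (div phi).
Proof.
move=> tphi; have [M [_ phi0]] := test_field_support tphi.
apply: (@div_C1_tame _ _ M).
- by apply: C1_comp_fst; case: tphi.
- by apply: C1_comp_snd; case: tphi.
- by move=> x /phi0 ->.
Qed.

Definition borel_hull F E :=
  [/\ lebesgue_measurable2 F, measurable E, F `<=` E & mub (E `\` F) = 0%E].

Lemma PerE F E : borel_hull F E ->
  Per F = ereal_sup [set (\int[mu2]_(x in E) div phi x)%:E | phi in @test_field R].
Proof.
move=> [mF mE FE EF0].
have H phi : test_field phi -> (\int[mub]_(x in F) (div phi x)%:E)%E =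
    (\int[mu2]_(x in E) div phi x)%:E.
  move=> tphi; have tm := test_field_tame tphi.
  rewrite (integral_lebesgue2_hull mF mE FE EF0); first last.
  - exact: tame_integrable.
  - by apply/measurable_EFinP; exact: tame_measurable.
  by rewrite /Rintegral fineK//; apply: integrable_fin_num => //; exact: tame_integrable.
congr ereal_sup; apply/seteqP; split => _ [phi tphi <-]; exists phi => //; last by rewrite H.
by rewrite H.
Qed.

Lemma test_field0 : test_field (fun _ : R * R => (0, 0)).
Proof.
apply: (@test_field_pair (fun=> 0) (fun=> 0) 0) => //.
- exact: C1_cst.
- exact: C1_cst.
- by move=> x; rewrite expr0n addr0.
Qed.

Lemma div0 x : div (fun _ : R * R => (0, 0)) x = 0 :> R.
Proof. by rewrite /div/= !derive_cst addr0. Qed.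

Lemma Per_le_integral F E phi : borel_hull F E -> test_field phi ->
  ((\int[mu2]_(x in E) div phi x)%:E <= Per F)%E.
Proof. by move=> h tphi; rewrite (PerE h); apply: ereal_sup_ubound; exists phi. Qed.

Lemma Per_ge0 F : lebesgue_measurable2 F -> (0 <= Per F)%E.
Proof.
move=> mF; have [E [mE FE EF0]] := lebesgue_measurable2_hull mF.
have := @Per_le_integral F E _ (And4 mF mE FE EF0) test_field0.
under eq_Rintegral do rewrite div0.
by rewrite Rintegral_cst// mul0r.
Qed.

Lemma test_field_bound phi x : test_field phi -> `|(phi x).1| <= 1 /\ `|(phi x).2| <= 1.
Proof.
move=> [_ _ /(_ x)]; rewrite enorm_le1 => h.
by split; rewrite -(@expr_le1 _ 2)// real_normK ?num_real//; apply: le_trans h;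
  rewrite ?lerDl ?lerDr ?sqr_ge0.
Qed.

Lemma continuous_swap2 : continuous (@swap2 R).
Proof. by move=> x; exact: (cvg_pair (@continuous_snd x) (@continuous_fst x)). Qed.

Let swap2_is_linear : linear (@swap2 R). Proof. by []. Qed.

HB.instance Definition _ := GRing.isLinear.Build R (R * R)%type (R * R)%type *:%R
  (@swap2 R) swap2_is_linear.

Lemma test_field_swap phi : test_field phi -> test_field (fun x => @swap2 R (phi (@swap2 R x))).
Proof.
move=> tphi; have [M [_ phi0]] := test_field_support tphi.
case: tphi => phi1 _ phin.
have C : C1 (fun x => phi (@swap2 R x)).
  by apply: (@C1_comp_linear _ _ _ _ _ (@swap2 R)); first exact: continuous_swap2.
apply: (@test_field_pair (fun x => (phi (@swap2 R x)).2) (fun x => (phi (@swap2 R x)).1) M).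
- exact: C1_comp_snd.
- exact: C1_comp_fst.
- move=> x nx; rewrite phi0//.
  by move=> /sqr_boxP[a b]; apply: nx; apply/sqr_boxP.
- by move=> x; rewrite addrC -enorm_le1.
Qed.

Lemma div_swap phi x :
  div (fun x => @swap2 R (phi (@swap2 R x))) x = div phi (@swap2 R x).
Proof.
(* The two derivatives are limits of identical quotients: [swap2 (h *: (1, 0) + x)] computes to
   [h *: (0, 1) + swap2 x], so the sides are convertible after exchanging the summands. *)
by rewrite /div/= addrC; congr (_ + _).
Qed.

Lemma Rintegral_swap A f : measurable A -> tame f ->
  \int[mu2]_(x in @swap2 R @^-1` A) f (@swap2 R x) = \int[mu2]_(x in A) f x.
Proof.
move=> mA tf.
pose plane := (measurableTypeR R * measurableTypeR R)%type.
have mswap : measurable_fun setT (@swap2 R : plane -> plane) by exact: measurable_swap.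
have mf : measurable_fun setT (EFin \o f) by apply/measurable_EFinP; exact: tame_measurable.
have tfs : tame (f \o (@swap2 R)).
  case: tf => [mf' [M [C fMC]]]; split; first exact: measurableT_comp.
  exists M, C => x; split; first exact: (fMC _).1.
  move=> nx; apply: (fMC _).2 => /sqr_boxP[a b]; apply: nx; exact/sqr_boxP.
have H := @integral_pushforward _ _ _ _ _ _ mswap mu2 A (EFin \o f) mf
  (tame_integrable (measurable_swap2 mA) tfs) mA.
refine (f_equal fine (eq_trans (esym H) _)).
by apply: eq_measure_integral => B mB _; exact: borel_measure2_swap.
Qed.

End test_fields.

(** * Cutting an indecomposable set along a rectangle *)

Section cutoffs.
Variable R : realType.
Implicit Types (f g : R -> R).

(** Unlike [C1], this names the derivative, so that its bounds and its zeros can be stated. *)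
Definition C1_with f (f' : R -> R) :=
  (forall t : R, is_derive t (1 : R) f (f' t)) /\ continuous f'.

Lemma C1_with_continuous f f' : C1_with f f' -> continuous f.
Proof.
move=> [df _] x; apply: differentiable_continuous.
by apply/derivable1_diffP; have [] := df x.
Qed.

Lemma C1_withM f f' g g' : C1_with f f' -> C1_with g g' ->
  C1_with (fun t => f t * g t) (fun t => f t * g' t + g t * f' t).
Proof.
move=> ff' gg'; have cf := C1_with_continuous ff'; have cg := C1_with_continuous gg'.
move: ff' gg' => [df cf'] [dg cg']; split=> t.
  have h1 := df t; have h2 := dg t.
  by apply: is_derive_eq.
apply: cvgD; first by apply: cvgM; [exact: cf|exact: cg'].
by apply: cvgM; [exact: cg|exact: cf'].
Qed.

Lemma C1_withB f f' g g' : C1_with f f' -> C1_with g g' ->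
  C1_with (fun t => f t - g t) (fun t => f' t - g' t).
Proof.
move=> [df cf'] [dg cg']; split=> t.
  have h1 := df t; have h2 := dg t.
  by apply: is_derive_eq.
by apply: cvgB; [exact: cf'|exact: cg'].
Qed.

Lemma C1_with_sstep (k m : R) :
  C1_with (fun t => sstep (k * t + m)) (fun t => k * dsstep (k * t + m)).
Proof.
split=> t.
  have h1 : is_derive t (1 : R) (fun x : R => k *: x + m) k.
    by apply: is_derive_eq; rewrite addr0 /GRing.scale/= mulr1.
  have := @is_derive1_comp _ (@sstep R) (fun x : R => k *: x + m) t _ _
    (is_derive_sstep (k * t + m)) h1.
  by rewrite mulrC.
apply: cvgM; first exact: cvg_cst.
apply: (@continuous_comp _ _ _ (fun t : R => k * t + m) (@dsstep R)).
  by apply: cvgD; [apply: cvgM; [exact: cvg_cst|exact: cvg_id]|exact: cvg_cst].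
exact: dsstep_continuous.
Qed.

Lemma C1_with_fst f f' : C1_with f f' -> C1 (fun x : R * R => f x.1).
Proof. by move=> [df cf]; apply: C1_comp1 df cf _; exact: C1_fst. Qed.

Lemma C1_with_snd f f' : C1_with f f' -> C1 (fun x : R * R => f x.2).
Proof. by move=> [df cf]; apply: C1_comp1 df cf _; exact: C1_snd. Qed.

Lemma derive_with_fst f f' v (x : R * R) : C1_with f f' ->
  'D_v (fun x : R * R => f x.1) x = f' x.1 * v.1.
Proof.
by move=> [df cf]; rewrite (derive_comp1 _ df) ?derive_fst//; exact: (@C1_fst R).1.
Qed.

Lemma derive_with_snd f f' v (x : R * R) : C1_with f f' ->
  'D_v (fun x : R * R => f x.2) x = f' x.2 * v.2.
Proof.
by move=> [df cf]; rewrite (derive_comp1 _ df) ?derive_snd//; exact: (@C1_snd R).1.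
Qed.

(** The product of a step rising on [a - e, a] and a step falling on [b, b + e]. As [dsstep] is at
    most 2, each factor contributes at most 2/e to the slope. A product, rather than a difference,
    keeps the values in [0, 1] even when b < a. *)
Lemma plateau (a b e : R) : 0 < e -> exists f f', C1_with f f' /\
  forall t, [/\ 0 <= f t <= 1, `|f' t| <= 4 / e,
    a <= t <= b -> f t = 1 /\ f' t = 0 &
    t < a - e \/ b + e < t -> f t = 0 /\ f' t = 0].
Proof.
move=> e0.
pose k := e^-1; have k0 : 0 < k by rewrite invr_gt0.
have ke : k * e = 1 by rewrite mulVf// gt_eqF.
have S1 := C1_with_sstep k (1 - k * a).
have S2 := C1_with_sstep (- k) (1 + k * b).
have := C1_withM S1 S2.
set f := (X in C1_with X); set f' := (X in C1_with _ X) => ff'.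
exists f, f'; split => // t.
have /andP[u0 u1] := sstep_itv (k * t + (1 - k * a)).
have /andP[v0 v1] := sstep_itv (- k * t + (1 + k * b)).
have /andP[du0 du1] := dsstep_itv (k * t + (1 - k * a)).
have /andP[dv0 dv1] := dsstep_itv (- k * t + (1 + k * b)).
split.
- by rewrite /f mulr_ge0// mulr_ile1.
- rewrite /f' -/k ler_norml.
  move: (sstep _) (sstep _) (dsstep _) (dsstep _) u0 u1 v0 v1 du0 du1 dv0 dv1 => u v du dv *.
  have [h1 h2] : 0 <= u * dv <= 2 /\ 0 <= v * du <= 2 by split; apply/andP; split; nra.
  apply/andP; split; nra.
- move=> /andP[ta tb].
  have l1 : 1 <= k * t + (1 - k * a) by nra.
  have l2 : 1 <= - k * t + (1 + k * b) by nra.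
  rewrite /f /f' !sstep_ge1// !dsstep_out; [lra|by right|by right].
- move=> [ta|tb].
    have l1 : k * t + (1 - k * a) <= 0 by nra.
    rewrite /f /f' (sstep_le0 l1) (@dsstep_out _ (k * t + (1 - k * a))); [lra|by left].
  have l1 : - k * t + (1 + k * b) <= 0 by nra.
  rewrite /f /f' (sstep_le0 l1) (@dsstep_out _ (- k * t + _)); [lra|by left].
Qed.

Definition rect (a b c d : R) : set (R * R) := `[a, b] `*` `[c, d].

Lemma rectP a b c d x : rect a b c d x <-> (a <= x.1 <= b) /\ (c <= x.2 <= d).
Proof. by rewrite /rect/= !in_itv/=. Qed.

Lemma measurable_rect a b c d : measurable (rect a b c d).
Proof. exact: measurableX. Qed.

Lemma convex_sqr_le (t a b c d : R) : 0 <= t <= 1 -> a ^+ 2 + b ^+ 2 <= 1 ->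
  c ^+ 2 + d ^+ 2 <= 1 ->
  (t * a + (1 - t) * c) ^+ 2 + (t * b + (1 - t) * d) ^+ 2 <= 1.
Proof.
move=> /andP[t0 t1] ab cd.
(* This quantity is exactly t|A|^2 + (1 - t)|C|^2 - |tA + (1 - t)C|^2 for A = (a, b) and C = (c,
   d). *)
have h1 : 0 <= t * (1 - t) * ((a - c) ^+ 2 + (b - d) ^+ 2).
  by apply: mulr_ge0; [apply: mulr_ge0 => //; rewrite subr_ge0|rewrite addr_ge0 ?sqr_ge0].
have h2 : t * (a ^+ 2 + b ^+ 2) <= t by rewrite ler_piMr.
have h3 : (1 - t) * (c ^+ 2 + d ^+ 2) <= 1 - t by rewrite ler_piMr// subr_ge0.
nra.
Qed.

Lemma derive_interp (h u w : R * R -> R) v x : C1 h -> C1 u -> C1 w ->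
  'D_v (fun y => h y * u y + (1 - h y) * w y) x =
  h x * 'D_v u x + (1 - h x) * 'D_v w x + 'D_v h x * (u x - w x).
Proof.
move=> h1 u1 w1.
have D (f : R * R -> R) : C1 f -> derivable f x v by move=> [df _]; exact: diff_derivable.
have h1' : C1 (fun y => 1 - h y) := @C1B _ _ _ (fun=> 1 : R) h (@C1_cst _ _ _ (1 : R)) h1.
rewrite (@deriveD _ _ _ (fun y => h y * u y) (fun y => (1 - h y) * w y)); [|by apply/D/C1M..].
rewrite (@deriveM _ _ h u); [|exact: D..].
rewrite (@deriveM _ _ (fun y => 1 - h y) w); [|exact: D..].
rewrite (@deriveB _ _ _ (fun=> 1 : R) h); [|exact (D _ (@C1_cst _ _ _ (1 : R)))|exact: D].
rewrite derive_cst /GRing.scale/=; ring.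
Qed.

End cutoffs.

Section cut.
Variable R : realType.
Notation mu1 := (@lebesgue_measure R).
Notation mu2 := (borel_measure2 R).
Notation mub := (@lebesgue_measure2 R).
Implicit Types (A E F : set (R * R)) (phi psi : R * R -> R * R) (f g : R -> R) (h : R * R -> R).

Lemma tame_bound (f : R * R -> R) : tame f -> exists C, forall x, `|f x| <= C.
Proof. by move=> [_ [M [C H]]]; exists C => x; exact: (H x).1. Qed.

Definition glue (h : R * R -> R) phi psi (x : R * R) : R * R :=
  (h x * (phi x).1 + (1 - h x) * (psi x).1,
   h x * (phi x).2 + (1 - h x) * (psi x).2).

Lemma test_field_glue h phi psi : C1 h -> (forall x, 0 <= h x <= 1) ->
  test_field phi -> test_field psi -> test_field (glue h phi psi).
Proof.
move=> h1 h01 tphi tpsi.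
have [M [_ phi0]] := test_field_support tphi.
have [N [_ psi0]] := test_field_support tpsi.
case: tphi => phi1 _ phin; case: tpsi => psi1 _ psin.
have h1' : C1 (fun y => 1 - h y) := @C1B _ _ _ (fun=> 1 : R) h (@C1_cst _ _ _ (1 : R)) h1.
apply: (@test_field_pair _ _ _ (Num.max M N)).
- exact (C1D (C1M h1 (C1_comp_fst phi1)) (C1M h1' (C1_comp_fst psi1))).
- exact (C1D (C1M h1 (C1_comp_snd phi1)) (C1M h1' (C1_comp_snd psi1))).
- move=> x nx; rewrite phi0; last first.
    by move=> k; apply: nx; apply: sqr_boxS k; rewrite le_max lexx.
  rewrite psi0; last first.
    by move=> k; apply: nx; apply: sqr_boxS k; rewrite le_max lexx orbT.
  by rewrite /= !mulr0 addr0.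
- move=> x; apply: convex_sqr_le => //; first by rewrite -enorm_le1; exact: phin.
  by rewrite -enorm_le1; exact: psin.
Qed.

Lemma div_glue h phi psi x : C1 h -> test_field phi -> test_field psi ->
  div (glue h phi psi) x = h x * div phi x + (1 - h x) * div psi x +
    ('D_(1, 0) h x * ((phi x).1 - (psi x).1) + 'D_(0, 1) h x * ((phi x).2 - (psi x).2)).
Proof.
move=> h1 [phi1 _ _] [psi1 _ _]; rewrite {1}/div /glue /=.
rewrite (derive_interp _ _ h1 (C1_comp_fst phi1) (C1_comp_fst psi1)).
rewrite (derive_interp _ _ h1 (C1_comp_snd phi1) (C1_comp_snd psi1)).
rewrite /div; ring.
Qed.

Lemma plateau2 (a b c d e : R) : 0 < e -> exists h : R * R -> R, [/\ C1 h,
  forall x, 0 <= h x <= 1,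
  forall x, `|'D_(1, 0) h x| <= 4 / e /\ `|'D_(0, 1) h x| <= 4 / e,
  forall x, rect a b c d x -> [/\ h x = 1, 'D_(1, 0) h x = 0 & 'D_(0, 1) h x = 0] &
  forall x, ~ rect (a - e) (b + e) (c - e) (d + e) x ->
    [/\ h x = 0, 'D_(1, 0) h x = 0 & 'D_(0, 1) h x = 0]].
Proof.
move=> e0.
have [f [f' [Hf f_]]] := plateau a b e0.
have [g [g' [Hg g_]]] := plateau c d e0.
have f1 := C1_with_fst Hf; have g1 := C1_with_snd Hg.
have D (u : R * R -> R) v x : C1 u -> derivable u x v by move=> [df _]; exact: diff_derivable.
pose h (x : R * R) := f x.1 * g x.2.
have Dh1 x : 'D_(1, 0) h x = g x.2 * f' x.1.
  rewrite /h (@deriveM _ _ (fun x : R * R => f x.1) (fun x : R * R => g x.2)); [|exact: D..].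
  by rewrite (derive_with_fst _ _ Hf) (derive_with_snd _ _ Hg)/= mulr0 scaler0 add0r mulr1.
have Dh2 x : 'D_(0, 1) h x = f x.1 * g' x.2.
  rewrite /h (@deriveM _ _ (fun x : R * R => f x.1) (fun x : R * R => g x.2)); [|exact: D..].
  by rewrite (derive_with_fst _ _ Hf) (derive_with_snd _ _ Hg)/= mulr0 scaler0 addr0 mulr1.
have n01 (t : R) : 0 <= t <= 1 -> `|t| <= 1 by move=> /andP[? ?]; rewrite ger0_norm.
exists h; split.
- exact (C1M f1 g1).
- move=> x; have [/andP[p q] _ _ _] := f_ x.1; have [/andP[r s] _ _ _] := g_ x.2.
  by rewrite /h mulr_ge0//= mulr_ile1.
- move=> x; have [/n01 p q _ _] := f_ x.1; have [/n01 r s _ _] := g_ x.2.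
  rewrite Dh1 Dh2 !normrM; split.
    by rewrite -[leRHS]mul1r ler_pM.
  by rewrite -[leRHS]mul1r ler_pM.
- move=> x /rectP[x1 x2]; have [_ _ /(_ x1)[p q] _] := f_ x.1.
  have [_ _ /(_ x2)[r s] _] := g_ x.2.
  by rewrite Dh1 Dh2 /h p q r s !mulr1 mulr0.
- move=> x nx.
  have : (x.1 < a - e \/ b + e < x.1) \/ (x.2 < c - e \/ d + e < x.2).
    apply: contrapT => H; apply: nx; apply/rectP; split; apply/andP; split; rewrite leNgt;
      apply/negP => k; apply: H; tauto.
  case=> H.
    have [_ _ _ /(_ H)[p q]] := f_ x.1.
    by rewrite Dh1 Dh2 /h p q !mul0r mulr0.
  have [_ _ _ /(_ H)[p q]] := g_ x.2.
  by rewrite Dh1 Dh2 /h p q !mulr0 mul0r.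
Qed.

Lemma Rintegral_indic A E M : measurable A -> measurable E -> A `<=` sqr_box M ->
  \int[mu2]_(x in E) \1_A x = fine (mu2 (A `&` E)).
Proof. by move=> mA mE AM; rewrite /Rintegral integral_indic. Qed.

(* The competitor is phi glued to psi by a cutoff of slope O(1/e), which is
   constant off the frame of width e around the rectangle. *)
Lemma cut_integral E phi psi a b c d e P : measurable E -> 0 < e <= 1 ->
  test_field phi -> test_field psi ->
  (forall chi, test_field chi -> \int[mu2]_(x in E) div chi x <= P) ->
  forall C, (forall x, `|div phi x| <= C) -> (forall x, `|div psi x| <= C) ->
  \int[mu2]_(x in E `&` rect a b c d) div phi x +
  \int[mu2]_(x in E `\` rect a b c d) div psi x <=
  P + (2 * C + 16 / e) * fine (mu2
    (E `&` (rect (a - e) (b + e) (c - e) (d + e) `\` rect a b c d))).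
Proof.
move=> mE /andP[e0 e1] tphi tpsi HP C Cphi Cpsi.
set K := rect a b c d; set K' := rect _ _ _ _.
have mK : measurable K by exact: measurable_rect.
have mK' : measurable K' by exact: measurable_rect.
have [h [h1 h01 hD hin hout]] := plateau2 a b c d e0.
have tg := test_field_glue h1 h01 tphi tpsi.
have KK' : K `<=` K'.
  move=> x /rectP[/andP[p q] /andP[r s]]; apply/rectP; split; apply/andP; split; lra.
pose M := Num.max (Num.max `|a - e| `|b + e|) (Num.max `|c - e| `|d + e|).
have K'M : K' `<=` sqr_box M.
  have aM : `|a - e| <= M by rewrite !le_max lexx.
  have bM : `|b + e| <= M by rewrite !le_max lexx orbT.
  have cM : `|c - e| <= M by rewrite !le_max lexx !orbT.
  have dM : `|d + e| <= M by rewrite !le_max lexx !orbT.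
  move=> x /rectP[/andP[p q] /andP[r s]]; apply/sqr_boxP.
  move: aM bM cM dM; rewrite !ler_norml => /andP[? ?] /andP[? ?] /andP[? ?] /andP[? ?].
  by split; apply/andP; split; lra.
have DM : K' `\` K `<=` sqr_box M by move=> x [/K'M].
have mD : measurable (K' `\` K) by exact: measurableD.
have tD := tame_indic mD DM.
have tdphi := test_field_tame tphi.
have tdpsi := test_field_tame tpsi.
have tdg := test_field_tame tg.
have tk1 : tame (fun x => \1_K x * div phi x).
  apply: tameMl => //; exists 1 => x; rewrite indicE.
  by case: (x \in K); rewrite ?normr1// normr0.
have tk2 : tame (fun x => \1_(~` K) x * div psi x).
  apply: tameMl => //; first exact/measurable_indic/measurableC.
  by exists 1 => x; rewrite indicE; case: (x \in ~` K); rewrite ?normr1// normr0.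
have restr A (f : R * R -> R) : measurable A -> \int[mu2]_(x in E `&` A) f x =
    \int[mu2]_(x in E) (\1_A x * f x).
  move=> mA; rewrite Rintegral_mkcondr; apply: eq_Rintegral => x _.
  by rewrite patchE indicE; case: (x \in A); rewrite ?mul1r ?mul0r.
rewrite setDE restr// restr; last exact: measurableC.
rewrite -RintegralD//; [|exact: tame_integrable..].
rewrite setIC -(@Rintegral_indic _ _ M)//.
apply: (@le_trans _ _ (\int[mu2]_(x in E)
    (div (glue h phi psi) x + (2 * C + 16 / e) * \1_(K' `\` K) x))).
  apply: le_Rintegral => //.
  - by apply: tame_integrable => //; exact: tameD.
  - by apply: tame_integrable => //; apply: tameD => //; exact: tameZ.
  move=> x _; rewrite div_glue// !indicE in_setC in_setD.
  have [] := boolP (x \in K) => [/set_mem Kx|/negP nKx].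
    have [-> -> ->] := hin _ Kx; rewrite andbF/=; lra.
  have {}nKx : ~ K x by move=> Kx; apply: nKx; exact: mem_set.
  have [] := boolP (x \in K') => [K'x|/negP nK'x] /=; last first.
    have nK'x' : ~ K' x by move=> k; apply: nK'x; exact: mem_set.
    have [-> -> ->] := hout _ nK'x'; lra.
  have /andP[hx0 hx1] := h01 x.
  (* On the frame, passing from [div psi] to the glued divergence costs 2C for the two divergences
     and, for each partial derivative of [h], at most 4/e times a difference of components bounded
     by 2; together 2C + 16/e. *)
  have [D1 D2] := hD x.
  have [p1 p2] := test_field_bound x tphi.
  have [q1 q2] := test_field_bound x tpsi.
  have b1 : `|'D_(1, 0) h x * ((phi x).1 - (psi x).1)| <= 4 / e * 2.
    rewrite normrM ler_pM//; apply: le_trans (ler_normB _ _) _; lra.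
  have b2 : `|'D_(0, 1) h x * ((phi x).2 - (psi x).2)| <= 4 / e * 2.
    rewrite normrM ler_pM//; apply: le_trans (ler_normB _ _) _; lra.
  have b3 : `|h x * (div psi x - div phi x)| <= 2 * C.
    rewrite normrM -[leRHS]mul1r ler_pM//; first by rewrite ger0_norm.
    apply: le_trans (ler_normB _ _) _; have := Cphi x; have := Cpsi x; lra.
  move: b1 b2 b3; rewrite !ler_norml; move: ('D_(1, 0) h x * _) ('D_(0, 1) h x * _) => u v.
  move=> /andP[u1 u2] /andP[v1 v2] /andP[w1 w2]; lra.
rewrite RintegralD//; [|exact: tame_integrable|by apply: tame_integrable => //; exact: tameZ].
rewrite RintegralZl//; last exact: tame_integrable.
by rewrite lerD2r; exact: HP.
Qed.

End cut.

Section cut_decomposition.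
Variable R : realType.
Notation mu1 := (@lebesgue_measure R).
Notation mu2 := (borel_measure2 R).
Notation mub := (@lebesgue_measure2 R).
Implicit Types (A E F : set (R * R)) (phi psi : R * R -> R * R) (f g : R -> R) (h : R * R -> R).


Lemma borel_hullI F E A : borel_hull F E -> measurable A ->
  borel_hull (F `&` A) (E `&` A).
Proof.
move=> [mF mE FE EF0] mA; split.
- by apply: measurableI => //; exact: lebesgue_measurable2_borel.
- exact: measurableI.
- exact: setSI.
- apply/eqP; rewrite eq_le outer_measure_ge0 andbT -EF0.
  apply: (le_outer_measure (mu2^*)%mu) => x [[Ex Ax] nF]; split => // Fx.
  exact: nF.
Qed.

Lemma borel_hull_measure F E : borel_hull F E -> mub F = 0%E -> mu2 E = 0%E.
Proof.
move=> [mF mE FE EF0] F0; rewrite -lebesgue_measure2_borel//.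
apply/eqP; rewrite eq_le outer_measure_ge0 andbT.
apply: (@le_trans _ _ (mub (F `|` (E `\` F)))).
  by apply: (le_outer_measure (mu2^*)%mu); rewrite setDUK.
apply: le_trans; first exact: (outer_measureU2 (mu2^*)%mu).
by change (mub F + mub (E `\` F) <= 0)%E; rewrite F0 EF0 adde0.
Qed.

(** The hypothesis says that the frame of width e carries mass o(e) along some sequence of widths,
    whereas gluing has slope O(1/e). Any two fields can thus be glued at vanishing cost, so the
    perimeters of the two pieces add up to at most [Per F]. Testing both pieces with one field gives
    the converse, and indecomposability applies. *)
Lemma indecomposable_cut F E a b c d : indecomposable F -> borel_hull F E ->
  (forall r : R, 0 < r -> exists e : R, 0 < e <= 1 /\
    fine (mu2 (E `&` (rect (a - e) (b + e) (c - e) (d + e) `\` rect a b c d))) <= r * e) ->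
  mu2 (E `&` rect a b c d) = 0%E \/ mu2 (E `\` rect a b c d) = 0%E.
Proof.
move=> [[mF PF] indF] hF Hr.
have [_ mE _ _] := hF.
have mK := measurable_rect a b c d; set K := rect a b c d in mK Hr *.
have hA : borel_hull (F `&` K) (E `&` K) := borel_hullI hF mK.
have hB : borel_hull (F `\` K) (E `\` K) := borel_hullI hF (measurableC mK).
have [mA mEA _ _] := hA; have [mB mEB _ _] := hB.
have fP : Per F \is a fin_num by rewrite ge0_fin_numE// Per_ge0.
set P := fine (Per F).
have HP chi : test_field chi -> \int[mu2]_(x in E) div chi x <= P.
  by move=> tchi; rewrite -lee_fin (fineK fP); exact: (Per_le_integral hF).
have key phi psi : test_field phi -> test_field psi ->
    \int[mu2]_(x in E `&` K) div phi x + \int[mu2]_(x in E `\` K) div psi x <= P.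
  move=> tphi tpsi.
  have [C1 HC1] := tame_bound (test_field_tame tphi).
  have [C2 HC2] := tame_bound (test_field_tame tpsi).
  pose C := Num.max (Num.max C1 C2) 0.
  have C0 : 0 <= C by rewrite le_max lexx orbT.
  have H1 x : `|div phi x| <= C by apply: le_trans (HC1 x) _; rewrite !le_max lexx.
  have H2 x : `|div psi x| <= C by apply: le_trans (HC2 x) _; rewrite !le_max lexx orbT.
  apply/ler_addgt0Pr => r r0.
  have D0 : 0 < 2 * C + 16 by lra.
  (* Since e <= 1, the gluing cost (2C + 16/e) * (r / (2C + 16)) * e is at most r. The bound C
     depends on the two fields, so the width is chosen after them. *)
  have [e [/andP[e0 e1] He]] := Hr (r / (2 * C + 16)) (divr_gt0 r0 D0).
  apply: le_trans.
    by apply: (cut_integral a b c d mE _ tphi tpsi HP H1 H2 (e := e)); rewrite e0.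
  rewrite lerD2l.
  apply: (@le_trans _ _ ((2 * C + 16 / e) * (r / (2 * C + 16) * e))).
    apply: ler_wpM2l => //; first by rewrite addr_ge0 ?mulr_ge0 ?invr_ge0// ltW.
  have -> : (2 * C + 16 / e) * (r / (2 * C + 16) * e) = r * ((2 * C * e + 16) / (2 * C + 16)).
    by field; rewrite !gt_eqF.
  rewrite -[leRHS]mulr1 ler_wpM2l ?(ltW r0)// ler_pdivrMr// mul1r lerD2r.
  by rewrite ler_piMr// mulr_ge0.
(* The two suprema are taken one after the other. With psi = 0 the first already shows that the
   inner piece has finite perimeter, which may then be moved across the inequality before the
   second. *)
have PA psi : test_field psi ->
    (Per (F `&` K) <= (P - \int[mu2]_(x in E `\` K) div psi x)%:E)%E.
  move=> tpsi; rewrite (PerE hA); apply: ge_ereal_sup => _ [phi tphi <-].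
  by rewrite lee_fin lerBrDr; exact: key.
have fA : Per (F `&` K) \is a fin_num.
  rewrite ge0_fin_numE; last exact: Per_ge0.
  exact: le_lt_trans (PA _ (@test_field0 R)) (ltry _).
have PB : (Per (F `\` K) <= Per F - Per (F `&` K))%E.
  rewrite (PerE hB); apply: ge_ereal_sup => _ [psi tpsi <-].
  have := PA _ tpsi; rewrite EFinB (fineK fP) leeBrDr// => H.
  by rewrite leeBrDr// addeC.
have fB : Per (F `\` K) \is a fin_num.
  rewrite ge0_fin_numE; last exact: Per_ge0.
  by apply: le_lt_trans PB _; rewrite -(fineK fA) -(fineK fP) -EFinB ltry.
have PAB : Per F = (Per (F `&` K) + Per (F `\` K))%E.
  apply/eqP; rewrite eq_le; apply/andP; split; last first.
    by rewrite addeC -(leeBrDr _ _ fA).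
  rewrite (PerE hF); apply: ge_ereal_sup => _ [phi tphi <-].
  apply: (@le_trans _ _ ((\int[mu2]_(x in E `&` K) div phi x)%:E +
                         (\int[mu2]_(x in E `\` K) div phi x)%:E)%E); last first.
    by apply: leeD; exact: Per_le_integral.
  rewrite -EFinD lee_fin -Rintegral_setU// ?setDE -?setIUr ?setUCr ?setIT//.
  - by apply: tame_integrable => //; exact: test_field_tame.
  - by apply/disj_setPS => x [[_ ?] [_]].
have [||A0|B0] := indF _ _ mA mB _ _ PAB.
- by rewrite setDE -setIUr setUCr setIT.
- by apply/seteqP; split => x // [[_ ?] [_]].
- by left; exact: borel_hull_measure hA A0.
- by right; exact: borel_hull_measure hB B0.
Qed.

End cut_decomposition.

(** * Smooth approximation and differentiation on the line *)

Section measure_tools.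

(** Continuity from above along the remainders, which decrease to the empty set inside D. It serves
    the closure under increasing unions in two pi-lambda arguments, and two exhaustions. *)
Lemma measure_ndseq_remainder d (T : measurableType d) (R : realType)
    (mu : {measure set T -> \bar R}) (D : set T) (F : (set T)^nat) (e : R) :
  measurable D -> (mu D < +oo)%E -> (forall n, measurable (F n)) ->
  nondecreasing_seq F -> 0 < e ->
  exists N, forall n, (N <= n)%N -> (mu (D `&` (\bigcup_k F k `\` F n)) <= e%:E)%E.
Proof.
move=> mD Dfin mF ndF e0.
pose G n := D `&` (\bigcup_k F k `\` F n).
have mG n : measurable (G n).
  by apply: measurableI => //; apply: measurableD => //; exact: bigcupT_measurable.
have G0 : \bigcap_n G n = set0.
  apply/seteqP; split => // x Gx.
  have [_ [[k _ Fkx] _]] := Gx 0%N Logic.I.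
  by have [_ [_]] := Gx k Logic.I.
have niG : nonincreasing_seq G.
  move=> n m nm; apply/subsetPset => x [Dx [Fx nFm]]; split => //; split => // Fn.
  by apply: nFm; move: (ndF _ _ nm) => /subsetPset; apply.
have : (mu \o G) @ \oo --> mu (\bigcap_n G n).
  apply: nonincreasing_cvg_mu => //.
    by apply: le_lt_trans Dfin; apply: le_measure; rewrite ?inE//; exact: subIsetl.
  exact: bigcapT_measurable.
rewrite G0 measure0 => /fine_cvgP[finG /cvgrPdist_le/(_ _ e0)cG].
have [N _ HN] : \forall n \near \oo, (mu (G n) <= e%:E)%E.
  near=> n.
  have fn : mu (G n) \is a fin_num by near: n; exact: finG.
  rewrite -(fineK fn) lee_fin.
  have : `|0 - fine (mu (G n))| <= e by near: n; exact: cG.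
  by rewrite sub0r normrN ger0_norm// fine_ge0.
by exists N.
Unshelve. all: by end_near. Qed.

Lemma le_measureU3 d (T : measurableType d) (R : realType)
    (mu : {measure set T -> \bar R}) (D A B C : set T) :
  measurable D -> measurable A -> measurable B -> measurable C ->
  D `<=` A `|` B `|` C -> (mu D <= mu A + mu B + mu C)%E.
Proof.
move=> mD mA mB mC DABC.
apply: (@le_trans _ _ (mu (A `|` B `|` C))).
  by apply: le_measure; rewrite ?inE//; apply: measurableU => //; exact: measurableU.
apply: le_trans; first by apply: measureU2 => //; exact: measurableU.
by rewrite leeD2r//; exact: measureU2.
Qed.

End measure_tools.

Section line.
Variable R : realType.
Notation mu1 := (@lebesgue_measure R).
Implicit Types (W : set R) (f g : R -> R).

Definition bdd_meas f := measurable_fun setT f /\ exists C, forall x, `|f x| <= C.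

Lemma bdd_meas_integrable f (p q : R) : bdd_meas f ->
  mu1.-integrable `[p, q] (EFin \o f).
Proof.
move=> [mf [C fC]]; apply: measurable_bounded_integrable => //.
- rewrite [ltLHS]lebesgue_measure_itv/=; case: ifP => _; last exact: ltry.
  by rewrite -EFinB ltry.
- exact: measurable_funTS.
- by exists C; split; [exact: num_real|move=> D /= CD x _; apply: le_trans (fC x) (ltW CD)].
Qed.

Lemma bdd_measD f g : bdd_meas f -> bdd_meas g -> bdd_meas (fun x => f x + g x).
Proof.
move=> [mf [C fC]] [mg [D gD]]; split; first exact: measurable_funD.
by exists (C + D) => x; rewrite (le_trans (ler_normD _ _))// lerD.
Qed.

Lemma bdd_measN f : bdd_meas f -> bdd_meas (fun x => - f x).
Proof.
move=> [mf [C fC]]; split; first exact: measurableT_comp.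
by exists C => x; rewrite normrN.
Qed.

Lemma bdd_measB f g : bdd_meas f -> bdd_meas g -> bdd_meas (fun x => f x - g x).
Proof. by move=> bf bg; apply: bdd_measD => //; exact: bdd_measN. Qed.

Lemma bdd_measM f g : bdd_meas f -> bdd_meas g -> bdd_meas (fun x => f x * g x).
Proof.
move=> [mf [C fC]] [mg [D gD]]; split; first exact: measurable_funM.
by exists (C * D) => x; rewrite normrM ler_pM.
Qed.

Lemma bdd_meas_norm f : bdd_meas f -> bdd_meas (fun x => `|f x|).
Proof.
move=> [mf [C fC]]; split; first exact: measurableT_comp.
by exists C => x; rewrite normr_id.
Qed.

Lemma bdd_meas_cst (c : R) : bdd_meas (fun=> c).
Proof. by split => //; exists `|c|. Qed.

Lemma bdd_meas_indic W : measurable W -> bdd_meas (\1_W : R -> R).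
Proof.
move=> mW; split; first exact: measurable_indic.
by exists 1 => x; rewrite indicE; case: (x \in W); rewrite ?normr1// normr0.
Qed.

Lemma bdd_meas_C1_with f f' : C1_with f f' -> (forall t, 0 <= f t <= 1) -> bdd_meas f.
Proof.
move=> ff' f01; split; first by apply: continuous_measurable_fun; exact: C1_with_continuous ff'.
by exists 1 => t; have /andP[t0 t1] := f01 t; rewrite ger0_norm.
Qed.

Lemma le_Rintegral_itv f g (p q : R) : bdd_meas f -> bdd_meas g ->
  (forall x, p <= x <= q -> f x <= g x) ->
  \int[mu1]_(x in `[p, q]) f x <= \int[mu1]_(x in `[p, q]) g x.
Proof.
move=> bf bg fg; apply: le_Rintegral => //; do ?exact: bdd_meas_integrable.
Qed.

Lemma Rintegral_itvD f g (p q : R) : bdd_meas f -> bdd_meas g ->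
  \int[mu1]_(x in `[p, q]) (f x + g x) =
  \int[mu1]_(x in `[p, q]) f x + \int[mu1]_(x in `[p, q]) g x.
Proof. by move=> bf bg; rewrite RintegralD//; exact: bdd_meas_integrable. Qed.

Lemma Rintegral_itvZ (k : R) f (p q : R) : bdd_meas f ->
  \int[mu1]_(x in `[p, q]) (k * f x) = k * \int[mu1]_(x in `[p, q]) f x.
Proof. by move=> bf; rewrite RintegralZl//; exact: bdd_meas_integrable. Qed.

Lemma Rintegral_indic_itv W (p q : R) : measurable W ->
  \int[mu1]_(x in `[p, q]) \1_W x = fine (mu1 (W `&` `[p, q])).
Proof. by move=> mW; rewrite /Rintegral integral_indic. Qed.

Lemma fine_itv_le W (p q l : R) : measurable W -> (mu1 W <= l%:E)%E ->
  \int[mu1]_(x in `[p, q]) \1_W x <= l.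
Proof.
move=> mW Wl; rewrite Rintegral_indic_itv// -lee_fin fineK.
  by apply: le_trans Wl; apply: le_measure; rewrite ?inE//; try exact: measurableI.
rewrite ge0_fin_numE//; apply: le_lt_trans (ltry l); apply: le_trans Wl.
by apply: le_measure; rewrite ?inE//; try exact: measurableI.
Qed.

Definition smoothly_approx (p q : R) W := forall e : R, 0 < e ->
  exists w w', [/\ C1_with w w', forall t, 0 <= w t <= 1 &
    \int[mu1]_(t in `[p, q]) `|\1_W t - w t| <= e].

Lemma C1_with_cst (c : R) : C1_with (fun=> c) (fun=> 0).
Proof. by split; [move=> t; exact: is_derive_cst|exact: cst_continuous]. Qed.

(** A pi-lambda argument starting from open half-lines, which generate the Borel sets and are stable
    under intersection. A proper difference is approximated by wA (1 - wB), which stays in [0, 1];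
    this range is what later makes convex combinations of fields admissible. *)
Lemma borel_smoothly_approx (p q : R) W : measurable W -> smoothly_approx p q W.
Proof.
have key : <<s setT, @RGenOInfty.G R >> `<=`
    [set W : set R | (measurable W /\ smoothly_approx p q W)].
  apply: lambda_system_subset => //.
  - move=> _ _ [x ->] [y ->]; exists (Num.max x y).
    apply/seteqP; split => z /=; rewrite !in_itv/= !andbT gt_max; first by move=> [-> ->].
    by move=> /andP[].
  - split => //.
    + split; first exact: measurableT.
      move=> e e0; exists (fun=> 1), (fun=> 0).
      split; [exact: C1_with_cst|by move=> t; rewrite ler01 lexx|].
      rewrite (@eq_Rintegral _ _ _ _ _ (fun=> 0)).
        by rewrite Rintegral_cst// mul0r ltW.
      by move=> x _; rewrite indicT subrr normr0.
    + move=> A B BA [mA aA] [mB aB]; split; first exact: measurableD.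
      move=> e e0.
      have [wA [wA' [A1 A2 A3]]] := aA (e / 2) ltac:(lra).
      have [wB [wB' [B1 B2 B3]]] := aB (e / 2) ltac:(lra).
      have B1' := C1_withB (C1_with_cst 1) B1.
      exists (fun t => wA t * (1 - wB t)); eexists; split.
      * exact (C1_withM A1 B1').
      * move=> t; have /andP[? ?] := A2 t; have /andP[? ?] := B2 t.
        by apply/andP; split; nra.
      have bA := bdd_meas_C1_with A1 A2; have bB := bdd_meas_C1_with B1 B2.
      have iA := bdd_meas_indic mA; have iB := bdd_meas_indic mB.
      have iAB := bdd_meas_indic (measurableD mA mB).
      have nA := bdd_meas_norm (bdd_measB iA bA).
      have nB := bdd_meas_norm (bdd_measB iB bB).
      apply: (@le_trans _ _ (\int[mu1]_(t in `[p, q]) (`|\1_A t - wA t| + `|\1_B t - wB t|))).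
        apply: le_Rintegral_itv.
        - exact (bdd_meas_norm (bdd_measB iAB (bdd_measM bA (bdd_measB (bdd_meas_cst 1) bB)))).
        - exact (bdd_measD nA nB).
        move=> t _; have /andP[a0 a1] := A2 t; have /andP[b0 b1] := B2 t.
        rewrite (_ : \1_(A `\` B) t = \1_A t * (1 - \1_B t) :> R); last first.
          by rewrite !indicE in_setD; case: (t \in A); case: (t \in B);
            rewrite /= ?subrr ?subr0 ?mulr0 ?mulr1.
        have : 0 <= (\1_B t : R) <= 1 by rewrite indicE; case: (t \in B); rewrite ?lexx ?ler01.
        move=> /andP[i0 i1].
        rewrite (_ : _ - _ = (\1_A t - wA t) * (1 - \1_B t) +
          wA t * - (\1_B t - wB t)); last by ring.
        rewrite (le_trans (ler_normD _ _))// !normrM normrN lerD//.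
          by rewrite ler_piMr// ger0_norm ?subr_ge0// gerBl.
        by rewrite ler_piMl// ger0_norm.
      rewrite RintegralD//; [|by apply: bdd_meas_integrable..].
      lra.
    + move=> F ndF HF.
      have mF n : measurable (F n) by have [] := HF n.
      have mUF : measurable (\bigcup_i F i) by exact: bigcupT_measurable.
      split => // e e0.
      have [] := @measure_ndseq_remainder _ _ _ mu1 `[p, q]%classic F (e / 2) _ _ mF ndF _ => //.
      * rewrite [ltLHS]lebesgue_measure_itv/=; case: ifP => _; last exact: ltry.
        by rewrite -EFinB ltry.
      * lra.
      move=> N /(_ N (leqnn N)) HN.
      have [_ aF] := HF N.
      have [w [w' [w1 w2 w3]]] := aF (e / 2) ltac:(lra).
      exists w, w'; split => //.
      have mD : measurable (\bigcup_k F k `\` F N) by exact: measurableD.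
      have bw := bdd_meas_C1_with w1 w2.
      have iN := bdd_meas_indic (mF N); have iU := bdd_meas_indic mUF.
      have iD := bdd_meas_indic mD.
      have nN := bdd_meas_norm (bdd_measB iN bw).
      apply: (@le_trans _ _ (\int[mu1]_(t in `[p, q])
          (\1_(\bigcup_k F k `\` F N) t + `|\1_(F N) t - w t|))).
        apply: le_Rintegral_itv.
        - exact (bdd_meas_norm (bdd_measB iU bw)).
        - exact (bdd_measD iD nN).
        move=> t _.
        rewrite (_ : _ - _ = \1_(\bigcup_k F k `\` F N) t + (\1_(F N) t - w t)); last first.
          rewrite !indicE in_setD; have [tN|tN] := boolP (t \in F N).
            rewrite (_ : t \in _ = true) ?andbF ?add0r//.
            by apply/mem_set; exists N => //; exact: set_mem.
          by rewrite andbT add0r.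
        by rewrite (le_trans (ler_normD _ _))// lerD2r ger0_norm// indicE.
      rewrite RintegralD//; [|by apply: bdd_meas_integrable..].
      rewrite -(_ : e / 2 + e / 2 = e); last lra.
      rewrite lerD// Rintegral_indic_itv//.
      move: HN; rewrite setIC => HN.
      rewrite -lee_fin fineK// ge0_fin_numE//; apply: le_lt_trans HN (ltry _).
  - move=> _ [x ->]; split; first exact: measurable_itv.
    move=> e e0.
    (* A ramp rising over [x, x + e] differs from the indicator of the half-line only on an interval
       of length e, and there by at most 1. *)
    pose k := e^-1; have k0 : 0 < k by rewrite invr_gt0.
    have ke : k * e = 1 by rewrite mulVf// gt_eqF.
    have S1 := C1_with_sstep k (- (k * x)).
    exists (fun t => sstep (k * t + - (k * x))); eexists.
    split; [exact: S1|by move=> t; exact: sstep_itv|].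
    have bs := bdd_meas_C1_with S1 (fun t => sstep_itv _).
    have m1 : measurable (`]x, +oo[%classic : set R) by exact: measurable_itv.
    have m2 : measurable (`]x, x + e]%classic : set R) by exact: measurable_itv.
    apply: (@le_trans _ _ (\int[mu1]_(t in `[p, q]) \1_`]x, x + e] t)).
      apply: le_Rintegral_itv.
      - exact (bdd_meas_norm (bdd_measB (bdd_meas_indic m1) bs)).
      - exact: bdd_meas_indic.
      move=> t _; rewrite !indicE.
      have /andP[s0 s1] := sstep_itv (k * t + - (k * x)).
      have [tx|tx] := leP t x.
        rewrite [t \in _]memNset/=; last by rewrite in_itv/= andbT ltNge tx.
        by rewrite sstep_le0 ?subrr ?normr0 ?ler0n//; nra.
      rewrite [t \in _]mem_set/=; last by rewrite in_itv/= andbT.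
      have [te|te] := leP t (x + e).
        rewrite [t \in _]mem_set/=; last by rewrite in_itv/= tx te.
        by rewrite ger0_norm ?subr_ge0// gerBl.
      by rewrite sstep_ge1 ?subrr ?normr0 ?ler0n//; nra.
    apply: fine_itv_le => //.
    rewrite [leLHS]lebesgue_measure_itv/= lte_fin; case: ifP => _; last by rewrite lee_fin ltW.
    by rewrite -EFinB lee_fin; lra.
move=> mW; apply: (key W _).2.
have : (@RGenOInfty.G R).-sigma.-measurable W by rewrite -RGenOInfty.measurableE.
by [].
Qed.

End line.

Section differentiation.
Variable R : realType.
Notation mu1 := (@lebesgue_measure R).
Implicit Types (W : set R) (f g : R -> R).

(** A density point of W inside ]c, d[ provides the interval. Rational endpoints leave only
    countably many candidates, and hence countably many profiles in [achievable_cover]. *)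
Lemma dense_subinterval W (c d : R) : measurable W ->
  mu1 (W `&` `[c, d]) != 0%E ->
  exists b e : rat, let h := ratr e - ratr b : R in
    [/\ c <= ratr b, ratr e <= d, 0 < h &
      ((h / 8)%:E <= mu1 (W `&` `[(ratr b + h / 4)%R, (ratr b + 3 / 4 * h)%R]))%E].
Proof.
move=> mW W0.
have [N [mN N0 HN]] := lebesgue_density mW.
have [x [[Wx xcd] nNx]] : exists x, (W `&` `]c, d[) x /\ ~ N x.
  apply: contrapT => H.
  have sub : W `&` `[c, d] `<=` N `|` [set c] `|` [set d].
    move=> x [Wx]; rewrite /= in_itv/= => /andP[cx xd].
    have [->|xc] := eqVneq x c; first by left; right.
    have [->|xd'] := eqVneq x d; first by right.
    left; left; apply: contrapT => nNx; apply: H; exists x; split => //; split => //=.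
    by rewrite in_itv/= !lt_neqAle cx xd eq_sym xc xd'.
  move: W0; rewrite -measure_le0 => /negP; apply.
  apply: (@le_trans _ _ (mu1 (N `|` [set c] `|` [set d]))).
    apply: le_measure; rewrite ?inE//.
      exact: measurableI.
    by apply: measurableU => //; exact: measurableU.
  apply: le_trans; first by apply: measureU2 => //; exact: measurableU.
  apply: (@le_trans _ _ (mu1 N + mu1 [set c] + mu1 [set d])%E).
    by apply: leeD => //; exact: measureU2.
  by rewrite N0 !lebesgue_measure_set1 !adde0.
move: xcd; rewrite /= in_itv/= => /andP[cx xd].
have : (mu1 (W `&` ball x r) * (mu1 (ball x r))^-1)%E @[r --> 0^'+] --> (1 : R)%:E.
  have : ~ (~` [set x | (mu1 (W `&` ball x r) * (mu1 (ball x r))^-1)%E @[r --> 0^'+]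
      --> (\1_W x)%:E]) x.
    by move=> /HN.
  by move=> /contrapT/=; rewrite indicE mem_set.
move=> /fine_cvgP[_ /cvgrPdist_le/(_ 2^-1 ltac:(lra))] H.
have [r [r0 rc rd Hr]] : exists r : R, [/\ 0 < r, c < x - 4 * r, x + 4 * r < d &
    `|1 - fine (mu1 (W `&` ball x r) * (mu1 (ball x r))^-1)%E| <= 2^-1].
  near (0 : R)^'+ => r; exists r; split.
  - by near: r; exact: nbhs_right_gt.
  - have : r < (x - c) / 4 by near: r; apply: nbhs_right_lt; rewrite divr_gt0// subr_gt0.
    lra.
  - have : r < (d - x) / 4 by near: r; apply: nbhs_right_lt; rewrite divr_gt0// subr_gt0.
    lra.
  - by near: r; exact: H.
have mb : mu1 (ball x r) = (r *+ 2)%:E by rewrite lebesgue_measure_ball// ltW.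
have fW : mu1 (W `&` ball x r) \is a fin_num.
  rewrite ge0_fin_numE//; apply: (@le_lt_trans _ _ (mu1 (ball x r))).
    by apply: le_measure; rewrite ?inE//; [apply: measurableI => //|]; exact: measurable_ball.
  by rewrite mb ltry.
have Wr : (r%:E <= mu1 (W `&` ball x r))%E.
  rewrite -(fineK fW) lee_fin.
  move: Hr; rewrite mb inver mulrn_eq0/= gt_eqF// fineM//= ler_distlC => /andP[+ _].
  rewrite -(fineK fW) /=; move: (fine _) => w.
  rewrite ler_pdivlMr; last by rewrite pmulrn_lgt0.
  rewrite -mulr_natr; lra.
(* The length h lies between 6r and 8r, so h/8 <= r, which W reaches on the ball of radius r; that
   ball also fits into the middle half of the interval. *)
have [b] := @rat_in_itvoo R (x - 4 * r) (x - 3 * r) ltac:(lra); rewrite in_itv/= => /andP[b1 b2].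
have [e] := @rat_in_itvoo R (x + 3 * r) (x + 4 * r) ltac:(lra); rewrite in_itv/= => /andP[e1 e2].
exists b, e; move: b1 b2 e1 e2; move: (ratr b : R) (ratr e : R) => b' e' b1 b2 e1 e2.
split; [lra|lra|lra|].
apply: (@le_trans _ _ r%:E); first by rewrite lee_fin; lra.
apply: (le_trans Wr); apply: le_measure; rewrite ?inE.
- by apply: measurableI => //; exact: measurable_ball.
- exact: measurableI.
- apply: setIS => y; rewrite /ball/= ltr_distlC => /andP[y1 y2].
  by rewrite in_itv/=; apply/andP; split; lra.
Unshelve. all: by end_near. Qed.

(** At a Lebesgue point where f vanishes, the mean of |f - f x| is the mean of f; it tends to 0, so
    the integral over [x - e, x + e] is o(e). A zero set of positive measure contains such a
    point. *)
Lemma bare_point f (p q : R) : bdd_meas f -> (forall x, 0 <= f x) ->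
  mu1 (`]p, q[ `&` [set x | f x = 0]) != 0%E ->
  exists x : R, p < x < q /\ forall r : R, 0 < r -> exists e0 : R, 0 < e0 /\
    forall e, 0 < e <= e0 -> \int[mu1]_(t in `[x - e, x + e]) f t <= r * e.
Proof.
move=> bf f0 pq0.
have [mf [C fC]] := bf.
have locf : locally_integrable setT f.
  split => //; first exact: openT.
  move=> K _ cK.
  have mK : measurable K by exact: compact_measurable.
  apply: (@le_lt_trans _ _ (\int[mu1]_(x in K) C%:E)%E).
    apply: ge0_le_integral => //=.
    - by apply/measurable_EFinP; apply: measurable_funTS; exact: measurableT_comp.
    - by move=> x _; rewrite lee_fin; apply: le_trans (fC x).
  rewrite integral_cst// lte_mul_pinfty ?lee_fin//.
    exact: le_trans (fC 0).
  exact: compact_finite_measure.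
have [N [mN N0 HN]] := lebesgue_differentiation locf.
have [x [[xpq fx] nNx]] : exists x, (`]p, q[ `&` [set x | f x = 0]) x /\ ~ N x.
  apply: contrapT => H; move: pq0; rewrite -measure_le0 => /negP; apply.
  rewrite -N0; apply: le_measure; rewrite ?inE//.
  - apply: measurableI => //; rewrite -[X in measurable X]setTI.
    exact: (mf measurableT _ (measurable_set1 0)).
  - move=> x Hx; apply: contrapT => nNx; apply: H; exists x; split => //.
exists x; split; first by move: xpq; rewrite /= in_itv.
have /contrapT lpt : ~ (~` [set x | lebesgue_pt f x]) x by move=> /HN.
move=> r r0; move: lpt; rewrite /lebesgue_pt/=.
move=> /fine_cvgP[fin_ /cvgrPdist_le/(_ (r / 4) ltac:(lra))] H.
have [e1 /= e10 He] : \forall t \near (0 : R)^'+,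
    davg f x t \is a fin_num /\ fine (davg f x t) <= r / 4.
  near=> t; split; first by near: t; exact: fin_.
  have : `|0 - fine (davg f x t)| <= r / 4 by near: t; exact: H.
  by rewrite sub0r normrN; apply: le_trans; exact: ler_norm.
exists (e1 / 4); split; first by rewrite divr_gt0.
move=> e /andP[e0 ee1].
(* The open ball of radius 2e contains the closed interval [x - e, x + e]; its length 4e is why the
   mean was bounded by r/4. *)
have [] := He (2 * e); rewrite /ball_ /= ?sub0r ?normrN ?gtr0_norm; try lra.
move=> fd hd.
have mb : mu1 (ball x (2 * e)) = ((2 * e) *+ 2)%:E.
  by rewrite lebesgue_measure_ball// mulr_ge0// ltW.
have e4 : (2 * e) *+ 2 = 4 * e by rewrite -mulr_natr; ring.
have intb : mu1.-integrable (ball x (2 * e)) (EFin \o f).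
  apply: measurable_bounded_integrable.
  - exact: measurable_ball.
  - by rewrite [ltLHS]mb ltry.
  - exact: measurable_funTS.
  - by exists C; split; [exact: num_real|move=> D /= CD y _; apply: le_trans (fC y) (ltW CD)].
have davgE : davg f x (2 * e) = (((4 * e)^-1)%:E * \int[mu1]_(y in ball x (2 * e)) (f y)%:E)%E.
  rewrite /davg /iavg mb e4 inver gt_eqF ?mulr_gt0//; congr (_ * _)%E.
  by apply: eq_integral => y _; rewrite /= fx subr0 ger0_norm.
have fI : (\int[mu1]_(y in ball x (2 * e)) (f y)%:E)%E \is a fin_num.
  by apply: integrable_fin_num => //; exact: measurable_ball.
apply: (@le_trans _ _ (fine (\int[mu1]_(y in ball x (2 * e)) (f y)%:E)%E)).
  rewrite fine_le//.
    by apply: integrable_fin_num => //; exact: bdd_meas_integrable.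
  apply: ge0_subset_integral => //=.
  - exact: measurable_ball.
  - by apply/measurable_EFinP; exact: measurable_funTS.
  - by move=> y _; rewrite lee_fin.
  - move=> y; rewrite /ball/= in_itv/= => /andP[y1 y2]; rewrite ltr_distlC; apply/andP; split; lra.
move: hd; rewrite davgE fineM//= ler_pdivrMl; last by rewrite mulr_gt0.
move=> /le_trans; apply; lra.
Unshelve. all: by end_near. Qed.

End differentiation.

(** * Perimeter of a set with nontrivial slices *)

Section slices.
Variable R : realType.
Notation mu1 := (@lebesgue_measure R).
Notation mu2 := (borel_measure2 R).
Variables p q c d : R.
Implicit Types (u g : R * R -> R).

Definition slice_fun u := [/\ measurable_fun setT u, exists C, forall z, `|u z| <= C &
  forall z, ~ rect p q c d z -> u z = 0].

Lemma rect_sqr_box : exists M, rect p q c d `<=` sqr_box M.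
Proof.
pose M := Num.max (Num.max `|p| `|q|) (Num.max `|c| `|d|).
exists M.
have aM : `|p| <= M by rewrite !le_max lexx.
have bM : `|q| <= M by rewrite !le_max lexx orbT.
have cM : `|c| <= M by rewrite !le_max lexx !orbT.
have dM : `|d| <= M by rewrite !le_max lexx !orbT.
move=> x /rectP[/andP[h1 h2] /andP[r s]]; apply/sqr_boxP.
move: aM bM cM dM; rewrite !ler_norml => /andP[? ?] /andP[? ?] /andP[? ?] /andP[? ?].
by split; apply/andP; split; lra.
Qed.

Lemma slice_fun_tame u : slice_fun u -> tame u.
Proof.
move=> [mu [C uC] u0]; split => //; have [M HM] := rect_sqr_box.
by exists M, C => x; split => // nx; apply: u0 => /HM.
Qed.

Lemma bdd_meas_slice u x : slice_fun u -> bdd_meas (fun y => u (x, y)).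
Proof.
move=> [mu [C uC] _]; split; last by exists C.
by apply: measurableT_comp => //; exact: measurable_pair1.
Qed.

Definition slice_int u x := \int[mu1]_(y in `[c, d]) u (x, y).

Let sliceT u x : slice_fun u ->
  (\int[mu1]_y (u (x, y))%:E)%E = (slice_int u x)%:E.
Proof.
move=> su; rewrite /slice_int /Rintegral fineK; last first.
  by apply: integrable_fin_num => //; apply: bdd_meas_integrable; exact: bdd_meas_slice.
rewrite [RHS]integral_mkcond; apply: eq_integral => y _; rewrite patchE; case: ifPn => //.
rewrite notin_setE /= in_itv/= => ycd; congr EFin; case: su => _ _; apply.
by move=> /rectP[_].
Qed.

Lemma bdd_meas_slice_int u : slice_fun u -> bdd_meas (slice_int u).
Proof.
move=> su; have tu := slice_fun_tame su; split.
  have := @measurable_fubini_F _ _ _ _ _ mu1 mu1 (EFin \o u) (tame_integrable measurableT tu).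
  rewrite [X in measurable_fun _ X](_ : _ = EFin \o slice_int u); last first.
    by apply/funext => x; exact: sliceT.
  by move=> /measurable_EFinP.
have [_ [C uC] _] := su.
exists (C * fine (mu1 `[c, d])) => x.
have bs := bdd_meas_slice x su.
apply: le_trans.
  by apply: le_normr_Rintegral => //; exact: bdd_meas_integrable.
rewrite -Rintegral_cst//.
apply: le_Rintegral_itv => //; [exact: bdd_meas_norm|exact: bdd_meas_cst].
Qed.

Lemma slice_fubini u : slice_fun u ->
  \int[mu2]_z u z = \int[mu1]_(x in `[p, q]) slice_int u x.
Proof.
move=> su; have tu := slice_fun_tame su.
have H := @integral12_prod_meas1 _ _ _ _ _ mu1 mu1 (EFin \o u) (tame_integrable measurableT tu).
refine (f_equal fine (eq_trans (esym H) _)).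
rewrite [RHS]integral_mkcond; apply: eq_integral => x _.
rewrite /fubini_F /= sliceT// patchE; case: ifPn => //.
rewrite notin_setE /= in_itv/= => xpq; rewrite /slice_int.
rewrite (@eq_Rintegral _ _ _ _ _ (fun=> 0)) ?Rintegral_cst ?mul0r//.
move=> y _; case: su => _ _; apply.
by move=> /rectP[].
Qed.

End slices.

Lemma convex_norm_le1 (R : realDomainType) (t a b : R) :
  0 <= t <= 1 -> `|a| <= 1 -> `|b| <= 1 -> `|t * a + (1 - t) * b| <= 1.
Proof.
move=> /andP[t0 t1] a1 b1; rewrite (le_trans (ler_normD _ _))// !normrM.
rewrite (ger0_norm t0) (@ger0_norm _ (1 - t)) ?subr_ge0//.
rewrite -[leRHS](subrKC t) lerD// ?ler_piMr// ?subr_ge0//.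
Qed.

(** Here i is the value of an indicator and w that of its smoothing; f1, f2 are the desired fluxes
    and a, b those actually attained. The smoothing costs B |i - w| and only one of the other two
    errors is active. *)
Lemma override_bound (R : realDomainType) (i w f1 f2 a b B : R) :
  i = 0 \/ i = 1 -> `|a - b| <= B ->
  `|i * f1 + (1 - i) * f2 - (w * a + (1 - w) * b)| <=
  `|f1 - a| + `|f2 - b| + B * `|i - w|.
Proof.
move=> i01 abB.
rewrite (_ : _ - _ = i * (f1 - a) + (1 - i) * (f2 - b) + (a - b) * (i - w)); last by ring.
rewrite (le_trans (ler_normD _ _))// lerD//; last by rewrite normrM ler_wpM2r.
rewrite (le_trans (ler_normD _ _))// lerD//; case: i01 => ->.
- by rewrite mul0r normr0.
- by rewrite mul1r.
- by rewrite subr0 mul1r.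
- by rewrite subrr mul0r normr0.
Qed.

(** * Vertical fields in a strip and their fluxes *)

Section strip.
Variable R : realType.
Notation mu1 := (@lebesgue_measure R).
Notation mu2 := (borel_measure2 R).
Variables (E : set (R * R)) (p q c d : R).
Hypotheses (mE : measurable E).
Implicit Types (g u : R * R -> R) (f : R -> R).

Definition strip_fun g := [/\ C1 g, forall z, `|g z| <= 1 &
  forall z, ~ rect p q c d z -> g z = 0].

Lemma closed_rect (a b c' d' : R) : closed (rect a b c' d').
Proof.
apply: compact_closed; first exact: norm_hausdorff.
by apply: compact_setX; exact: segment_compact.
Qed.

Lemma slice_fun_flux g : strip_fun g ->
  slice_fun p q c d (fun z => \1_E z * - 'D_(0, 1) g z).
Proof.
move=> [g1 gn g0]; have [M HM] := rect_sqr_box p q c d.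
have D0 z : ~ rect p q c d z -> 'D_(0, 1) g z = 0.
  by apply: derive_eq0_out => //; exact: closed_rect.
have tD : tame ('D_(0, 1) g).
  by apply: (@tame_continuous _ _ M); [exact: g1.2|move=> x nx; apply: D0 => /HM].
have [C DC] := tame_bound tD.
split.
- apply: measurable_funM; first exact: measurable_indic.
  by apply: measurableT_comp => //; exact: tame_measurable.
- exists C => z; rewrite normrM normrN -[leRHS]mul1r ler_pM//.
  by rewrite indicE; case: (z \in E); rewrite ?normr1// normr0.
- by move=> z /D0 ->; rewrite oppr0 mulr0.
Qed.

(** The share of the vertical line above x in the integral of the divergence of [(0, - g)] over E.
    With this sign, a profile gains where it falls on E. *)
Definition flux g := slice_int c d (fun z => \1_E z * - 'D_(0, 1) g z).

Lemma strip_fun_test g : strip_fun g -> test_field (fun z => (0, - g z)) /\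
  \int[mu2]_(z in E) div (fun z => (0, - g z)) z = \int[mu1]_(x in `[p, q]) flux g x.
Proof.
move=> sg; have [g1 gn g0] := sg; have [M HM] := rect_sqr_box p q c d.
split.
  apply: (@test_field_pair _ (fun=> 0) (fun z => - g z) M).
  - exact: C1_cst.
  - exact (C1N g1).
  - by move=> x nx; rewrite g0 ?oppr0// => /HM.
  - by move=> x; have := gn x; rewrite ler_norml => /andP[? ?]; nra.
rewrite -(slice_fubini (slice_fun_flux sg)) Rintegral_mkcond; apply: eq_Rintegral => z _.
rewrite patchE indicE /div/= derive_cst add0r deriveN; last exact: diff_derivable (g1.1 z).
by case: (z \in E); rewrite ?mul1r ?mul0r.
Qed.

(* Since the cutoffs w in [w g1 + (1 - w) g2] approximate indicators of Borel
   sets, fluxes can be chosen independently above each x; this replaces the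
   slicing theorem for functions of bounded variation. *)
Definition achievable f := bdd_meas f /\ forall e : R, 0 < e ->
  exists2 g, strip_fun g & \int[mu1]_(x in `[p, q]) `|f x - flux g x| <= e.

Lemma bdd_meas_flux g : strip_fun g -> bdd_meas (flux g).
Proof. by move=> sg; apply: bdd_meas_slice_int (slice_fun_flux sg). Qed.

Lemma achievable0 : achievable (fun=> 0).
Proof.
split; first exact: bdd_meas_cst.
move=> e e0; exists (fun=> 0).
  by split => //; [exact: C1_cst|move=> z; rewrite normr0].
rewrite (@eq_Rintegral _ _ _ _ _ (fun=> 0)) ?Rintegral_cst ?mul0r ?ltW//.
move=> x _; rewrite /flux /slice_int.
rewrite (@eq_Rintegral _ _ _ _ _ (fun=> 0)) ?Rintegral_cst ?mul0r ?subrr ?normr0//.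
by move=> y _; rewrite derive_cst oppr0 mulr0.
Qed.

(** The weight depends on the first coordinate only and the flux differentiates in the second, so no
    derivative of the weight appears, however steep it is. This makes independent choices over
    different x possible. *)
Lemma flux_interp (w w' : R -> R) g1 g2 x : C1_with w w' -> strip_fun g1 -> strip_fun g2 ->
  flux (fun z => w z.1 * g1 z + (1 - w z.1) * g2 z) x =
  w x * flux g1 x + (1 - w x) * flux g2 x.
Proof.
move=> ww' sg1 sg2; have [C1g1 _ _] := sg1; have [C1g2 _ _] := sg2.
have wC1 := C1_with_fst ww'.
have b1 := bdd_meas_slice x (slice_fun_flux sg1).
have b2 := bdd_meas_slice x (slice_fun_flux sg2).
rewrite /flux /slice_int -!RintegralZl//; [|exact: bdd_meas_integrable..].
rewrite -RintegralD//; last 2 first.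
- exact (bdd_meas_integrable c d (bdd_measM (bdd_meas_cst (w x)) b1)).
- exact (bdd_meas_integrable c d (bdd_measM (bdd_meas_cst (1 - w x)) b2)).
apply: eq_Rintegral => y _.
rewrite (derive_interp _ _ wC1 C1g1 C1g2) (derive_with_fst _ _ ww') /=; ring.
Qed.

Lemma achievable_override W f1 f2 : measurable W -> achievable f1 -> achievable f2 ->
  achievable (fun x => \1_W x * f1 x + (1 - \1_W x) * f2 x).
Proof.
move=> mW [bf1 af1] [bf2 af2].
have bW := bdd_meas_indic mW.
have bW' := bdd_measB (bdd_meas_cst 1) bW.
have bF := bdd_measD (bdd_measM bW bf1) (bdd_measM bW' bf2).
split => // e e0.
have [g1 sg1 e1] := af1 (e / 4) ltac:(lra).
have [g2 sg2 e2] := af2 (e / 4) ltac:(lra).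
have bg1 := bdd_meas_flux sg1; have bg2 := bdd_meas_flux sg2.
(* B bounds the gap between the two attained fluxes, so the smoothing of W can be chosen only after
   g1 and g2; B + 1 avoids a division by zero. *)
have [_ [B HB]] := bdd_meas_norm (bdd_measB bg1 bg2).
have B0 : 0 <= B by apply: le_trans (HB 0).
have B1 : 0 < B + 1 by rewrite ltr_wpDl.
have D0 : 0 < 2 * (B + 1) by rewrite mulr_gt0.
have [w [w' [ww' w01 we]]] := borel_smoothly_approx p q mW (divr_gt0 e0 D0).
have bw := bdd_meas_C1_with ww' w01.
exists (fun z => w z.1 * g1 z + (1 - w z.1) * g2 z).
  have [C1g1 ng1 g10] := sg1; have [C1g2 ng2 g20] := sg2.
  have wC1 := C1_with_fst ww'.
  split.
  - exact (C1D (C1M wC1 C1g1) (C1M (C1B (@C1_cst _ _ _ (1 : R)) wC1) C1g2)).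
  - by move=> z; exact: convex_norm_le1.
  - by move=> z nz; rewrite g10// g20// !mulr0 addr0.
have n1 := bdd_meas_norm (bdd_measB bf1 bg1).
have n2 := bdd_meas_norm (bdd_measB bf2 bg2).
have nW := bdd_meas_norm (bdd_measB bW bw).
have nBW := bdd_measM (bdd_meas_cst B) nW.
apply: (@le_trans _ _ (\int[mu1]_(x in `[p, q])
    (`|f1 x - flux g1 x| + `|f2 x - flux g2 x| + B * `|\1_W x - w x|))).
  under eq_Rintegral do rewrite (flux_interp _ ww' sg1 sg2).
  apply: le_Rintegral_itv.
  - exact (bdd_meas_norm (bdd_measB bF (bdd_measD (bdd_measM bw bg1)
      (bdd_measM (bdd_measB (bdd_meas_cst 1) bw) bg2)))).
  - exact (bdd_measD (bdd_measD n1 n2) nBW).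
  move=> x _.
  apply: override_bound; first by rewrite indicE; case: (x \in W); [right|left].
  by apply: le_trans (HB x); rewrite normr_id.
rewrite (Rintegral_itvD p q (bdd_measD n1 n2) nBW) (Rintegral_itvD p q n1 n2).
rewrite (Rintegral_itvZ B p q nW).
have : B * \int[mu1]_(x in `[p, q]) `|\1_W x - w x| <= e / 2.
  apply: (@le_trans _ _ (B * (e / (2 * (B + 1))))); first exact: ler_wpM2l.
  rewrite (_ : B * _ = (e / 2) * (B / (B + 1))); last by field; rewrite gt_eqF.
  by rewrite ler_piMr ?ler_pdivrMr ?mul1r ?lerDl ?divr_ge0// ltW.
move=> e3; rewrite [leRHS](_ : e = e / 4 + e / 4 + e / 2); last by field.
exact (lerD (lerD e1 e2) e3).
Qed.

End strip.

Section strip_field.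
Variable R : realType.
Notation mu1 := (@lebesgue_measure R).
Notation mu2 := (borel_measure2 R).
Variables (E : set (R * R)) (p q c d : R).
Hypotheses (mE : measurable E) (pq : p < q) (cd : c < d).
Implicit Types (g u : R * R -> R) (f k : R -> R).

Let K := rect p q c d.
Let mK : measurable K. Proof. exact: measurable_rect. Qed.
Let mEK : measurable (E `&` K). Proof. exact: measurableI. Qed.

Let indic01 (A : set (R * R)) z : `|\1_A z| <= 1 :> R.
Proof. by rewrite indicE; case: (z \in A); rewrite ?normr1// normr0. Qed.

Let slice_fun_base k' : continuous k' -> (exists C, forall t, `|k' t| <= C) ->
  slice_fun p q c d (fun z => \1_(E `&` K) z * - k' z.2).
Proof.
move=> ck' [C k'C]; split.
- apply: measurable_funM; first exact: measurable_indic.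
  apply: measurableT_comp => //; apply: measurableT_comp => //.
  exact: continuous_measurable_fun.
- exists C => z; rewrite normrM normrN -[leRHS]mul1r ler_pM//; exact: indic01.
- by move=> z nz; rewrite indicE memNset ?mul0r// => -[].
Qed.

Let slice_fun_indic : slice_fun p q c d (\1_(E `&` K)).
Proof.
split; first exact: measurable_indic.
  by exists 1 => z; exact: indic01.
by move=> z nz; rewrite indicE memNset// => -[].
Qed.

Definition slice_mass := slice_int c d (\1_(E `&` K)).

Lemma bdd_meas_slice_mass : bdd_meas slice_mass.
Proof. exact: bdd_meas_slice_int slice_fun_indic. Qed.

Lemma slice_mass_ge0 x : 0 <= slice_mass x.
Proof. by apply: Rintegral_ge0 => y _; rewrite indicE. Qed.

Lemma integral_slice_mass :
  \int[mu1]_(x in `[p, q]) slice_mass x = fine (mu2 (E `&` K)).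
Proof.
rewrite -(slice_fubini slice_fun_indic) /Rintegral; congr fine.
by rewrite integral_indic// setIT.
Qed.

Let base k' := slice_int c d (fun z => \1_(E `&` K) z * - k' z.2).

(** A profile in the second variable alone is not supported in the strip. A plateau in the first
    variable cuts it off near p and q; the flux changes only over two intervals of length h, by at
    most C, whence h = e / (2 (C + 1)). *)
Lemma achievable_base k k' : C1_with k k' -> (exists C, forall t, `|k' t| <= C) ->
  (forall t, `|k t| <= 1) -> (forall t, ~ (c <= t <= d) -> k t = 0) ->
  achievable E p q c d (base k').
Proof.
move=> kk' bk' k1 k0.
have sb := slice_fun_base kk'.2 bk'.
have bb : bdd_meas (base k') := bdd_meas_slice_int sb.
split => // e e0.
have [_ [C HC]] := bb.
have C0 : 0 <= C by apply: le_trans (HC 0).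
have C1 : 0 < C + 1 by rewrite ltr_wpDl.
pose h := e / (2 * (C + 1)).
have h0 : 0 < h by rewrite divr_gt0// mulr_gt0.
have [f [f' [ff' f_]]] := plateau (p + h) (q - h) h0.
have f01 t : 0 <= f t <= 1 by have [] := f_ t.
have bf := bdd_meas_C1_with ff' f01.
have kC1 := C1_with_snd kk'; have fC1 := C1_with_fst ff'.
have sg : strip_fun p q c d (fun z => f z.1 * k z.2).
  split; first exact (C1M fC1 kC1).
    move=> z; have /andP[? ?] := f01 z.1.
    by rewrite normrM -[leRHS]mul1r ler_pM// ger0_norm.
  move=> z nz.
  have [zpq|zpq] := pselect (p <= z.1 <= q); last first.
    have [_ _ _ Hf] := f_ z.1; have [|-> _] := Hf; last by rewrite mul0r.
    apply: contrapT => H; apply: zpq; apply/andP; split; rewrite leNgt; apply/negP => H'; apply: H.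
      by left; rewrite addrK.
    by right; rewrite subrK.
  rewrite k0 ?mulr0// => zcd; apply: nz; exact/rectP.
exists (fun z => f z.1 * k z.2) => //.
have fluxE x : p <= x <= q -> flux E c d (fun z => f z.1 * k z.2) x = f x * base k' x.
  move=> xpq; rewrite /flux /base /slice_int -Rintegral_itvZ; last exact: bdd_meas_slice x sb.
  apply: eq_Rintegral => y; rewrite inE /= in_itv/= => ycd.
  have -> : 'D_(0, 1) (fun z : R * R => f z.1 * k z.2) (x, y) = f x * k' y.
    rewrite (@deriveM _ _ (fun z : R * R => f z.1) (fun z : R * R => k z.2)).
    - by rewrite (derive_with_fst _ _ ff') (derive_with_snd _ _ kk')/= mulr0 scaler0 addr0 mulr1.
    - exact: diff_derivable (fC1.1 (x, y)).
    - exact: diff_derivable (kC1.1 (x, y)).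
  have -> : \1_(E `&` K) (x, y) = \1_E (x, y) :> R.
    rewrite !indicE in_setI (_ : (x, y) \in K) ?andbT//.
    by rewrite inE; exact/rectP.
  by rewrite -mulrN mulrCA.
pose A : set R := `[p, p + h]%classic.
pose B : set R := `[q - h, q]%classic.
have mA : measurable A by exact: measurable_itv.
have mB : measurable B by exact: measurable_itv.
have bAB := bdd_measD (bdd_meas_indic mA) (bdd_meas_indic mB).
apply: (@le_trans _ _ (\int[mu1]_(x in `[p, q]) (C * (\1_A x + \1_B x)))).
  apply: le_Rintegral_itv.
  - exact (bdd_meas_norm (bdd_measB bb (bdd_meas_flux mE sg))).
  - exact (bdd_measM (bdd_meas_cst C) bAB).
  move=> x xpq; rewrite fluxE//; move: xpq => /andP[xp xq].
  rewrite -{1}(mul1r (base k' x)) -mulrBl normrM mulrC ler_pM//.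
  have /andP[fx0 fx1] := f01 x.
  rewrite ger0_norm ?subr_ge0// !indicE.
  have [xA|xA] := leP x (p + h).
    rewrite (_ : x \in A); last by rewrite inE /A/= in_itv/= xp.
    by rewrite (@le_trans _ _ 1) ?gerBl// lerDl.
  have [xB|xB] := leP (q - h) x.
    rewrite (_ : x \in B); last by rewrite inE /B/= in_itv/= xB.
    by rewrite (@le_trans _ _ 1) ?gerBl// lerDr.
  have [_ _ H _] := f_ x.
  have [-> _] := H ltac:(by rewrite (ltW xA) (ltW xB)).
  by rewrite subrr addr_ge0.
rewrite (Rintegral_itvZ C p q bAB) (Rintegral_itvD p q (bdd_meas_indic mA) (bdd_meas_indic mB)).
have hA : \int[mu1]_(x in `[p, q]) \1_A x <= h.
  apply: fine_itv_le => //; rewrite [leLHS]lebesgue_measure_itv/= lte_fin ltrDl h0.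
  by rewrite -EFinB lee_fin addrC addKr.
have hB : \int[mu1]_(x in `[p, q]) \1_B x <= h.
  apply: fine_itv_le => //; rewrite [leLHS]lebesgue_measure_itv/= lte_fin ltrBlDr ltrDl h0.
  by rewrite -EFinB lee_fin opprB addrCA subrr addr0.
apply: (@le_trans _ _ (C * (h + h))); first by rewrite ler_wpM2l// lerD.
rewrite /h (_ : C * _ = e * (C / (C + 1))); last by field; rewrite gt_eqF.
by rewrite ler_piMr ?ltW// ltr_pdivrMr// mul1r ltrDl.
Qed.

Let valid (j : rat * rat) := [&& c <= ratr j.1, ratr j.2 <= d & (ratr j.1 : R) < ratr j.2].
Let len (j : rat * rat) : R := ratr j.2 - ratr j.1.
Let mid (j : rat * rat) : set R := `[ratr j.1 + len j / 4, ratr j.1 + 3 / 4 * len j]%classic.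
(** The abscissas for which one bump, falling across the rational interval j, works for all lines at
    once: E fills at least an eighth of the length of j inside its middle half. Intervals not
    contained in [c, d] are discarded. *)
Let X (j : rat * rat) : set R := if valid j then
  [set x | ((len j / 8)%:E <= mu1 (xsection (E `&` ([set: R] `*` mid j)) x))%E] else set0.

Let mX j : measurable (X j).
Proof.
rewrite /X; case: ifPn => // _.
have mM : measurable (E `&` ([set: R] `*` mid j)).
  by apply: measurableI => //; apply: measurableX => //; exact: measurable_itv.
have := @measurable_fun_xsection _ _ _ _ _ mu1 _ mM.
move=> /(_ measurableT _ (@emeasurable_itv R (Interval (BLeft (len j / 8)%:E) +oo%O))).
rewrite setTI; congr measurable; apply/seteqP; split => x /=; rewrite in_itv/= andbT//.
Qed.

(* The profile rises slowly over [c, d] and falls steeply across an interval where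
   the slice of E is dense. *)
Lemma achievable_bump j : exists2 f, achievable E p q c d f &
  forall x, p <= x <= q -> X j x -> 8^-1 - 2 / (d - c) * slice_mass x <= f x.
Proof.
rewrite /X; case: ifPn => [/and3P[cb ed be]|_]; last first.
  by exists (fun=> 0) => //; exact: achievable0.
pose b : R := ratr j.1; pose h := len j.
have h0 : 0 < h by rewrite subr_gt0.
have L0 : 0 < d - c by rewrite subr_gt0.
pose l := (d - c)^-1; have l0 : 0 < l by rewrite invr_gt0.
pose i := h^-1; have i0 : 0 < i by rewrite invr_gt0.
have ll : l * (d - c) = 1 by rewrite mulVf// gt_eqF.
have ih : i * h = 1 by rewrite mulVf// gt_eqF.
have kk' := C1_withB (C1_with_sstep l (- (l * c))) (C1_with_sstep i (- (i * b))).
set k := (X in C1_with X) in kk'; set k' := (X in C1_with _ X) in kk'.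
have bk' : exists C, forall t, `|k' t| <= C.
  exists (2 * l + 2 * i) => t; rewrite /k'.
  have := dsstep_ge0 (l * t - l * c); have := dsstep_le2 (l * t - l * c).
  have := dsstep_ge0 (i * t - i * b); have := dsstep_le2 (i * t - i * b).
  move: (dsstep _) (dsstep _) => u v *; rewrite ler_norml; apply/andP; split; nra.
exists (base k').
  apply: (achievable_base kk' bk').
    move=> t; rewrite /k; have /andP[? ?] := sstep_itv (l * t - l * c).
    by have /andP[? ?] := sstep_itv (i * t - i * b); rewrite ler_norml; apply/andP; split; lra.
  move=> t tcd; rewrite /k.
  have bd : b + h <= d by rewrite /b /h /len addrC subrK.
  have [tc|tc] := leP c t; last first.
    rewrite !sstep_le0 ?subrr// -mulrBr pmulr_rle0// subr_le0; last exact: ltW.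
    by apply: le_trans (ltW tc) _.
  have [td|td] := leP t d; first by exfalso; apply: tcd; rewrite tc td.
  rewrite !sstep_ge1 ?subrr// -mulrBr ?{1}/l.
    by rewrite -ih ler_pM2l// lerBrDl; apply: le_trans bd (ltW td).
  by rewrite -ll ler_pM2l// lerD2r ltW.
move=> x xpq Xx.
have sb := slice_fun_base kk'.2 bk'.
have mM : measurable (mid j) by exact: measurable_itv.
pose S : set R := xsection (E `&` ([set: R] `*` mid j)) x.
have mS : measurable S.
  by apply: measurable_xsection; apply: measurableI => //; exact: measurableX.
have Scd : S `<=` `[c, d].
  move=> y; rewrite /S /xsection/= inE => -[_ [_]].
  rewrite /mid/= !in_itv/= -/b -/h => /andP[y1 y2].
  have bd : b + h <= d by rewrite /b /h /len addrC subrK.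
  have cb' : c <= b by [].
  by apply/andP; split; lra.
have bS := bdd_meas_indic mS.
have bm := bdd_meas_slice x slice_fun_indic.
(* On S the fall has slope at least i = 1/h, and on all of E the rise has slope at most 2l = 2/(d -
   c). As S has measure at least h/8, the fall contributes at least 1/8. *)
apply: (@le_trans _ _ (\int[mu1]_(y in `[c, d]) (i * \1_S y + - (2 * l) * \1_(E `&` K) (x, y)))).
  rewrite Rintegral_itvD; last 2 first.
  - exact (bdd_measM (bdd_meas_cst i) bS).
  - exact (bdd_measM (bdd_meas_cst _) bm).
  rewrite (Rintegral_itvZ i c d bS) (Rintegral_itvZ _ c d bm).
  rewrite -/(slice_int c d (\1_(E `&` K)) x) -/slice_mass.
  rewrite mulNr lerD2r Rintegral_indic_itv// (setIidl Scd).
  have fS : mu1 S \is a fin_num.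
    rewrite ge0_fin_numE//; apply: (@le_lt_trans _ _ (mu1 `[c, d])).
      by apply: le_measure; rewrite ?inE.
    by rewrite lebesgue_measure_itv/=; case: ifP => _; rewrite ?ltry// -EFinB ltry.
  have : len j / 8 <= fine (mu1 S) by rewrite -lee_fin fineK.
  rewrite -/h => hS; rewrite -(ler_pM2l h0) mulrA mulfV ?gt_eqF// mul1r; lra.
apply: le_Rintegral_itv.
- exact (bdd_measD (bdd_measM (bdd_meas_cst i) bS) (bdd_measM (bdd_meas_cst (- (2 * l))) bm)).
- exact (bdd_meas_slice x sb).
move=> y ycd; rewrite /k'/=.
have := dsstep_ge0 (l * y - l * c); have := dsstep_le2 (l * y - l * c).
have := dsstep_ge0 (i * y - i * b).
have SE : y \in S -> (x, y) \in E `&` K /\ 1 <= dsstep (i * y - i * b).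
  rewrite inE /S /xsection/= inE => -[Exy [_]].
  rewrite /mid/= in_itv/= -/b -/h => /andP[y1 y2]; split.
    by rewrite inE; split => //; exact/rectP.
  apply: dsstep_mid; rewrite -mulrBr; apply/andP; split.
    by rewrite (_ : 4^-1 = i * (h / 4)); [rewrite ler_pM2l//; lra|rewrite mulrA ih mul1r].
  by rewrite (_ : 3 / 4 = i * (3 / 4 * h)); [rewrite ler_pM2l//; lra|rewrite mulrCA ih mulr1].
rewrite !indicE; case: (boolP (y \in S)) => [/SE[-> ?]|nS] ? ? ? /=.
  nra.
case: ((x, y) \in E `&` K) => /=; nra.
Qed.

Let F (n : nat) : set R := \bigcup_(i in [set i | (i < n)%N])
  (if unpickle i is Some j then X j else set0).

Let mF n : measurable (F n).
Proof. by apply: bigcup_measurable => i _; case: unpickle. Qed.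

(** By induction over the codes of rational pairs: on [W] the new bump overrides the function built
    so far, elsewhere the old bound survives. Overlaps do no harm, as each bump alone guarantees 1/8
    minus the loss. *)
Lemma achievable_cover n : exists2 f, achievable E p q c d f &
  forall x, p <= x <= q -> 8^-1 * \1_(F n) x - 2 / (d - c) * slice_mass x <= f x.
Proof.
have cs x : 0 <= 2 / (d - c) * slice_mass x.
  by rewrite mulr_ge0 ?slice_mass_ge0// divr_ge0// subr_ge0 ltW.
elim: n => [|n [f af Hf]].
  exists (fun=> 0); first exact: achievable0.
  move=> x _; rewrite indicE memNset ?mulr0 ?sub0r ?oppr_le0//.
  by move=> [].
pose W := if unpickle n is Some j then X j else set0.
have [f1 af1 Hf1] : exists2 f, achievable E p q c d f &
  forall x, p <= x <= q -> W x -> 8^-1 - 2 / (d - c) * slice_mass x <= f x.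
  rewrite /W; case: unpickle => [j|]; first exact: achievable_bump.
  by exists (fun=> 0) => //; exact: achievable0.
have mW : measurable W by rewrite /W; case: unpickle.
exists (fun x => \1_W x * f1 x + (1 - \1_W x) * f x); first exact: achievable_override.
move=> x xpq; rewrite [\1_W x]indicE; case: (boolP (x \in W)) => [/set_mem Wx|/negP nWx].
  rewrite mul1r subrr mul0r addr0; apply: le_trans (Hf1 _ xpq Wx).
  by rewrite lerD2r ler_piMr// indicE lern1 leq_b1.
rewrite mul0r add0r subr0 mul1r; apply: le_trans (Hf _ xpq).
rewrite lerD2r ler_pM2l// !indicE ler_nat.
case: (boolP (x \in F n.+1)) => // /set_mem[i /= ilt Wi].
rewrite mem_set// /F; exists i => //=.
rewrite ltn_neqAle -ltnS ilt andbT; apply/eqP => ni.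
by apply: nWx; apply/mem_set; rewrite /W -ni.
Qed.

Let cover x : p <= x <= q -> slice_mass x != 0 -> (\bigcup_n F n) x.
Proof.
move=> xpq mx.
have mW : measurable (xsection E x) by exact: measurable_xsection.
have W0 : mu1 (xsection E x `&` `[c, d]) != 0%E.
  apply: contra_neq mx => W0; rewrite /slice_mass /slice_int.
  transitivity (\int[mu1]_(y in `[c, d]) \1_(xsection E x) y); last first.
    by rewrite Rintegral_indic_itv// W0.
  apply: eq_Rintegral => y; rewrite inE /= in_itv/= => ycd; rewrite !indicE in_setI.
  rewrite (_ : (x, y) \in K) ?andbT; last by rewrite inE; exact/rectP.
  congr (nat_of_bool _)%:R; rewrite /xsection.
  by apply/idP/idP => H; [apply/mem_set|move/set_mem: H].
have [b [e /= [cb ed h0 H]]] := dense_subinterval mW W0.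
have : exists n : nat, unpickle n = Some (b, e) by exists (pickle (b, e)); exact: pickleK.
move=> [n nbe]; exists n.+1 => //; exists n; first exact: ltnSn.
rewrite nbe /X /valid /= cb ed -subr_gt0 h0 /=; apply: le_trans H _.
apply: le_measure; rewrite ?inE.
- by apply: measurableI => //; exact: measurable_itv.
- apply: measurable_xsection; apply: measurableI => //; apply: measurableX => //.
  exact: measurable_itv.
- by move=> y [/set_mem Ey ymid]; apply/mem_set; split.
Qed.

(** By [cover], almost every x lies in some F n, hence finitely many codes serve lines of total
    measure at least (q - p)/2. Each gains 1/8, which gives (q - p)/16; the mass term is the price
    of the slow rise, and e that of smoothing. *)
Lemma strip_field (e : R) : mu1 (`]p, q[ `&` [set x | slice_mass x = 0]) = 0%E ->
  0 < e -> exists phi, [/\ test_field phi, forall z, ~ K z -> phi z = 0 &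
    (q - p) / 16 - 2 / (d - c) * fine (mu2 (E `&` K)) - e <=
      \int[mu2]_(z in E) div phi z].
Proof.
move=> null e0.
pose D : set R := `]p, q[%classic.
have mD : measurable D by exact: measurable_itv.
have muD : mu1 D = (q - p)%:E by rewrite [LHS]lebesgue_measure_itv/= lte_fin pq EFinB.
have Dfin : (mu1 D < +oo)%E by rewrite muD ltry.
have mUF : measurable (\bigcup_n F n) by exact: bigcupT_measurable.
have ndF : nondecreasing_seq F.
  move=> n m nm; apply/subsetPset => x [i /= ilt Xi]; exists i => //=.
  exact: leq_trans nm.
have qp2 : 0 < (q - p) / 2 by rewrite divr_gt0// subr_gt0.
have [N /(_ N (leqnn N)) HN] := @measure_ndseq_remainder _ _ _ mu1 D F _ mD Dfin mF ndF qp2.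
have DF0 : mu1 (D `\` \bigcup_n F n) = 0%E.
  apply/eqP; rewrite eq_le measure_ge0 andbT -null; apply: le_measure; rewrite ?inE.
  - exact: measurableD.
  - apply: measurableI => //.
    have [mm _] := bdd_meas_slice_mass.
    by have := mm measurableT _ (measurable_set1 0); rewrite setTI.
  - move=> x [Dx nF]; split => //=; apply: contrapT => /eqP mx; apply: nF; apply: cover => //.
    by move: Dx; rewrite /D/= in_itv/= => /andP[/ltW-> /ltW->].
have mDF : measurable (D `&` F N) by exact: measurableI.
have mR : measurable (D `&` (\bigcup_k F k `\` F N)).
  by apply: measurableI => //; exact: measurableD.
have mDU : measurable (D `\` \bigcup_n F n) by exact: measurableD.
have fDF : mu1 (D `&` F N) \is a fin_num.
  rewrite ge0_fin_numE//; apply: le_lt_trans Dfin; apply: le_measure; rewrite ?inE//.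
have DFN : (q - p) / 2 <= fine (mu1 (D `&` F N)).
  have : (mu1 D <= mu1 (D `&` F N) + ((q - p) / 2)%:E)%E.
    have : (mu1 D <= mu1 (D `&` F N) + mu1 (D `&` (\bigcup_k F k `\` F N)) +
        mu1 (D `\` \bigcup_n F n))%E.
      apply: (@le_measureU3 _ _ _ mu1 _ _ _ _ mD mDF mR mDU) => x Dx.
      have [Fx|nFx] := pselect ((\bigcup_n F n) x); last by right.
      by left; have [FNx|nFNx] := pselect (F N x); [left|right].
    rewrite DF0 adde0 => H; apply: le_trans H _; exact: leeD2l.
  by rewrite muD -(fineK fDF) -EFinD lee_fin; lra.
have [f [bf af] Hf] := achievable_cover N.
have [g sg Hg] := af e e0.
have [tphi Hphi] := strip_fun_test mE sg.
exists (fun z => (0, - g z)); split => //.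
  by move=> z nz; have [_ _ ->] := sg; rewrite ?oppr0.
rewrite Hphi.
have bF := bdd_meas_indic (mF N).
have bm := bdd_meas_slice_mass.
have bg := bdd_meas_flux mE sg.
have n1 := bdd_meas_norm (bdd_measB bf bg).
have H1 : \int[mu1]_(x in `[p, q]) (8^-1 * \1_(F N) x + - (2 / (d - c)) * slice_mass x) <=
    \int[mu1]_(x in `[p, q]) (flux E c d g x + `|f x - flux E c d g x|).
  apply: le_Rintegral_itv.
  - exact (bdd_measD (bdd_measM (bdd_meas_cst _) bF) (bdd_measM (bdd_meas_cst _) bm)).
  - exact (bdd_measD bg n1).
  move=> x xpq; rewrite mulNr; apply: le_trans (Hf x xpq) _.
  by rewrite -lerBlDl ler_norm.
move: H1; rewrite (Rintegral_itvD p q (bdd_measM (bdd_meas_cst _) bF)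
  (bdd_measM (bdd_meas_cst _) bm)).
rewrite (Rintegral_itvD p q bg n1) (Rintegral_itvZ _ p q bF) (Rintegral_itvZ _ p q bm).
rewrite integral_slice_mass Rintegral_indic_itv// => H1.
rewrite lerBlDr; apply: le_trans (le_trans H1 _); last by rewrite lerD2l.
rewrite mulNr lerD2r.
have mFp : measurable (F N `&` `[p, q]) by exact: measurableI.
have : fine (mu1 (D `&` F N)) <= fine (mu1 (F N `&` `[p, q])).
  apply: fine_le => //.
    rewrite ge0_fin_numE//; apply: (@le_lt_trans _ _ (mu1 `[p, q])).
      by apply: le_measure; rewrite ?inE//; do ?[exact: mFp|exact: subIsetr].
    by rewrite lebesgue_measure_itv/= lte_fin pq -EFinB ltry.
  apply: le_measure; rewrite ?inE//; do ?[exact: mFp|exact: mDF].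
  move=> x [Dx Fx]; split => //; move: Dx; rewrite /D/= !in_itv/= => /andP[/ltW-> /ltW->]//.
move=> /(le_trans DFN) H2.
rewrite (_ : 16 = 2 * 8); last by rewrite -natrM.
by rewrite invfM mulrA mulrC ler_pM2l.
Qed.

End strip_field.

(** * Squares of small density: a gaining field or a cut *)

Section square.
Variable R : realType.
Notation mu1 := (@lebesgue_measure R).
Notation mu2 := (borel_measure2 R).
Implicit Types (E F : set (R * R)).

(* The segment {a} x [c, d] carries no trace of E, so E can be cut along it. *)
Definition bare E (a c d : R) := forall r : R, 0 < r -> exists2 e0 : R, 0 < e0 &
  forall e, 0 < e <= e0 -> (mu2 (E `&` rect (a - e) (a + e) c d) <= (r * e)%:E)%E.

Lemma rect_fin E a b c d : measurable E -> mu2 (E `&` rect a b c d) \is a fin_num.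
Proof.
move=> mE; have [M HM] := rect_sqr_box a b c d.
rewrite ge0_fin_numE//; apply: le_lt_trans (sqr_box_fin M).
apply: le_measure; rewrite ?inE.
- by apply: measurableI => //; exact: measurable_rect.
- exact: measurable_sqr_box.
- by move=> x [_ /HM].
Qed.

Lemma slice_massS E p q p' q' c d x : p <= p' -> q' <= q -> p' <= x <= q' ->
  slice_mass E p q c d x = slice_mass E p' q' c d x.
Proof.
move=> pp qq /andP[px xq]; apply: eq_Rintegral => y _.
rewrite !indicE !(in_setI _ E).
rewrite (_ : (x, y) \in rect p q c d = ((x, y) \in rect p' q' c d))//.
apply/idP/idP => /set_mem/rectP[/= _ h]; apply/mem_set/rectP; split => //=.
  by rewrite px xq.
by rewrite (le_trans pp px) (le_trans xq qq).
Qed.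

(** Either almost every vertical line charges E, and [strip_field] applies, or the zeros of
    [slice_mass] have positive measure and [bare_point] finds a line with mass o(e) around it. *)
Lemma strip_dichotomy E p q c d (e : R) : measurable E -> p < q -> c < d -> 0 < e ->
  (exists phi, [/\ test_field phi, forall z, ~ rect p q c d z -> phi z = 0 &
    (q - p) / 16 - 2 / (d - c) * fine (mu2 (E `&` rect p q c d)) - e <=
      \int[mu2]_(z in E) div phi z]) \/
  exists2 a, p < a < q & bare E a c d.
Proof.
move=> mE pq cd e0.
have [null|nnull] := eqVneq (mu1 (`]p, q[ `&` [set x | slice_mass E p q c d x = 0])) 0%E.
  by left; exact: strip_field.
right; have [a [apq Ha]] := bare_point (bdd_meas_slice_mass p q c d mE)
  (slice_mass_ge0 E p q c d) nnull.
exists a => // r r0; have [e1 [e10 He1]] := Ha r r0.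
have /andP[pa aq] := apq.
(* The distances to p and q keep [a - h, a + h] within the strip, where the slice masses of the thin
   and the full strip coincide. *)
exists (Num.min e1 (Num.min (a - p) (q - a))).
  by rewrite !lt_min e10 !subr_gt0 pa aq.
move=> h /andP[h0]; rewrite !le_min => /andP[h1 /andP[h2 h3]].
have := He1 h; rewrite h0 h1 => /(_ isT) Hh.
rewrite -(fineK (rect_fin _ _ _ _ mE)) lee_fin.
apply: le_trans Hh; rewrite -(integral_slice_mass (a - h) (a + h) c d mE).
apply: le_Rintegral_itv; [exact: bdd_meas_slice_mass..|].
move=> x xh; rewrite (@slice_massS E p q (a - h) (a + h))//; lra.
Qed.

Lemma swap_rect E a b c d :
  @swap2 R @^-1` E `&` rect a b c d = @swap2 R @^-1` (E `&` rect c d a b).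
Proof. by apply/seteqP; split => x [Ex /rectP[? ?]]; split => //; apply/rectP. Qed.

(** The reflection [swap2] preserves test fields, divergence and area, so horizontal strips need no
    second construction. *)
Lemma strip_dichotomy_swap E p q c d (e : R) : measurable E -> p < q -> c < d -> 0 < e ->
  (exists phi, [/\ test_field phi, forall z, ~ rect c d p q z -> phi z = 0 &
    (q - p) / 16 - 2 / (d - c) * fine (mu2 (E `&` rect c d p q)) - e <=
      \int[mu2]_(z in E) div phi z]) \/
  exists2 a, p < a < q & forall r : R, 0 < r -> exists2 e0 : R, 0 < e0 &
  forall e, 0 < e <= e0 -> (mu2 (E `&` rect c d (a - e) (a + e)) <= (r * e)%:E)%E.
Proof.
move=> mE pq cd e0; have mE' := measurable_swap2 mE.
have mER a b c' d' : measurable (E `&` rect a b c' d').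
  by apply: measurableI => //; exact: measurable_rect.
have [[phi [tphi phi0 Hphi]]|[a apq Ha]] := strip_dichotomy mE' pq cd e0.
  left; exists (fun x => swap2 (phi (swap2 x))); split.
  - exact (test_field_swap tphi).
  - move=> z nz; have -> : phi (swap2 z) = 0; last by [].
    by apply: phi0 => /rectP[h1 h2]; apply: nz; apply/rectP.
  - move: Hphi; rewrite swap_rect (borel_measure2_swap (mER c d p q)) => /le_trans; apply.
    rewrite -(Rintegral_swap mE (test_field_tame (test_field_swap tphi))).
    have -> : (fun x => div (fun z => swap2 (phi (swap2 z))) (swap2 x)) = div phi.
      by apply/funext => -[x y]; rewrite div_swap.
    exact: lexx.
right; exists a; first exact: apq.
move=> r /Ha[e1 e10 He1]; exists e1; first exact: e10.
move=> h /He1; rewrite swap_rect (borel_measure2_swap (mER c d (a - h) (a + h))); exact.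
Qed.

Lemma rectS (a b c d a' b' c' d' : R) : a' <= a -> b <= b' -> c' <= c -> d <= d' ->
  rect a b c d `<=` rect a' b' c' d'.
Proof.
move=> aa bb cc dd z /rectP[/andP[z1 z2] /andP[z3 z4]]; apply/rectP.
by rewrite (le_trans aa z1) (le_trans z2 bb) (le_trans cc z3) (le_trans z4 dd).
Qed.

Lemma annulus_cover (a b c d e u u' v v' : R) : 0 < e ->
  u <= a - e -> b + e <= u' -> v <= c - e -> d + e <= v' ->
  rect (a - e) (b + e) (c - e) (d + e) `\` rect a b c d `<=`
  rect (a - e) (a + e) v v' `|` rect (b - e) (b + e) v v' `|`
  (rect u u' (c - e) (c + e) `|` rect u u' (d - e) (d + e)).
Proof.
move=> e0 ua bu vc dv z [/rectP[/andP[z1 z2] /andP[z3 z4]] nz].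
have zu : u <= z.1 <= u' by apply/andP; split; lra.
have zv : v <= z.2 <= v' by apply/andP; split; lra.
have [za|za] := ltP z.1 a.
  by left; left; apply/rectP; split => //; apply/andP; split; lra.
have [zb|zb] := ltP b z.1.
  by left; right; apply/rectP; split => //; apply/andP; split; lra.
have [zc|zc] := ltP z.2 c.
  by right; left; apply/rectP; split => //; apply/andP; split; lra.
have [zd|zd] := ltP d z.2.
  by right; right; apply/rectP; split => //; apply/andP; split; lra.
by exfalso; apply: nz; apply/rectP; rewrite za zb zc zd.
Qed.

(** The bookkeeping of constants: a border strip of width l/4 has main term l/64; mass at most
    l^2/512 costs at most l/256, and the smoothing another l/256. *)
Lemma strip_value (l m t : R) : 0 < l -> m <= l ^+ 2 / 512 ->
  l / 64 - 2 / l * m - l / 256 <= t -> l / 128 <= t.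
Proof.
move=> l0 Hm; apply: le_trans.
have : 2 / l * m <= l / 256.
  rewrite -(ler_pM2l l0) mulrA mulrCA mulfV ?gt_eqF// mulr1.
  apply: le_trans (_ : 2 * (l ^+ 2 / 512) <= _); last by rewrite expr2; lra.
  by rewrite ler_pM2l.
move: (2 / l * m) => k; lra.
Qed.

Definition hbare E (c a b : R) := forall r : R, 0 < r -> exists2 e0 : R, 0 < e0 &
  forall e, 0 < e <= e0 -> (mu2 (E `&` rect a b (c - e) (c + e)) <= (r * e)%:E)%E.

Lemma square_strips E u v (l : R) : measurable E -> 0 < l ->
  (mu2 (E `&` rect u (u + l) v (v + l)) <= (l ^+ 2 / 512)%:E)%E ->
  (exists phi, [/\ test_field phi, forall z, ~ rect u (u + l) v (v + l) z -> phi z = 0 &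
    l / 128 <= \int[mu2]_(z in E) div phi z]) \/
  exists a b c d, [/\ u < a < u + l / 4 /\ bare E a v (v + l),
    u + 3 / 4 * l < b < u + l /\ bare E b v (v + l),
    v < c < v + l / 4 /\ hbare E c u (u + l) &
    v + 3 / 4 * l < d < v + l /\ hbare E d u (u + l)].
Proof.
move=> mE l0 Ein.
set Q := rect u (u + l) v (v + l) in Ein *.
pose good phi := [/\ test_field phi, forall z, ~ Q z -> phi z = 0 &
    l / 128 <= \int[mu2]_(z in E) div phi z].
have e0 : 0 < l / 256 by lra.
have finish p q c d phi : rect p q c d `<=` Q -> test_field phi ->
    (forall z, ~ rect p q c d z -> phi z = 0) ->
    l / 64 - 2 / l * fine (mu2 (E `&` rect p q c d)) - l / 256 <=
      \int[mu2]_(z in E) div phi z -> good phi.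
  move=> sub tphi phi0 H; split; first exact: tphi.
    by move=> z nz; apply: phi0 => /sub.
  apply: strip_value l0 _ H; rewrite -lee_fin (fineK (rect_fin _ _ _ _ mE)).
  apply: le_trans Ein; apply: le_measure; rewrite ?inE.
  - by apply: measurableI => //; exact: measurable_rect.
  - by apply: measurableI => //; exact: measurable_rect.
  - exact: setIS.
have simp1 : (u + l / 4 - u) / 16 = l / 64 by field.
have simp2 : (u + l - (u + 3 / 4 * l)) / 16 = l / 64 by field.
have simp3 : (v + l / 4 - v) / 16 = l / 64 by field.
have simp4 : (v + l - (v + 3 / 4 * l)) / 16 = l / 64 by field.
have simp5 (t : R) : t + l - t = l by ring.
have [n1 n2 n3] : [/\ u < u + l / 4, v < v + l & u + 3 / 4 * l < u + l] by split; lra.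
have [n4 n5 n6] : [/\ v < v + l / 4, u < u + l & v + 3 / 4 * l < v + l] by split; lra.
have [s1 s2 s3 s4] : [/\ rect u (u + l / 4) v (v + l) `<=` Q,
   rect (u + 3 / 4 * l) (u + l) v (v + l) `<=` Q,
   rect u (u + l) v (v + l / 4) `<=` Q & rect u (u + l) (v + 3 / 4 * l) (v + l) `<=` Q].
  by split; apply: rectS; lra.
clearbody Q.
have [[phi [tphi phi0]]|[a a1 Ha]] := strip_dichotomy mE n1 n2 e0.
  by rewrite simp1 simp5 => H; left; exists phi; exact: finish s1 tphi phi0 H.
have [[phi [tphi phi0]]|[b b1 Hb]] := strip_dichotomy mE n3 n2 e0.
  by rewrite simp2 simp5 => H; left; exists phi; exact: finish s2 tphi phi0 H.
have [[phi [tphi phi0]]|[c c1 Hc]] := strip_dichotomy_swap mE n4 n5 e0.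
  by rewrite simp3 simp5 => H; left; exists phi; exact: finish s3 tphi phi0 H.
have [[phi [tphi phi0]]|[d d1 Hd]] := strip_dichotomy_swap mE n6 n5 e0.
  by rewrite simp4 simp5 => H; left; exists phi; exact: finish s4 tphi phi0 H.
right; exists a, b, c, d.
exact (And4 (conj a1 Ha) (conj b1 Hb) (conj c1 Hc) (conj d1 Hd)).
Qed.

(** A bare line controls all small widths, not just a sequence of them, so four lines admit a common
    e. The frame lies in four thin strips, each with mass at most (r/4) e. *)
Lemma bare_annulus E a b c d u u' v v' : measurable E -> u < a -> b < u' -> v < c -> d < v' ->
  bare E a v v' -> bare E b v v' -> hbare E c u u' -> hbare E d u u' ->
  forall r : R, 0 < r -> exists e : R, 0 < e <= 1 /\
    fine (mu2 (E `&` (rect (a - e) (b + e) (c - e) (d + e) `\` rect a b c d))) <= r * e.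
Proof.
move=> mE ua bu vc dv Ha Hb Hc Hd r r0.
have r4 : 0 < r / 4 by lra.
have [ea ea0 Hea] := Ha _ r4; have [eb eb0 Heb] := Hb _ r4.
have [ec ec0 Hec] := Hc _ r4; have [ed ed0 Hed] := Hd _ r4.
have [e [e_0 [h1 h2 h3 h4] [h5 h6 h7 h8 h9]]] : exists e : R, [/\ 0 < e,
    [/\ e <= ea, e <= eb, e <= ec & e <= ed] &
    [/\ e <= 1, u <= a - e, b + e <= u', v <= c - e & d + e <= v']].
  exists (Num.min (Num.min (Num.min ea eb) (Num.min ec ed))
    (Num.min 1 (Num.min (Num.min (a - u) (u' - b)) (Num.min (c - v) (v' - d))))).
  set e := Num.min _ _.
  have : e <= e by [].
  rewrite {2}/e !le_min => /andP[/andP[/andP[h1 h2] /andP[h3 h4]]].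
  move=> /andP[h5 /andP[/andP[h6 h7] /andP[h8 h9]]].
  split; last by split => //; lra.
    rewrite !lt_min; apply/andP; split; first by rewrite ea0 eb0 ec0 ed0.
    by rewrite ltr01 !subr_gt0 ua bu vc dv.
  by [].
exists e; split; first by rewrite e_0.
have := annulus_cover e_0 h6 h7 h8 h9.
have mr p q s t : measurable (E `&` rect p q s t).
  by apply: measurableI => //; exact: measurable_rect.
have mA : measurable (E `&` (rect (a - e) (b + e) (c - e) (d + e) `\` rect a b c d)).
  by apply: measurableI => //; apply: measurableD; exact: measurable_rect.
move: mA; set A := E `&` _ => mA cov.
pose Sa := E `&` rect (a - e) (a + e) v v'.
pose Sb := E `&` rect (b - e) (b + e) v v'.
pose Sc := E `&` rect u u' (c - e) (c + e).
pose Sd := E `&` rect u u' (d - e) (d + e).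
have sub : A `<=` Sa `|` Sb `|` (Sc `|` Sd).
  by move=> z [Ez /cov[[?|?]|[?|?]]]; [left; left|left; right|right; left|right; right]; split.
have mScd : measurable (Sc `|` Sd) by apply: measurableU; exact: mr.
have ba : (mu2 Sa <= (r / 4 * e)%:E)%E by apply: Hea; rewrite e_0 h1.
have bb : (mu2 Sb <= (r / 4 * e)%:E)%E by apply: Heb; rewrite e_0 h2.
have bc : (mu2 Sc <= (r / 4 * e)%:E)%E by apply: Hec; rewrite e_0 h3.
have bd : (mu2 Sd <= (r / 4 * e)%:E)%E by apply: Hed; rewrite e_0 h4.
have bcd : (mu2 (Sc `|` Sd) <= (r / 4 * e)%:E + (r / 4 * e)%:E)%E.
  exact: le_trans (measureU2 mu2 (mr _ _ _ _) (mr _ _ _ _)) (leeD bc bd).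
have bnd := le_trans
  (@le_measureU3 _ _ _ mu2 A Sa Sb (Sc `|` Sd) mA (mr _ _ _ _) (mr _ _ _ _) mScd sub)
  (leeD (leeD ba bb) bcd).
have fA : mu2 A \is a fin_num.
  rewrite ge0_fin_numE; last exact: measure_ge0.
  apply: le_lt_trans bnd _; rewrite -!EFinD; exact: ltry.
move: bnd; rewrite -(fineK fA) -!EFinD lee_fin => /le_trans; apply.
by rewrite -!mulrDl ler_wpM2r ?(ltW e_0)//; lra.
Qed.

(* If all four border strips contained a bare line, cutting along these lines would
   split F; hence in one of the strips almost every slice of E is nontrivial, while
   E has small density there. *)
Lemma square_field F E u v (l : R) (x : R * R) : indecomposable F -> borel_hull F E ->
  0 < l -> u + l / 4 < x.1 < u + 3 / 4 * l -> v + l / 4 < x.2 < v + 3 / 4 * l ->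
  (forall r : R, 0 < r -> mu2 (E `&` rect (x.1 - r) (x.1 + r) (x.2 - r) (x.2 + r)) != 0%E) ->
  mu2 (E `\` rect u (u + l) v (v + l)) != 0%E ->
  (mu2 (E `&` rect u (u + l) v (v + l)) <= (l ^+ 2 / 512)%:E)%E ->
  exists phi, [/\ test_field phi, forall z, ~ rect u (u + l) v (v + l) z -> phi z = 0 &
    l / 128 <= \int[mu2]_(z in E) div phi z].
Proof.
move=> indF hF l0 /andP[x1 x1'] /andP[x2 x2'] xE Eout Ein.
have [_ mE _ _] := hF.
have [//|[a [b [c [d [[/andP[a1 a2] Ha] [/andP[b1 b2] Hb] [/andP[c1 c2] Hc] [/andP[d1 d2] Hd]]]]]]]
  := square_strips mE l0 Ein.
have ann := bare_annulus mE a1 b2 c1 d2 Ha Hb Hc Hd.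
have mER p q s t : measurable (E `&` rect p q s t).
  by apply: measurableI => //; exact: measurable_rect.
have mED p q s t : measurable (E `\` rect p q s t).
  by apply: measurableD => //; exact: measurable_rect.
have [r [r0 Hr]] : exists r : R, 0 < r /\
    rect (x.1 - r) (x.1 + r) (x.2 - r) (x.2 + r) `<=` rect a b c d.
  have [k1 k2 k3 k4] : [/\ a < x.1, x.1 < b, c < x.2 & x.2 < d].
    clear -x1 x1' x2 x2' a2 b1 c2 d1; split; lra.
  exists (Num.min (Num.min (x.1 - a) (b - x.1)) (Num.min (x.2 - c) (d - x.2))).
  set r := Num.min _ _; have : r <= r by [].
  rewrite {2}/r !le_min => /andP[/andP[h1 h2] /andP[h3 h4]]; split.
    by rewrite !lt_min !subr_gt0 k1 k2 k3 k4.
  by clear -h1 h2 h3 h4; apply: rectS; lra.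
have Q : rect a b c d `<=` rect u (u + l) v (v + l) by apply: rectS; exact: ltW.
(* Both pieces are charged: the inner one because its interior contains the support point x, which
   lies in the central part of the square between the four lines; the outer one because E charges
   the complement of the whole square. *)
exfalso; have [K0|K0] := indecomposable_cut indF hF ann.
- have := xE r r0; rewrite -measure_le0 -K0 => /negP; apply; apply: le_measure; rewrite ?inE.
  + exact: mER.
  + exact: mER.
  + exact: setIS.
- move: Eout; rewrite -measure_le0 -K0 => /negP; apply; apply: le_measure; rewrite ?inE.
  + exact: mED.
  + exact: mED.
  + exact: setDS.
Qed.

End square.

(** * Approximation by grid cells *)

Section partition.

Lemma measure_bigsetU_seq d (T : measurableType d) (R : realType)
    (mu : {measure set T -> \bar R}) (I : choiceType) (s : seq I) (F : I -> set T) (X : set T) :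
  measurable X -> (forall i, measurable (F i)) ->
  (forall i j x, F i x -> F j x -> i = j) -> uniq s ->
  mu (X `&` \big[setU/set0]_(i <- s) F i) = (\sum_(i <- s) mu (X `&` F i))%E.
Proof.
move=> mX mF dF; elim: s => [|i s IH] /=; first by rewrite !big_nil setI0 measure0.
move=> /andP[ins us]; rewrite !big_cons setIUr measureU.
- by congr (_ + _)%E; exact: IH.
- exact: measurableI.
- by apply: measurableI => //; exact: bigsetU_measurable.
- apply/seteqP; split => // x [[_ Fix] [_]]; rewrite -bigcup_seq => -[j /= js Fjx].
  by move: ins; rewrite (dF _ _ _ Fix Fjx) js.
Qed.

Lemma partition_measure d (T : measurableType d) (R : realType)
    (mu : {measure set T -> \bar R}) (I : finType) (F : I -> set T) (X : set T) :
  measurable X -> (forall i, measurable (F i)) ->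
  (forall i j x, F i x -> F j x -> i = j) -> (forall x, X x -> exists i, F i x) ->
  (mu X < +oo)%E -> fine (mu X) = \sum_i fine (mu (X `&` F i)).
Proof.
move=> mX mF dF cF Xfin.
have := @measure_bigsetU_seq _ _ _ mu _ (enum I) F X mX mF dF (enum_uniq _).
rewrite (_ : X `&` _ = X); last first.
  apply/seteqP; split => x; first by case.
  move=> Xx; split => //; have [i Fi] := cF x Xx.
  by rewrite -bigcup_seq; exists i => //=; rewrite mem_enum.
move=> ->; rewrite big_enum/= -sum_fine// => i _.
rewrite ge0_fin_numE//; apply: le_lt_trans Xfin; apply: le_measure; rewrite ?inE//.
exact: measurableI.
Qed.

End partition.

Section grid.
Variables (R : realType) (M : R).
Hypothesis (M0 : 0 < M).
Notation mu2 := (borel_measure2 R).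
Implicit Types (S : set (R * R)).

(** Half-open boxes and cells form an exact partition, so masses add up without boundary terms. *)
Definition grid_box : set (R * R) := `[- M, M[ `*` `[- M, M[.
Definition step (n : nat) : R := 2 * M / n.+1%:R.
Definition node (n i : nat) : R := - M + i%:R * step n.
Definition cell (n : nat) (ij : 'I_n.+1 * 'I_n.+1) : set (R * R) :=
  `[node n ij.1, node n ij.1 + step n[ `*` `[node n ij.2, node n ij.2 + step n[.

Lemma step_gt0 n : 0 < step n.
Proof. by rewrite divr_gt0// mulr_gt0. Qed.

Lemma step_total n : n.+1%:R * step n = 2 * M.
Proof. by rewrite mulrC divfK. Qed.

Lemma node_next n i : node n i + step n = node n i.+1.
Proof. by rewrite /node -natr1 mulrDl mul1r addrA. Qed.

Lemma measurable_cell n ij : measurable (@cell n ij).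
Proof. by apply: measurableX; exact: measurable_itv. Qed.

Lemma measurable_grid_box : measurable grid_box.
Proof. by apply: measurableX; exact: measurable_itv. Qed.

Lemma cell_measure n ij : mu2 (@cell n ij) = (step n ^+ 2)%:E.
Proof.
rewrite [LHS]product_measure1E//= !lebesgue_measure_itv/= !lte_fin !ltrDl step_gt0.
by rewrite -!EFinB -EFinM; congr EFin; ring.
Qed.

Lemma grid_box_fin : (mu2 grid_box < +oo)%E.
Proof.
rewrite [ltLHS]product_measure1E//= !lebesgue_measure_itv/=.
by case: ifP => _; rewrite -?EFinB -?EFinM ?mule0 ?ltry.
Qed.

Let node_trunc n i (t : R) : node n i <= t < node n i + step n ->
  Num.trunc ((t + M) / step n) = i.
Proof.
rewrite node_next /node => /andP[h1 h2]; apply: truncn_def.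
have s0 := step_gt0 n.
rewrite ler_pdivlMr// ltr_pdivrMr//; apply/andP; split; lra.
Qed.

Lemma cell_disjoint n ij ij' x : @cell n ij x -> @cell n ij' x -> ij = ij'.
Proof.
rewrite /cell/= !in_itv/= => -[/node_trunc a1 /node_trunc a2] [/node_trunc b1 /node_trunc b2].
case: ij ij' a1 a2 b1 b2 => [i j] [i' j'] /= a1 a2 b1 b2.
by congr pair; apply: val_inj; [rewrite /= -a1 b1|rewrite /= -a2 b2].
Qed.

Lemma cell_cover n x : grid_box x -> exists ij, @cell n ij x.
Proof.
have s0 := step_gt0 n.
have H (t : R) : - M <= t < M -> exists i : 'I_n.+1, node n i <= t < node n i + step n.
  move=> /andP[t1 t2].
  have t0 : 0 <= (t + M) / step n by rewrite divr_ge0 ?(ltW s0)//; lra.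
  have := truncn_itv t0; set k := Num.trunc _ => /andP[k1 k2].
  have kn : (k < n.+1)%N.
    rewrite -(ltr_nat R); apply: le_lt_trans k1 _.
    rewrite ltr_pdivrMr// /step mulrC mulfVK ?gt_eqF//; lra.
  exists (Ordinal kn); rewrite node_next /node /=.
  by move: k1 k2; rewrite ler_pdivlMr// ltr_pdivrMr// => k1 k2; apply/andP; split; lra.
rewrite /grid_box/= !in_itv/= => -[/H[i Hi] /H[j Hj]]; exists (i, j).
by rewrite /cell/= !in_itv.
Qed.

Lemma cell_box n ij : @cell n ij `<=` grid_box.
Proof.
have s0 := step_gt0 n.
have H (i : 'I_n.+1) (t : R) : node n i <= t < node n i + step n -> - M <= t < M.
  rewrite node_next /node => /andP[h1 h2].
  have : 0 <= i%:R * step n by rewrite mulr_ge0// ltW.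
  have : i.+1%:R * step n <= n.+1%:R * step n by rewrite ler_pM2r// ler_nat ltn_ord.
  rewrite step_total.
  by move=> *; apply/andP; split; lra.
by move=> x; rewrite /cell /grid_box/= !in_itv/= => -[/H ? /H ?].
Qed.

Definition mass S (Q : set (R * R)) : R := fine (mu2 (S `&` Q)).

Lemma mass_fin S (Q : set (R * R)) : measurable S -> measurable Q -> Q `<=` grid_box ->
  mu2 (S `&` Q) \is a fin_num.
Proof.
move=> mS mQ QB; rewrite ge0_fin_numE//; apply: le_lt_trans grid_box_fin.
apply: le_measure; rewrite ?inE.
- exact: measurableI.
- exact: measurable_grid_box.
- by move=> x [_ /QB].
Qed.

Lemma mass_sum n S : measurable S -> mass S grid_box = \sum_ij mass S (@cell n ij).
Proof.
move=> mS; have mB := measurable_grid_box.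
have mSB : measurable (S `&` grid_box) by exact: measurableI.
rewrite {1}/mass (@partition_measure _ _ _ mu2 _ (@cell n) _ mSB).
- apply: eq_bigr => ij _; rewrite /mass; congr (fine (mu2 _)).
  by rewrite -setIA (setIidr (@cell_box n ij)).
- exact: measurable_cell.
- exact: cell_disjoint.
- by move=> x [_ Bx]; exact: cell_cover.
- by apply: le_lt_trans grid_box_fin; apply: le_measure; rewrite ?inE//; exact: subIsetr.
Qed.

Lemma mass_ge0 S Q : 0 <= mass S Q.
Proof. exact: fine_ge0. Qed.

Lemma mass_le S S' Q : measurable S -> measurable S' -> measurable Q -> Q `<=` grid_box ->
  S `<=` S' -> mass S Q <= mass S' Q.
Proof.
move=> mS mS' mQ QB SS; rewrite fine_le ?mass_fin//; apply: le_measure; rewrite ?inE.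
- exact: measurableI.
- exact: measurableI.
- exact: setSI.
Qed.

Lemma massD S S' Q : measurable S -> measurable S' -> measurable Q -> Q `<=` grid_box ->
  S' `<=` S -> mass (S `\` S') Q = mass S Q - mass S' Q.
Proof.
move=> mS mS' mQ QB SS.
have mSQ : measurable (S `&` Q) by exact: measurableI.
have mSQ' : measurable (S' `&` Q) by exact: measurableI.
have f1 := mass_fin mS mQ QB; have f2 := mass_fin mS' mQ QB.
rewrite /mass -fineB//; congr fine.
rewrite (_ : (S `\` S') `&` Q = (S `&` Q) `\` (S' `&` Q)); last first.
  apply/seteqP; split => [x [[Sx nS'] Qx]|x [[Sx Qx] nS']]; split => //; first by move=> [].
  by split => // S'x; apply: nS'.
have lt1 : (mu2 (S `&` Q) < +oo)%E by rewrite -ge0_fin_numE.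
have -> : mu2 ((S `&` Q) `\` (S' `&` Q)) =
    (mu2 (S `&` Q) - mu2 ((S `&` Q) `&` (S' `&` Q)))%E by exact: measureD.
by congr (_ - mu2 _)%E; apply: setIidr; exact: setSI.
Qed.

Lemma mass_cellT n ij : mass setT (@cell n ij) = step n ^+ 2.
Proof. by rewrite /mass setTI cell_measure. Qed.

(* The L^1 distance from S to the nearest union of cells. *)
Definition defect n S : R :=
  \sum_(ij : 'I_n.+1 * 'I_n.+1) Num.min (mass S (cell ij)) (step n ^+ 2 - mass S (cell ij)).

Definition grid_approx S := forall e : R, 0 < e -> exists N, forall n, (N <= n)%N ->
  defect n S <= e.

Lemma step_small (e : R) : 0 < e -> exists N, forall n, (N <= n)%N -> step n < e.
Proof.
move=> e0; exists (Num.trunc (2 * M / e)) => n Nn.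
rewrite /step ltr_pdivrMr// -ltr_pdivrMl// mulrC.
apply: lt_le_trans (truncnS_gt _) _; by rewrite ler_nat ltnS.
Qed.

(** The function a -> min(a, q - a) is 1-Lipschitz, so the change in each cell is at most the mass
    lost there. *)
Lemma defect_le n S S' : measurable S -> measurable S' -> S' `<=` S ->
  defect n S <= defect n S' + mass (S `\` S') grid_box.
Proof.
move=> mS mS' SS; rewrite (mass_sum n (measurableD mS mS')) -big_split/=.
apply: ler_sum => ij _.
have mC := measurable_cell ij; have CB := @cell_box n ij.
rewrite massD//; have := mass_le mS' mS mC CB SS.
move: (mass S _) (mass S' _) => a b ab.
rewrite ge_min; apply/orP; have [h|h] := leP b (step n ^+ 2 - b); [left|right]; lra.
Qed.

(** V k collects the points at sup-distance at least 1/(k+1) from the complement of S. Once the mesh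
    is below this distance, a cell either lies in S and has no defect, or misses V k and has defect
    at most its mass of S \ V k, which is small in total. *)
Lemma open_grid_approx S : open S -> grid_approx S.
Proof.
move=> oS e e0; have mS := open_measurable2 oS.
pose V (k : nat) : set (R * R) := ~` \bigcup_(y in ~` S) ball y (k.+1%:R^-1).
have mV k : measurable (V k).
  apply: measurableC; apply: open_measurable2; apply: bigcup_open => y _.
  exact: ball_open.
have ndV : nondecreasing_seq V.
  move=> k l kl; apply/subsetPset; apply: subsetC => x [y Sy yx]; exists y => //.
  by apply: le_ball yx; rewrite lef_pV2 ?posrE// ler_nat.
have UV : \bigcup_k V k = S.
  apply/seteqP; split => x.
    move=> [k _ Vx]; apply: contrapT => nSx; apply: Vx; exists x => //.
    exact: ballxx.
  move=> Sx; have [r /= r0 rS] : nbhs_ball x S by rewrite nbhs_ballE; exact: open_nbhs_nbhs.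
  exists (Num.trunc r^-1) => // -[y nSy /ball_sym yx]; apply: nSy; apply: rS.
  apply: le_ball yx; rewrite -[leRHS]invrK lef_pV2 ?posrE// ?invr_gt0//.
  exact/ltW/truncnS_gt.
have [k /(_ k (leqnn k)) Hk] := @measure_ndseq_remainder _ _ _ mu2 grid_box V e
  measurable_grid_box grid_box_fin mV ndV e0.
have k0 : 0 < k.+1%:R^-1 :> R by rewrite invr_gt0.
have [N HN] := step_small k0.
exists N => n /HN sn.
have mD : measurable (S `\` V k) by exact: measurableD.
have VS : V k `<=` S by rewrite -UV; exact: bigcup_sup.
apply: (@le_trans _ _ (mass (S `\` V k) grid_box)); last first.
  rewrite -lee_fin (fineK (mass_fin mD measurable_grid_box (@subset_refl _ _))).
  by rewrite setIC -UV.
rewrite (mass_sum n mD); apply: ler_sum => ij _.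
have mC := measurable_cell ij; have CB := @cell_box n ij.
rewrite ge_min; have [CS|nCS] := pselect (cell ij `<=` S).
  apply/orP; right; rewrite (_ : mass S (cell ij) = step n ^+ 2) ?subrr ?mass_ge0//.
  by rewrite -(mass_cellT ij) /mass setTI (setIidr CS).
apply/orP; left; rewrite le_eqVlt; apply/orP; left; apply/eqP; rewrite /mass.
congr (fine (mu2 _)); apply/seteqP; split => x [Sx Cx]; split => //; last by case: Sx.
split => // Vx; apply: nCS => y Cy; apply: contrapT => nSy; apply: Vx.
exists y => //; move: Cx Cy; rewrite /cell/= !in_itv/=.
move=> -[/andP[? ?] /andP[? ?]] [/andP[? ?] /andP[? ?]].
by split; rewrite /ball/= ltr_distlC; move: sn; move: (_^-1) => r sn; apply/andP; split; lra.
Qed.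

Lemma measurable2_open_gen : @measurable _ (R * R)%type `<=` <<s @open (R * R)%type >>.
Proof.
pose T := g_sigma_algebraType (@open (R * R)%type).
have mfst : measurable_fun setT (fst : T -> R).
  move=> mT; apply: (measurability _ (RGenOpens.measurableE R)) => //.
  move=> _ [_ [a [b ->] <-]]; rewrite setTI; apply: sub_sigma_algebra.
  by apply: open_comp; [move=> x _; exact: continuous_fst|exact: interval_open].
have msnd : measurable_fun setT (snd : T -> R).
  move=> mT; apply: (measurability _ (RGenOpens.measurableE R)) => //.
  move=> _ [_ [a [b ->] <-]]; rewrite setTI; apply: sub_sigma_algebra.
  by apply: open_comp; [move=> x _; exact: continuous_snd|exact: interval_open].
rewrite measurable_prod_measurableType; apply: smallest_sub; first exact: smallest_sigma_algebra.
move=> _ [A mA [B mB <-]].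
have := measurableI _ _ (mfst measurableT A mA) (msnd measurableT B mB).
by rewrite !setTI.
Qed.

(** A pi-lambda argument from open sets takes the place of a covering theorem. For proper
    differences it rests on min(a - b, q - a + b) <= min(a, q - a) + min(b, q - b), valid for 0 <= b
    <= a <= q. *)
Lemma borel_grid_approx S : measurable S -> grid_approx S.
Proof.
suff key : <<s setT, @open (R * R)%type >> `<=`
    [set S : set (R * R) | (measurable S /\ grid_approx S)].
  by move=> mS; apply: (key S _).2; exact: measurable2_open_gen.
apply: lambda_system_subset => //.
- by move=> A B oA oB; exact: openI.
- split; first by move=> A _; exact: subsetT.
  + split; first exact: measurableT.
    exact/open_grid_approx/openT.
  + move=> A B BA [mA aA] [mB aB]; split; first exact: measurableD.
    move=> e e0; have e2 : 0 < e / 2 by lra.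
    have [N1 H1] := aA _ e2; have [N2 H2] := aB _ e2.
    exists (maxn N1 N2) => n; rewrite geq_max => /andP[/H1 h1 /H2 h2].
    apply: (@le_trans _ _ (defect n A + defect n B)); last lra.
    rewrite -big_split/=; apply: ler_sum => ij _.
    have mC := measurable_cell ij; have CB := @cell_box n ij.
    have := mass_le mB mA mC CB BA; have := mass_ge0 B (cell ij).
    have := mass_le mA measurableT mC CB (@subsetT _ A); rewrite mass_cellT.
    rewrite massD//; move: (mass A _) (mass B _) (step n ^+ 2) => a b q.
    move=> aq b0 ba; rewrite ge_min.
    have [h|h] := leP a (q - a); have [h'|h'] := leP b (q - b); apply/orP.
    * by left; lra.
    * by left; lra.
    * by right; lra.
    * by left; lra.
  + move=> F ndF HF.
    have mF n : measurable (F n) by have [] := HF n.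
    have mU : measurable (\bigcup_i F i) by exact: bigcupT_measurable.
    split => // e e0; have e2 : 0 < e / 2 by lra.
    have [k /(_ k (leqnn k)) Hk] := @measure_ndseq_remainder _ _ _ mu2 grid_box F _
      measurable_grid_box grid_box_fin mF ndF e2.
    have [_ /(_ _ e2)[N HN]] := HF k; exists N => n /HN h.
    have FU : F k `<=` \bigcup_i F i by exact: bigcup_sup.
    apply: le_trans (defect_le n mU (mF k) FU) _.
    have mD : measurable (\bigcup_i F i `\` F k) by exact: measurableD.
    have : mass (\bigcup_i F i `\` F k) grid_box <= e / 2.
      rewrite -lee_fin (fineK (mass_fin mD measurable_grid_box (@subset_refl _ _))).
      by rewrite setIC.
    lra.
- by move=> A oA; split; [exact: open_measurable2|exact: open_grid_approx].
Qed.

(** A Markov inequality: in a bad cell the defect is at least k times the mass of S, as k <= 1. A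
    total defect below k/2 times the mass thus leaves at least half of the mass in good cells, each
    of area [step n ^+ 2]. *)
Lemma good_cells S (k : R) : measurable S -> 0 < mass S grid_box -> 0 < k <= 1 ->
  exists N, forall n, (N <= n)%N -> exists A : {set 'I_n.+1 * 'I_n.+1},
    (forall ij, ij \in A -> step n ^+ 2 - mass S (cell ij) <= k * step n ^+ 2) /\
    mass S grid_box / 2 <= #|A|%:R * step n ^+ 2.
Proof.
move=> mS S0 /andP[k0 k1].
have e0 : 0 < k * (mass S grid_box / 2) by rewrite mulr_gt0// divr_gt0.
have [N HN] := borel_grid_approx mS e0.
exists N => n /HN Hn.
pose A : {set 'I_n.+1 * 'I_n.+1} :=
  finset (fun ij => step n ^+ 2 - mass S (cell ij) <= k * step n ^+ 2).
exists A; split; first by move=> ij; rewrite inE.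
have bnd (ij : 'I_n.+1 * 'I_n.+1) : 0 <= mass S (cell ij) <= step n ^+ 2.
  by rewrite mass_ge0/= -(mass_cellT ij) mass_le//; [exact: measurable_cell|exact: cell_box].
have bad : \sum_(ij | ij \notin A) mass S (cell ij) <= mass S grid_box / 2.
  rewrite -(ler_pM2l k0); apply: le_trans Hn; rewrite mulr_sumr.
  apply: (@le_trans _ _ (\sum_(ij | ij \notin A)
     Num.min (mass S (cell ij)) (step n ^+ 2 - mass S (cell ij)))).
    apply: ler_sum => ij; rewrite inE -ltNge => h.
    have /andP[a0 aq] := bnd ij.
    rewrite le_min; apply/andP; split; first by rewrite ler_piMl.
    by apply: le_trans (ltW h); rewrite ler_pM2l.
  rewrite /defect [leRHS](bigID (fun ij => ij \notin A))/= lerDl.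
  by apply: sumr_ge0 => ij _; have /andP[a0 aq] := bnd ij; rewrite le_min a0 subr_ge0.
have good : \sum_(ij in A) mass S (cell ij) <= #|A|%:R * step n ^+ 2.
  rewrite mulr_natl -sumr_const; apply: ler_sum => ij _.
  by have /andP[] := bnd ij.
have : mass S grid_box = \sum_(ij in A) mass S (cell ij) + \sum_(ij | ij \notin A) mass S (cell ij).
  by rewrite (mass_sum n mS) (bigID (fun ij => ij \in A)).
move: good bad; move: (\sum_(ij in A) _) (\sum_(ij | ij \notin A) _) (mass S grid_box).
by move: (#|A|%:R * _) => *; lra.
Qed.

End grid.

(** * The essential support *)

Section assembly.
Variable R : realType.
Notation mu1 := (@lebesgue_measure R).
Notation mu2 := (borel_measure2 R).
Notation mub := (@lebesgue_measure2 R).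
Implicit Types (A E F G S : set (R * R)) (phi psi : R * R -> R * R).

Lemma test_field_continuous phi : test_field phi -> continuous phi.
Proof. by move=> [phi1 _ _]; exact: C1_continuous phi1. Qed.

(** Fields are supported in closed squares, whereas cells are half-open. Continuity removes the
    right and upper edges, where neighbouring supports would meet. *)
Lemma field_zero_boundary phi u u' v v' z : continuous phi ->
  (forall z, ~ rect u u' v v' z -> phi z = 0) ->
  u' <= z.1 \/ v' <= z.2 -> phi z = 0.
Proof.
move=> cphi phi0 zb; apply: contrapT => /eqP phiz.
have nz : nbhs (phi z) [set y : R * R | y != 0].
  apply: open_nbhs_nbhs; split; last exact: phiz.
  rewrite (_ : [set y : R * R | y != 0] = ~` [set 0]).
    apply: closed_openC; apply: accessible_closed_set1; apply: hausdorff_accessible.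
    exact: norm_hausdorff.
  by apply/seteqP; split => y /= /eqP.
have [r /= r0 Hr] : nbhs_ball z [set y | phi y != 0].
  by rewrite nbhs_ballE; exact: (cphi z _ nz).
have r2 : 0 < r / 2 by rewrite divr_gt0.
case: zb => zb.
- have := Hr (z.1 + r / 2, z.2).
  rewrite /= phi0 ?eqxx; last by move=> /rectP[/= /andP[_ ?] _]; lra.
  apply/not_implyP; split; last by [].
  split; rewrite /ball/=; last by rewrite subrr normr0.
  by rewrite opprD addNKr normrN gtr0_norm//; lra.
- have := Hr (z.1, z.2 + r / 2).
  rewrite /= phi0 ?eqxx; last by move=> /rectP[/= _ /andP[_ ?]]; lra.
  apply/not_implyP; split; last by [].
  split; rewrite /ball/=; first by rewrite subrr normr0.
  by rewrite opprD addNKr normrN gtr0_norm//; lra.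
Qed.

Definition add_field phi psi (z : R * R) : R * R :=
  ((phi z).1 + (psi z).1, (phi z).2 + (psi z).2).

Lemma test_field_add phi psi : test_field phi -> test_field psi ->
  (forall z, phi z = 0 \/ psi z = 0) -> test_field (add_field phi psi).
Proof.
move=> tphi tpsi dis.
have [M [_ phi0]] := test_field_support tphi.
have [N [_ psi0]] := test_field_support tpsi.
case: tphi => phi1 _ phin; case: tpsi => psi1 _ psin.
apply: (@test_field_pair _ _ _ (Num.max M N)).
- exact (C1D (C1_comp_fst phi1) (C1_comp_fst psi1)).
- exact (C1D (C1_comp_snd phi1) (C1_comp_snd psi1)).
- move=> x nx; rewrite phi0; last first.
    by move=> k; apply: nx; apply: sqr_boxS k; rewrite le_max lexx.
  rewrite psi0; last first.
    by move=> k; apply: nx; apply: sqr_boxS k; rewrite le_max lexx orbT.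
  by rewrite /= !addr0.
- move=> x; have [->|->] := dis x; rewrite /= ?add0r ?addr0 -enorm_le1.
    exact: psin.
  exact: phin.
Qed.

Lemma div_add phi psi z : test_field phi -> test_field psi ->
  div (add_field phi psi) z = div phi z + div psi z.
Proof.
move=> [phi1 _ _] [psi1 _ _].
have D (f : R * R -> R) v x : C1 f -> derivable f x v by move=> [df _]; exact: diff_derivable.
rewrite /div /add_field /=.
rewrite (@deriveD _ _ _ (fun z => (phi z).1) (fun z => (psi z).1) z (1, 0)
  (D _ _ _ (C1_comp_fst phi1)) (D _ _ _ (C1_comp_fst psi1))).
rewrite (@deriveD _ _ _ (fun z => (phi z).2) (fun z => (psi z).2) z (0, 1)
  (D _ _ _ (C1_comp_snd phi1)) (D _ _ _ (C1_comp_snd psi1))).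
by rewrite addrACA.
Qed.

(** At each point at most one of the fields is nonzero, so the sum keeps the bound 1 on the norm
    while the integrals add up. *)
Lemma sum_fields E (I : eqType) (C : I -> set (R * R)) (s : seq I) (t : R) :
  measurable E -> (forall i j z, C i z -> C j z -> i = j) -> uniq s ->
  (forall i, i \in s -> exists phi, [/\ test_field phi, forall z, ~ C i z -> phi z = 0 &
    t <= \int[mu2]_(z in E) div phi z]) ->
  exists phi, [/\ test_field phi,
    forall z, (forall i, i \in s -> ~ C i z) -> phi z = 0 &
    (size s)%:R * t <= \int[mu2]_(z in E) div phi z].
Proof.
move=> mE dC; elim: s => [_ _|i s IH /= /andP[ins us] H].
  exists (fun=> (0, 0)); split => //; first exact: test_field0.
  under eq_Rintegral do rewrite div0.
  by rewrite Rintegral_cst// !mul0r.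
have [psi [tpsi psi0 Hpsi]] := IH us (fun j js => H j ltac:(by rewrite inE js orbT)).
have [phi [tphi phi0 Hphi]] := H i (mem_head _ _).
exists (add_field phi psi); split.
- apply: test_field_add => // z; have [Ci|nCi] := pselect (C i z); last by left; exact: phi0.
  by right; apply: psi0 => j js Cj; move: ins; rewrite (dC _ _ _ Ci Cj) js.
- move=> z nz; rewrite /add_field phi0; last by apply: nz; exact: mem_head.
  by rewrite psi0 ?addr0// => j js; apply: nz; rewrite inE js orbT.
- have -> : \int[mu2]_(z in E) div (add_field phi psi) z =
      \int[mu2]_(z in E) (div phi z + div psi z).
    by apply: eq_Rintegral => z _; rewrite div_add.
  rewrite RintegralD//; [|by apply: tame_integrable => //; exact: test_field_tame..].
  by rewrite -natr1 mulrDl mul1r addrC; exact (lerD Hphi Hpsi).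
Qed.

(** The support of the restriction of [mu2] to E. Squares define the same set as Euclidean balls and
    match the rectangles used for cutting. *)
Definition ess_support E : set (R * R) := [set x | forall r : R, 0 < r ->
  mu2 (E `&` rect (x.1 - r) (x.1 + r) (x.2 - r) (x.2 + r)) != 0%E].

Let null_sub E A B : measurable E -> measurable A -> measurable B -> A `<=` B ->
  mu2 (E `&` B) = 0%E -> mu2 (E `&` A) = 0%E.
Proof.
move=> mE mA mB AB B0; apply/eqP; rewrite -measure_le0 -B0; apply: le_measure; rewrite ?inE.
- exact: measurableI.
- exact: measurableI.
- exact: setIS.
Qed.

Lemma closed_ess_support E : measurable E -> closed (ess_support E).
Proof.
move=> mE; rewrite -(setCK (ess_support E)); apply: open_closedC.
rewrite openE => x /= /existsNP[r /not_implyP[r0 /negP/negPn/eqP rx]].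
rewrite /interior -nbhs_ballE; exists (r / 2); first by rewrite /= divr_gt0.
move=> y [/= ]; rewrite /ball/= !ltr_distlC => /andP[y1 y2] /andP[y3 y4] /(_ (r / 2)).
rewrite divr_gt0// => /(_ isT)/negP; apply; apply/eqP.
apply: null_sub rx => //; try exact: measurable_rect.
by apply: rectS; lra.
Qed.

Lemma null_off_ess_support E : measurable E -> mu2 (E `\` ess_support E) = 0%E.
Proof.
move=> mE.
pose q (x : rat) : R := ratr x.
pose box (i : rat * rat * rat * rat) := rect (q i.1.1.1) (q i.1.1.2) (q i.1.2) (q i.2).
pose B (n : nat) : set (R * R) := if unpickle n is Some i then
  (if mu2 (E `&` box i) == 0%E then E `&` box i else set0) else set0.
have mbox i : measurable (box i) by exact: measurable_rect.
have mB n : measurable (B n).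
  rewrite /B; case: unpickle => // i; case: ifP => // _; exact: measurableI.
have B0 n : mu2 (B n) = 0%E.
  rewrite /B; case: unpickle => [i|]; last exact: measure0.
  by case: eqP => // _; exact: measure0.
have mG : measurable (E `\` ess_support E).
  by apply: measurableD => //; apply: closed_measurable2; exact: closed_ess_support.
have sub : E `\` ess_support E `<=` \bigcup_n B n.
  move=> x [Ex /existsNP[r /not_implyP[r0 /negP/negPn/eqP rx]]].
  have [a] := @rat_in_itvoo R (x.1 - r) x.1 ltac:(lra); rewrite in_itv/= => /andP[a1 a2].
  have [b] := @rat_in_itvoo R x.1 (x.1 + r) ltac:(lra); rewrite in_itv/= => /andP[b1 b2].
  have [c] := @rat_in_itvoo R (x.2 - r) x.2 ltac:(lra); rewrite in_itv/= => /andP[c1 c2].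
  have [d] := @rat_in_itvoo R x.2 (x.2 + r) ltac:(lra); rewrite in_itv/= => /andP[d1 d2].
  have i0 : mu2 (E `&` box (a, b, c, d)) = 0%E.
    apply: null_sub rx => //; first exact: measurable_rect.
    by apply: rectS; exact: ltW.
  have : exists n : nat, unpickle n = Some (a, b, c, d).
    by exists (pickle (a, b, c, d)); exact: pickleK.
  move=> [n nabcd]; exists n; first exact: Logic.I.
  rewrite /B nabcd i0 eqxx; split; first exact: Ex.
  by apply/rectP => /=; rewrite !ltW.
apply/eqP; rewrite -measure_le0.
apply: (@le_trans _ _ (mu2 (\bigcup_n B n))).
  by apply: le_measure; rewrite ?inE//; exact: bigcupT_measurable.
have : (mu2 (\bigcup_n B n) <= \sum_(0 <= n <oo) mu2 (B n))%E.
  apply: measure_sigma_subadditive => //; exact: bigcupT_measurable.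
by rewrite eseries0.
Qed.

Lemma measure_gt0_box S : measurable S -> mu2 S != 0%E ->
  exists2 M : R, 0 < M & 0 < mass S (grid_box M).
Proof.
move=> mS S0; apply: contrapT => H; move: S0 => /eqP; apply.
have B0 (n : nat) : mu2 (S `&` grid_box n.+1%:R) = 0%E.
  have mB := measurable_grid_box (n.+1%:R : R).
  have f := mass_fin mS mB (@subset_refl _ _).
  apply: contrapT => /eqP nz; apply: H; exists n.+1%:R => //.
  by rewrite /mass fine_gt0// lt0e nz measure_ge0 ltey_eq f.
apply/eqP; rewrite -measure_le0.
have mU : measurable (\bigcup_n (S `&` grid_box (n.+1%:R : R))).
  apply: bigcupT_measurable => n; apply: measurableI => //; exact: measurable_grid_box.
apply: (@le_trans _ _ (mu2 (\bigcup_n (S `&` grid_box (n.+1%:R : R))))).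
  apply: le_measure; rewrite ?inE// => x Sx.
  have [n Hn] := sqr_box_ge_norm x; have /sqr_boxP[x1 x2] := Hn n (leqnn n).
  exists n => //; split => //.
  have nn : n%:R < n.+1%:R :> R by rewrite ltr_nat.
  have H1 (t : R) : `|t| <= n%:R -> - n.+1%:R <= t < n.+1%:R.
    rewrite ler_norml => /andP[? ?]; apply/andP; split; lra.
  by rewrite /grid_box /= !in_itv/= !H1.
have : (mu2 (\bigcup_n (S `&` grid_box (n.+1%:R : R))) <=
    \sum_(0 <= n <oo) mu2 (S `&` grid_box (n.+1%:R : R)))%E.
  apply: measure_sigma_subadditive => //.
  by move=> n; apply: measurableI => //; exact: measurable_grid_box.
by rewrite eseries0.
Qed.

Lemma rect_measure (a b c d : R) : a <= b -> c <= d ->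
  mu2 (rect a b c d) = ((b - a) * (d - c))%:E.
Proof.
move=> ab cd; rewrite [LHS]product_measure1E//= !lebesgue_measure_itv/= !lte_fin.
have bnd (s t : R) : s <= t -> (if (s < t)%R then t%:E - s%:E else 0)%E = (t - s)%:E.
  by move=> st; case: ltP => // ts; rewrite (@le_anti _ _ s t) ?subrr// st.
by rewrite !bnd.
Qed.

Let step_contradiction (m P l : R) : 0 < l -> l * (256 * (P + 1)) < m ->
  m / 2 <= 128 * P * l -> False.
Proof.
move=> l0; have -> : l * (256 * (P + 1)) = 256 * (P * l) + 256 * l by ring.
by rewrite -mulrA; move: (P * l) => t; lra.
Qed.

Let budget_gt0 (P : R) : 0 <= P -> 0 < 256 * (P + 1).
Proof. by move=> P0; lra. Qed.

Section support_contradiction.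
Variables (F E : set (R * R)) (M : R).
Hypotheses (indF : indecomposable F) (hF : borel_hull F E) (M0 : 0 < M).
Let mE : measurable E. Proof. by case: hF. Qed.
Let S := ess_support E `\` E.
Let mS : measurable S.
Proof. by apply: measurableD => //; apply: closed_measurable2; exact: closed_ess_support. Qed.

(** The closure of the cell, which is the form that [square_field] expects. *)
Let corner n (ij : 'I_n.+1 * 'I_n.+1) : set (R * R) :=
  rect (node M n ij.1) (node M n ij.1 + step M n) (node M n ij.2) (node M n ij.2 + step M n).

Let cell_corner n (ij : 'I_n.+1 * 'I_n.+1) : cell M ij `<=` corner ij.
Proof.
move=> z; rewrite /cell/= !in_itv/= => -[/andP[? ?] /andP[? ?]].
by apply/rectP; split; apply/andP; split => //; exact: ltW.
Qed.

Let mcorner n (ij : 'I_n.+1 * 'I_n.+1) : measurable (corner ij).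
Proof. exact: measurable_rect. Qed.

(** E is disjoint from S, so its mass in the cell is at most what S leaves free; the edges added by
    closing the cell are null. *)
Let corner_light n (ij : 'I_n.+1 * 'I_n.+1) :
  step M n ^+ 2 - mass S (cell M ij) <= 512^-1 * step M n ^+ 2 ->
  (mu2 (E `&` corner ij) <= (step M n ^+ 2 / 512)%:E)%E.
Proof.
move=> Hij.
have mC := measurable_cell M ij; have CB := cell_box M0 (ij := ij).
have mEQ : measurable (E `&` corner ij) by exact: measurableI.
have mEC : measurable (E `&` cell M ij) by exact: measurableI.
have mQC : measurable (corner ij `\` cell M ij) by exact: measurableD.
have l0 := step_gt0 M0 n.
have muQ : mu2 (corner ij) = (step M n ^+ 2)%:E.
  rewrite [LHS]rect_measure ?lerDl ?(ltW l0)//.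
  by congr EFin; ring.
have Qfin : (mu2 (corner ij) < +oo)%E by rewrite muQ ltry.
have QC0 : mu2 (corner ij `\` cell M ij) = 0%E.
  have -> : mu2 (corner ij `\` cell M ij) =
      (mu2 (corner ij) - mu2 (corner ij `&` cell M ij))%E.
    by apply: measureD; [exact: mcorner|exact: mC|exact: Qfin].
  by rewrite (setIidr (@cell_corner n ij)) (cell_measure M0) muQ -EFinB subrr.
have -> : step M n ^+ 2 / 512 = 512^-1 * step M n ^+ 2 by rewrite mulrC.
have Ecell : (mu2 (E `&` cell M ij) <= (512^-1 * step M n ^+ 2)%:E)%E.
  rewrite -(fineK (mass_fin mE mC CB)) lee_fin; apply: le_trans Hij.
  rewrite -(mass_cellT M0 ij) -(massD measurableT mS mC CB (@subsetT _ S)).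
  apply: (mass_le mE (measurableD measurableT mS) mC CB).
  by move=> x Ex; split => // -[].
apply: (@le_trans _ _ (mu2 (E `&` cell M ij) + mu2 (corner ij `\` cell M ij))%E); last first.
  by rewrite QC0 adde0.
apply: (@le_trans _ _ (mu2 ((E `&` cell M ij) `|` (corner ij `\` cell M ij)))).
  apply: le_measure; rewrite ?inE//; first exact: measurableU.
  by move=> x [Ex Qx]; have [Cx|nCx] := pselect (cell M ij x); [left|right].
exact: measureU2.
Qed.

(** The concentric square of side l/3 has area l^2/9, more than the l^2/512 that S may leave
    uncovered, so S meets it; it lies strictly between the quarter lines. *)
Let corner_point n (ij : 'I_n.+1 * 'I_n.+1) (l := step M n) :
  l ^+ 2 - mass S (cell M ij) <= 512^-1 * l ^+ 2 ->
  exists x, [/\ S x, node M n ij.1 + l / 4 < x.1 < node M n ij.1 + 3 / 4 * l &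
    node M n ij.2 + l / 4 < x.2 < node M n ij.2 + 3 / 4 * l].
Proof.
move=> Hij; apply: contrapT => H.
have l0 : 0 < l by exact: step_gt0.
have mC := measurable_cell M ij; have CB := cell_box M0 (ij := ij).
set u := node M n ij.1 in H; set v := node M n ij.2 in H.
pose K := rect (u + l / 3) (u + 2 / 3 * l) (v + l / 3) (v + 2 / 3 * l).
have mK : measurable K by exact: measurable_rect.
have KC : K `<=` cell M ij.
  move=> z /rectP[/andP[? ?] /andP[? ?]]; rewrite /cell/= !in_itv/= -/u -/v -/l.
  by split; apply/andP; split; lra.
have KS : K `<=` ~` S.
  move=> z /rectP[/andP[? ?] /andP[? ?]] Sz; apply: H; exists z; split => //.
    by apply/andP; split; lra.
  by apply/andP; split; lra.
have muK : mu2 K = (l ^+ 2 / 9)%:E.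
  by rewrite [LHS]rect_measure; [congr EFin; field|lra|lra].
have : mass K (cell M ij) <= mass (setT `\` S) (cell M ij).
  apply: (mass_le mK (measurableD measurableT mS) mC CB).
  by move=> x /KS.
rewrite (massD measurableT mS mC CB (@subsetT _ S)) (mass_cellT M0).
rewrite {1}/mass (setIidl KC) muK/= => H2.
have := le_trans H2 Hij.
have : 0 < l ^+ 2 by rewrite exprn_gt0.
move: (l ^+ 2) => t; lra.
Qed.

Lemma support_mass0 : ~ (0 < mass S (grid_box M)).
Proof.
move=> S0.
have [[mF PF] _] := indF.
have fP : Per F \is a fin_num by rewrite ge0_fin_numE// Per_ge0.
set P := fine (Per F).
have P0 : 0 <= P by rewrite fine_ge0// Per_ge0.
have E0 : mu2 E != 0%E.
  apply/eqP => E0; have [x [Gx _]] : exists x, S x.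
    apply: contrapT => nS; move: S0; rewrite /mass.
    rewrite (_ : S = set0) ?set0I ?measure0 ?ltxx//; apply/seteqP; split => // x Sx.
    by apply: nS; exists x.
  have /eqP := Gx 1 ltr01; apply; apply/eqP; rewrite -measure_le0 -E0.
  apply: le_measure; rewrite ?inE//; first by apply: measurableI => //; exact: measurable_rect.
(* A positive real below the measure of E, which may be infinite. The mesh will be below min(1, m),
   so l^2/512 < m and no light square can contain almost all of E. *)
have [m m0 Em] : exists2 m : R, 0 < m & (m%:E <= mu2 E)%E.
  have [fE|nfE] := boolP (mu2 E \is a fin_num).
    exists (fine (mu2 E)); last by rewrite fineK.
    by rewrite fine_gt0// lt0e E0 measure_ge0 ltey_eq fE.
  exists 1 => //; move: nfE; rewrite ge0_fin_numE// -leNgt leye_eq => /eqP ->.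
  exact: leey.
have k01 : 0 < (512^-1 : R) <= 1 by apply/andP; split; lra.
have [N HN] := good_cells M0 mS S0 k01.
set ms := mass S (grid_box M) in S0 HN.
have m1 : 0 < Num.min 1 m by rewrite lt_min ltr01 m0.
have [N1 HN1] := step_small M m1.
have D0 := budget_gt0 P0.
(* At least ms / (2 l^2) cells contribute l/128 each, so P >= ms / (256 l); this mesh is too fine
   for that. Using P + 1 covers the case P = 0. *)
have [N2 HN2] := step_small M (divr_gt0 S0 D0).
pose n := maxn N (maxn N1 N2).
have [A [HA cA]] := HN n (leq_maxl _ _).
have sm := HN1 n (leq_trans (leq_maxl _ _) (leq_maxr _ _)).
have sS := HN2 n (leq_trans (leq_maxr _ _) (leq_maxr _ _)).
have l0 := step_gt0 M0 n.
set l := step M n in HA cA sm sS l0.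
have [|||phi [tphi _ Hphi]] := @sum_fields E _ (@cell R M n) (enum A) (l / 128) mE.
- exact: cell_disjoint.
- exact: enum_uniq.
- move=> ij; rewrite mem_enum => /HA Hij.
  have [x [[Gx _] x1 x2]] := corner_point Hij.
  have Ein := corner_light Hij.
  have Eout : mu2 (E `\` corner ij) != 0%E.
    apply/eqP => out0.
    have mEQ : measurable (E `&` corner ij) by exact: measurableI.
    have mEQ' : measurable (E `\` corner ij) by exact: measurableD.
    have : (mu2 E <= mu2 (E `&` corner ij) + mu2 (E `\` corner ij))%E.
      apply: (@le_trans _ _ (mu2 ((E `&` corner ij) `|` (E `\` corner ij)))).
        apply: le_measure; rewrite ?inE//; first exact: measurableU.
        by move=> y Ey; have [Qy|nQy] := pselect (corner ij y); [left|right].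
      exact: measureU2.
    rewrite out0 adde0 => h; have := le_trans Em (le_trans h Ein).
    rewrite lee_fin; apply/negP; rewrite -ltNge.
    move: sm; rewrite lt_min => /andP[sm1 sm2].
    apply: lt_trans sm2; rewrite -/l expr2.
    have : l * l < l by rewrite gtr_pMl.
    by move: (l * l) => t tl; lra.
  have [phi [tphi phi0 Hphi]] := square_field indF hF l0 x1 x2 Gx Eout Ein.
  exists phi; split => // z nCz.
  have [Qz|nQz] := pselect (corner ij z); last exact: phi0.
  apply: (field_zero_boundary (test_field_continuous tphi) phi0).
  apply: contrapT => H; apply: nCz; move: Qz => /rectP[/andP[z1 z2] /andP[z3 z4]].
  rewrite /cell/= !in_itv/= z1 z3/=.
  by split; rewrite ltNge; apply/negP => h; apply: H; [left|right].
- have : \int[mu2]_(z in E) div phi z <= P.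
    by rewrite /P -lee_fin (fineK fP); exact: (Per_le_integral hF).
  move=> /(le_trans Hphi); rewrite -cardE => H.
  have : ms / 2 <= 128 * P * l.
    apply: (le_trans cA).
    rewrite (_ : #|A|%:R * l ^+ 2 = #|A|%:R * (l / 128) * (128 * l)); last by rewrite expr2; field.
    rewrite (_ : 128 * P * l = P * (128 * l)); last by ring.
    by rewrite ler_wpM2r// mulr_ge0// ltW.
  move: sS; rewrite ltr_pdivlMr// -/l => sS H3.
  exact: step_contradiction l0 sS H3.
Qed.

End support_contradiction.

Lemma support_diff_null F E : indecomposable F -> borel_hull F E ->
  mu2 (ess_support E `\` E) = 0%E.
Proof.
move=> indF hF; have [_ mE _ _] := hF.
have mS : measurable (ess_support E `\` E).
  by apply: measurableD => //; apply: closed_measurable2; exact: closed_ess_support.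
apply: contrapT => /eqP S0; have [M M0 HM] := measure_gt0_box mS S0.
exact: support_mass0 indF hF M0 HM.
Qed.

End assembly.

(** * The closed representative and its BV distance *)

Section closed_representative.
Variable R : realType.
Notation mu2 := (borel_measure2 R).
Notation mub := (@lebesgue_measure2 R).
Implicit Types (A B E F G N : set (R * R)).

Let cT := caratheodory_type ((mu2)^*)%mu.

Lemma mub_le A B : A `<=` B -> (mub A <= mub B)%E.
Proof. exact: (le_outer_measure (mu2^*)%mu). Qed.

Lemma mub0_sub A B : A `<=` B -> mub B = 0%E -> mub A = 0%E.
Proof.
move=> AB B0; apply/eqP; rewrite eq_le outer_measure_ge0 andbT -B0; exact: mub_le.
Qed.

Lemma mub0U A B : mub A = 0%E -> mub B = 0%E -> mub (A `|` B) = 0%E.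
Proof.
move=> A0 B0; apply/eqP; rewrite eq_le outer_measure_ge0 andbT.
apply: le_trans; first exact: (outer_measureU2 (mu2^*)%mu).
by change (mub A + mub B <= 0)%E; rewrite A0 B0 adde0.
Qed.

Lemma lebesgue_measurable2_null N : mub N = 0%E -> lebesgue_measurable2 N.
Proof.
move=> N0; apply: (@le_caratheodory_measurable _ _ (mu2^*)%mu N) => X.
change (mub (X `&` N) + mub (X `&` ~` N) <= mub X)%E.
rewrite (mub0_sub (@subIsetr _ X N) N0) add0e; apply: mub_le; exact: subIsetl.
Qed.

(** The completed measure makes every subset of N measurable, hence every function is measurable on
    N and no regularity of f is asked for. *)
Lemma integral_null_support N (f : R * R -> \bar R) : mub N = 0%E ->
  (forall x, ~ N x -> f x = 0%E) -> (\int[mub]_x f x = 0)%E.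
Proof.
move=> N0 f0.
have mN : measurable (N : set cT) := lebesgue_measurable2_null N0.
have mf : measurable_fun (N : set cT) f.
  move=> _ B _; apply: lebesgue_measurable2_null; apply: mub0_sub N0; exact: subIsetl.
have fN : f = f \_ N.
  apply/funext => x; rewrite patchE; case: ifPn => // /negP nN; apply: f0 => Nx.
  by apply: nN; exact: mem_set.
rewrite fN -integral_mkcond; exact: null_set_integral.
Qed.

Lemma BV_norm_null A B : mub (A `\` B) = 0%E -> mub (B `\` A) = 0%E ->
  BV_norm (fun x => \1_A x - \1_B x) = 0%E.
Proof.
move=> AB BA; have N0 := mub0U AB BA.
have u0 x : ~ (A `\` B `|` B `\` A) x -> \1_A x - \1_B x = 0 :> R.
  move=> nx; rewrite !indicE (_ : (x \in A) = (x \in B)) ?subrr//.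
  apply/idP/idP => /set_mem H; apply/mem_set; apply: contrapT => H'; apply: nx; by [left|right].
rewrite /BV_norm (integral_null_support N0); last first.
  by move=> x /u0 ->; rewrite abse0.
rewrite add0e /total_variation2; apply/eqP; rewrite eq_le; apply/andP; split.
  apply: ge_ereal_sup => _ [phi tphi <-].
  by rewrite (integral_null_support N0)// => x /u0 ->; rewrite mul0r.
(* The zero field shows that the family is nonempty; the supremum of an empty one would be -oo. *)
apply: ereal_sup_ubound; exists (fun=> (0, 0)); first exact: test_field0.
by rewrite (integral_null_support N0)// => x /u0 ->; rewrite mul0r.
Qed.

Lemma support_representative F E : indecomposable F -> borel_hull F E ->
  mub (F `\` ess_support E) = 0%E /\ mub (ess_support E `\` F) = 0%E.
Proof.
move=> indF hF; have [_ mE FE EF0] := hF.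
have mG : measurable (ess_support E) by apply: closed_measurable2; exact: closed_ess_support.
have EG0 : mub (E `\` ess_support E) = 0%E.
  by rewrite lebesgue_measure2_borel; [exact: null_off_ess_support|exact: measurableD].
have GE0 : mub (ess_support E `\` E) = 0%E.
  by rewrite lebesgue_measure2_borel; [exact: support_diff_null indF hF|exact: measurableD].
split.
- by apply: mub0_sub EG0; exact: setSD.
- apply: mub0_sub (mub0U GE0 EF0) => x [Gx nFx].
  by have [Ex|nEx] := pselect (E x); [right|left].
Qed.

Lemma eball_sub_rect (x : R * R) (r : R) :
  eball x r `<=` rect (x.1 - r) (x.1 + r) (x.2 - r) (x.2 + r).
Proof.
move=> y; rewrite /eball/= /enorm => h.
have H (t s : R) : Num.sqrt (t ^+ 2 + s ^+ 2) < r -> `|t| < r.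
  apply: le_lt_trans; rewrite -sqrtr_sqr ler_wsqrtr// lerDl sqr_ge0//.
have h1 := H _ _ h; move: h; rewrite addrC => /H h2.
move: h1 h2; rewrite !ltr_norml /= => /andP[? ?] /andP[? ?].
by apply/rectP; split; apply/andP; split; lra.
Qed.

(** A point of F outside the support would have a ball that F does not charge and so lie in [Neg F];
    as the support is closed, it contains the closure. Conversely, E charges every square around a
    support point, and since E differs from F by a null set, F meets that square. *)
Lemma closure_shaved F E : shaved F -> borel_hull F E -> closure F = ess_support E.
Proof.
move=> shF [mF mE FE EF0].
have mER a b c d : measurable (E `&` rect a b c d).
  by apply: measurableI => //; exact: measurable_rect.
apply/seteqP; split.
- rewrite [X in _ `<=` X](iffLR (closure_id _) (closed_ess_support mE)).
  apply: closureS => x Fx r r0; apply/eqP => E0.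
  have : Neg F x.
    split => //; exists r; split => //.
    apply: (@mub0_sub _ (E `&` rect (x.1 - r) (x.1 + r) (x.2 - r) (x.2 + r))).
      by move=> y [/eball_sub_rect Ry Fy]; split => //; exact: FE.
    by rewrite lebesgue_measure2_borel//; exact: E0.
  by rewrite shF.
- move=> x Gx U; rewrite -nbhs_ballE => -[e /= e0 eU].
  have /eqP := Gx (e / 2) (divr_gt0 e0 (ltr0Sn _ _)).
  move=> E0; apply/set0P/eqP => FU; apply: E0.
  rewrite -lebesgue_measure2_borel//; apply: mub0_sub EF0.
  move=> y [Ey /rectP[/andP[? ?] /andP[? ?]]]; split => // Fy.
  suff : (F `&` U) y by rewrite FU.
  split => //; apply: eU.
  by split; rewrite /ball/= ltr_distlC; apply/andP; split; lra.
Qed.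

End closed_representative.

Theorem theorem1 (R : realType) :
  (forall F : set (R * R), shaved F -> indecomposable F ->
     BV_norm (fun x => \1_F x - \1_(closure F) x) = 0%E) /\
  (forall F : set (R * R), indecomposable F ->
     exists G : set (R * R), closed G /\
       BV_norm (fun x => \1_F x - \1_G x) = 0%E).
Proof.
have hull (F : set (R * R)) : indecomposable F -> exists E, borel_hull F E.
  move=> [[mF _] _]; have [E [mE FE EF0]] := lebesgue_measurable2_hull mF.
  by exists E; split.
split=> F.
  move=> shF indF; have [E hF] := hull F indF.
  rewrite (closure_shaved shF hF).
  by have [FG GF] := support_representative indF hF; exact: BV_norm_null.
move=> indF; have [E hF] := hull F indF; exists (ess_support E).
have [FG GF] := support_representative indF hF.
split; last exact: BV_norm_null.
by case: hF => _ mE _ _; exact: closed_ess_support.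
Qed.
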